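(* Let $f:M\to\mathbb{R}^3$ be a CMC surface ($H=1$, not a round sphere) with Gauss map $N$, let $\mu\in\mathbb{C}\setminus\{0,\pm1\}$, $a=\frac{\mu+\mu^{-1}}2$, $b=i\frac{\mu^{-1}-\mu}2$, let $\alpha$ be a non-trivial $d^N_\mu$-parallel section and $\beta=\frac12(N\alpha(a-1)+\alpha b)$. The simple factor dressing $\check f=r^N_{E,\mu}(f)$ given by $E=\alpha\mathbb{C}$ is, up to possible translation, a 2-step Darboux transform of $f$. More precisely, up to translation, the simple factor dressing is given by $$\check f=f-\alpha\frac{b}{a-1}\alpha^{-1},$$ and $\check f$ is a common Darboux transform of the $\mu$-Darboux transform $f^\mu=f+\alpha\beta^{-1}$ of $f$ given by $\alpha$ and of the parallel CMC surface $g=f+N$, which is a $\mu$-Darboux transform of $f$ at $\mu_0=-1$.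
   Context: $\mathbb{H}=\mathrm{span}_{\mathbb{R}}\{1,i,j,k\}=\mathbb{R}^4$, $\mathbb{R}^3=\mathrm{Im}\,\mathbb{H}$, $S^2=\{n\in \mathrm{Im}\,\mathbb{H}: n^2=-1\}$, $\mathbb{C}=\mathrm{span}_{\mathbb{R}}\{1,i\}$ acting by right multiplication, $\mathbb{H}=\mathbb{C}^2$. $M$ is a Riemann surface with universal cover $\tilde M$; $*\omega(X)=\omega(JX)$. CMC surface: conformal immersion $f:M\to\mathbb{R}^3$ with Gauss map $N$ ($*df=N\,df=-df\,N$), normalized to mean curvature $1$, i.e. $df=-\frac12(dN-N*dN)$. The associated family of $N$ is $d^N_\lambda=d+(\lambda-1)A^{(1,0)}+(\lambda^{-1}-1)A^{(0,1)}$, $\lambda\in\mathbb{C}\setminus\{0\}$, with $A=\frac14( *dN+N\,dN)$, $A^{(1,0)}=\frac12(A-I*A)$, $A^{(0,1)}=\frac12(A+I*A)$, $I$ right multiplication by $i$; equivalently $d^N_\lambda\alpha=d\alpha+\frac12 df(N\alpha(a_\lambda-1)+\alpha b_\lambda)$, $a_\lambda=\frac{\lambda+\lambda^{-1}}2$, $b_\lambda=i\frac{\lambda^{-1}-\lambda}2$. Simple factor dressing: for a $d^N_\mu$-stable complex line bundle $E$ over $\tilde M$ with $\tilde M\times\mathbb{C}^2=E\oplus Ej$ let $r_\lambda=\pi_E\gamma_\lambda+\pi_{Ej}$, $\gamma_\lambda=\frac{1-\bar\mu^{-1}}{1-\mu}\frac{\lambda-\mu}{\lambda-\bar\mu^{-1}}$.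 Then $r_\lambda\cdot d^N_\lambda=r_\lambda\circ d^N_\lambda\circ r_\lambda^{-1}$ is the associated family $d^{\check N}_\lambda$ of a harmonic map $\check N:\tilde M\to S^2$, and $r^N_{E,\mu}(f)=\check f$ is the CMC surface (mean curvature $1$) in $\mathbb{R}^3$ with Gauss map $\check N$ (determined up to translation). It is known that for $E=\alpha\mathbb{C}$, $d^N_\mu\alpha=0$, one has $\check N=TNT^{-1}$, $T=\alpha\beta^{-1}$, with $\beta$ as in the claim. $\mu$-Darboux transform of $f$: $D^N_{\alpha,\mu}(f)=f+\alpha\beta^{-1}$ with $\alpha\ne0$ $d^N_\mu$-parallel and $\beta=\frac12(N\alpha(a_\mu-1)+\alpha b_\mu)$. For $\mu_0=-1$ one gets $\beta_0=-N\alpha_0$ and the transform $g=f+N$. Darboux transform: for a conformal immersion $h$ with line bundle $L=\begin{pmatrix}h\\1\end{pmatrix}\mathbb{H}$, a line bundle $\hat L=\varphi\mathbb{H}$ over $\tilde M$ with $d\varphi\in\Omega^1(\tilde L)$ and $\tilde M\times\mathbb{H}^2=\hat L\oplus\tilde L$. A 2-step Darboux transform of $f$ is one obtained by Bianchi permutability: if $\varphi_1,\varphi_2$ (with $d\varphi_l\in\Omega^1(\tilde L)$) define Darboux transforms $f_1,f_2$ of $f$ and $d\varphi_2=d\varphi_1\chi$, then $(\varphi_2-\varphi_1\chi)\mathbb{H}$ is a common Darboux transform of $f_1$ and $f_2$; here $\varphi_l=\begin{pmatrix}1\\0\end{pmatrix}\alpha_l+\begin{pmatrix}f\\1\end{pmatrix}\beta_l$.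 *)

(* Defs.v *)
From HB Require Import structures.
From mathcomp Require Import all_boot all_order all_algebra.
From mathcomp Require Import complex.
From mathcomp Require Import all_classical all_reals all_analysis.
From mathcomp Require Import ring lra.

Set Implicit Arguments.
Unset Strict Implicit.
Unset Printing Implicit Defensive.

Import Order.TTheory GRing.Theory Num.Theory numFieldNormedType.Exports.

Local Open Scope classical_set_scope.
Local Open Scope ring_scope.

Record quat (R : realType) := Quat { q1 : R; qi : R; qj : R; qk : R }.
Arguments q1 {R} _.
Arguments qi {R} _.
Arguments qj {R} _.
Arguments qk {R} _.

Section QuatRing.
Variable R : realType.
Implicit Types x y z : quat R.

Definition quat_enc x := (q1 x, qi x, qj x, qk x).
Definition quat_dec (t : R * R * R * R) :=
  Quat t.1.1.1 t.1.1.2 t.1.2 t.2.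
Lemma quat_encK : cancel quat_enc quat_dec. Proof. by case. Qed.

HB.instance Definition _ := Choice.copy (quat R) (can_type quat_encK).

Definition addq x y :=
  Quat (q1 x + q1 y) (qi x + qi y) (qj x + qj y) (qk x + qk y).
Definition oppq x := Quat (- q1 x) (- qi x) (- qj x) (- qk x).
Definition mulq x y := Quat
  (q1 x * q1 y - qi x * qi y - qj x * qj y - qk x * qk y)
  (q1 x * qi y + qi x * q1 y + qj x * qk y - qk x * qj y)
  (q1 x * qj y - qi x * qk y + qj x * q1 y + qk x * qi y)
  (q1 x * qk y + qi x * qj y - qj x * qi y + qk x * q1 y).
Definition qnorm2 x := q1 x ^+ 2 + qi x ^+ 2 + qj x ^+ 2 + qk x ^+ 2.
Definition invq x :=
  let n := qnorm2 x in Quat (q1 x / n) (- qi x / n) (- qj x / n) (- qk x / n).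

Fact addqA : associative addq.
Proof. by case=> ? ? ? ? [? ? ? ?] [? ? ? ?]; rewrite /addq /= !addrA. Qed.
Fact addqC : commutative addq.
Proof. by case=> ? ? ? ? [? ? ? ?]; congr Quat; rewrite /= addrC. Qed.
Fact add0q : left_id (Quat 0 0 0 0) addq.
Proof. by case=> ? ? ? ?; rewrite /addq /= !add0r. Qed.
Fact addNq : left_inverse (Quat 0 0 0 0) oppq addq.
Proof. by case=> ? ? ? ?; rewrite /addq /= !addNr. Qed.

HB.instance Definition _ :=
  GRing.isZmodule.Build (quat R) addqA addqC add0q addNq.

Fact mulqA : associative mulq.
Proof. by case=> ? ? ? ? [? ? ? ?] [? ? ? ?]; congr Quat => /=; ring. Qed.
Fact mul1q : left_id (Quat 1 0 0 0) mulq.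
Proof. by case=> ? ? ? ?; congr Quat => /=; ring. Qed.
Fact mulq1 : right_id (Quat 1 0 0 0) mulq.
Proof. by case=> ? ? ? ?; congr Quat => /=; ring. Qed.
Fact mulqDl : left_distributive mulq +%R.
Proof. by case=> ? ? ? ? [? ? ? ?] [? ? ? ?]; congr Quat => /=; ring. Qed.
Fact mulqDr : right_distributive mulq +%R.
Proof. by case=> ? ? ? ? [? ? ? ?] [? ? ? ?]; congr Quat => /=; ring. Qed.
Fact oneq_neq0 : Quat 1 0 0 0 != 0 :> quat R.
Proof. by apply/eqP => -[/eqP]; rewrite oner_eq0. Qed.

HB.instance Definition _ := GRing.Zmodule_isNzRing.Build (quat R)
  mulqA mul1q mulq1 mulqDl mulqDr oneq_neq0.

Fact qnorm2_neq0 x : x != 0 -> qnorm2 x != 0.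
Proof.
apply: contra => /eqP n0; apply/eqP; move: n0.
case: x => a b c d; rewrite /qnorm2 /= => n0.
have [a2 b2 c2 d2] : [/\ 0 <= a ^+ 2, 0 <= b ^+ 2, 0 <= c ^+ 2 & 0 <= d ^+ 2].
  by split; apply: sqr_ge0.
by congr Quat; apply/eqP; rewrite -sqrf_eq0; apply/eqP; lra.
Qed.

Fact mulVq : {in [pred x : quat R | x != 0], left_inverse 1 invq *%R}.
Proof.
move=> x; rewrite inE => /qnorm2_neq0; case: x => a b c d.
by rewrite /qnorm2 /= => n0; congr Quat; rewrite /invq /qnorm2 /=; field.
Qed.
Fact mulqV : {in [pred x : quat R | x != 0], right_inverse 1 invq *%R}.
Proof.
move=> x; rewrite inE => /qnorm2_neq0; case: x => a b c d.
by rewrite /qnorm2 /= => n0; congr Quat; rewrite /invq /qnorm2 /=; field.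
Qed.
Fact unitqP x y : y * x = 1 /\ x * y = 1 -> [pred x : quat R | x != 0] x.
Proof.
case=> yx _; apply/negP => /= /eqP x0; move/eqP: yx.
by rewrite x0 mulr0 eq_sym oner_eq0.
Qed.
Fact invq_out : {in [predC [pred x : quat R | x != 0]], invq =1 id}.
Proof.
move=> x; rewrite inE /= negbK => /eqP ->.
by congr Quat; rewrite /= ?oppr0 mul0r.
Qed.

HB.instance Definition _ := GRing.NzRing_hasMulInverse.Build (quat R)
  mulVq mulqV unitqP invq_out.

End QuatRing.

(** The embedding of the complex numbers as span{1, i}; they act on quaternions
    by multiplication on the right. *)
Definition cplx (R : realType) (z : R[i]) : quat R :=
  Quat (complex.Re z) (complex.Im z) 0 0.

Definition quat_i (R : realType) : quat R := Quat 0 1 0 0.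
Definition quat_j (R : realType) : quat R := Quat 0 0 1 0.

Definition imaginary (R : realType) (x : quat R) := q1 x = 0.

Fixpoint iterD (R : realType) (s : seq (R * R)) (F : R * R -> R) : R * R -> R :=
  if s is v :: s' then fun x => 'D_v (iterD s' F) x else F.

(** C^infinity on the open set [U]: all iterated directional derivatives are (Frechet)
    differentiable, hence continuous. *)
Definition smooth_on (R : realType) (U : set (R * R)) (F : R * R -> R) :=
  forall s x, U x -> differentiable (iterD s F) x.

Definition rotJ (R : realType) (v : R * R) : R * R := (- v.2, v.1).

(** Smooth solutions of the Cauchy-Riemann equations. *)
Definition holomorphic_on (R : realType) (U : set (R * R))
    (F : R * R -> R * R) :=
  let u x := (F x).1 in let w x := (F x).2 in
  [/\ smooth_on U u, smooth_on U w &
    forall x v, U x ->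
      'D_(rotJ v) u x = - 'D_v w x /\ 'D_(rotJ v) w x = 'D_v u x].

Record chart (R : realType) (X : topologicalType) := Chart {
  dom : set X;
  img : set (R * R);
  coord : X -> R * R;
  cinv : R * R -> X;
  dom_open : open dom;
  img_open : open img;
  coord_img : forall p, dom p -> img (coord p) /\ cinv (coord p) = p;
  cinv_dom : forall x, img x -> dom (cinv x) /\ coord (cinv x) = x;
  coord_cont : forall p, dom p -> {for p, continuous coord};
  cinv_cont : forall x, img x -> {for x, continuous cinv}
}.

Record riemannSurface (R : realType) := RiemannSurface {
  carrier :> topologicalType;
  atlas : set (chart R carrier);
  rs_hausdorff : hausdorff_space carrier;
  rs_connected : connected [set: carrier];
  atlas_cover : forall p, exists2 c, atlas c & dom c p;
  atlas_compat : forall c c', atlas c -> atlas c' ->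
    holomorphic_on (img c `&` cinv c @^-1` dom c') (coord c' \o cinv c)
}.

Section Covering.
Variable R : realType.

Definition holomorphic_map (X Y : riemannSurface R) (f : X -> Y) :=
  continuous f /\
  forall c c', atlas c -> atlas c' ->
    holomorphic_on (img c `&` cinv c @^-1` (f @^-1` dom c'))
                   (coord c' \o f \o cinv c).

Definition evenly_covered (X Y : topologicalType) (f : X -> Y) (U : set Y) :=
  exists S : set (set X),
    [/\ forall V, S V -> open V,
        forall V W, S V -> S W -> V `&` W !=set0 -> V = W,
        f @^-1` U = \bigcup_(V in S) V &
        forall V, S V -> exists s : Y -> X,
          (forall y, U y -> [/\ {for y, continuous s}, V (s y) & f (s y) = y]) /\
          (forall x, V x -> s (f x) = x)].

Definition covering_map (X Y : topologicalType) (f : X -> Y) :=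
  [/\ continuous f, forall y, exists x, f x = y &
    forall y, exists U, [/\ open U, U y & evenly_covered f U]].

Definition is_path (X : topologicalType) (x y : X) (g : R -> X) :=
  [/\ {within `[0, 1], continuous g}, g 0 = x & g 1 = y].

Definition simply_connected (X : topologicalType) :=
  (forall x y : X, exists g, is_path x y g) /\
  forall (x y : X) (g0 g1 : R -> X), is_path x y g0 -> is_path x y g1 ->
    exists H : R * R -> X,
      [/\ {within `[0, 1] `*` `[0, 1], continuous H},
          forall t, t \in `[0, 1] -> H (0, t) = g0 t /\ H (1, t) = g1 t &
          forall s, s \in `[0, 1] -> H (s, 0) = x /\ H (s, 1) = y].

Definition universal_cover (M Mt : riemannSurface R) (pr : Mt -> M) :=
  [/\ holomorphic_map pr, covering_map pr & simply_connected Mt].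

End Covering.

Section Forms.
Variables (R : realType) (X : riemannSurface R).
Local Notation H := (quat R).

Definition smooth_in (U : set X) (F : X -> H) := forall c, atlas c ->
  let W := img c `&` cinv c @^-1` U in
  [/\ smooth_on W (q1 \o F \o cinv c), smooth_on W (qi \o F \o cinv c),
      smooth_on W (qj \o F \o cinv c) & smooth_on W (qk \o F \o cinv c)].

Definition smooth (F : X -> H) := smooth_in [set: X] F.

(** A 1-form is given by its expression in charts: [w c p v] is its value on
    the tangent vector at [p] represented in the chart [c] by [v]; only the
    values for [c] in the atlas and [p] in the domain of [c] are relevant. *)
Definition form := chart R X -> X -> R * R -> H.

Definition form_eq (w w' : form) :=
  forall c p v, atlas c -> dom c p -> w c p v = w' c p v.

Definition d (F : X -> H) : form := fun c p v =>
  Quat ('D_v (q1 \o F \o cinv c) (coord c p))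
       ('D_v (qi \o F \o cinv c) (coord c p))
       ('D_v (qj \o F \o cinv c) (coord c p))
       ('D_v (qk \o F \o cinv c) (coord c p)).

(** ( *w)(X) = w(J X), where J is multiplication by i in any holomorphic
    chart. *)
Definition star (w : form) : form := fun c p v => w c p (rotJ v).

Definition addf (w w' : form) : form := fun c p v => w c p v + w' c p v.
Definition oppf (w : form) : form := fun c p v => - w c p v.
Definition lmulf (F : X -> H) (w : form) : form := fun c p v => F p * w c p v.
Definition rmulf (w : form) (F : X -> H) : form := fun c p v => w c p v * F p.
Definition zerof : form := fun _ _ _ => 0.
Definition cstf (q : H) : X -> H := fun=> q.

(** [N] takes values in the 2-sphere, [f] is weakly conformal with Gauss map
    [N], and the mean curvature is normalized to 1. *)
Definition weak_cmc (f N : X -> H) :=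
  [/\ smooth f /\ smooth N,
      forall p, imaginary (f p),
      forall p, imaginary (N p) /\ N p * N p = -1,
      form_eq (star (d f)) (lmulf N (d f)) /\
      form_eq (star (d f)) (oppf (rmulf (d f) N)) &
      form_eq (d f)
        (lmulf (cstf (- 2^-1)) (addf (d N) (oppf (lmulf N (star (d N))))))].

Definition immersion (f : X -> H) :=
  forall c p v, atlas c -> dom c p -> d f c p v = 0 -> v = 0.

Definition cmc_surface (f N : X -> H) := weak_cmc f N /\ immersion f.

(** [f] maps into a round sphere of the 3-space of imaginary quaternions. *)
Definition round_sphere (f : X -> H) := exists m r,
  [/\ imaginary m, 0 < r & forall p, qnorm2 (f p - m) = r ^+ 2].

Definition Aform (N : X -> H) : form :=
  lmulf (cstf 4^-1) (addf (star (d N)) (lmulf N (d N))).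

(** The forms A, A^(1,0), A^(0,1) have values in the endomorphisms: A acts by
    left multiplication, and the complex structure I is right multiplication
    by i. *)
Definition A10 (N s : X -> H) : form :=
  lmulf (cstf 2^-1)
    (addf (rmulf (Aform N) s)
          (oppf (rmulf (rmulf (star (Aform N)) s) (cstf (quat_i R))))).
Definition A01 (N s : X -> H) : form :=
  lmulf (cstf 2^-1)
    (addf (rmulf (Aform N) s)
          (rmulf (rmulf (star (Aform N)) s) (cstf (quat_i R)))).

Definition assoc (N : X -> H) (l : R[i]) (s : X -> H) : form :=
  addf (d s) (addf (rmulf (A10 N s) (cstf (cplx (l - 1))))
                   (rmulf (A01 N s) (cstf (cplx (l^-1 - 1))))).

Definition parallel (N : X -> H) (l : R[i]) (s : X -> H) :=
  smooth s /\ form_eq (assoc N l s) zerof.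

Definition nontrivial (s : X -> H) := exists p, s p <> 0.

Definition coef_a (l : R[i]) : R[i] := (l + l^-1) / 2.
Definition coef_b (l : R[i]) : R[i] := 'i%C * (l^-1 - l) / 2.

Definition beta (N : X -> H) (l : R[i]) (s : X -> H) : X -> H := fun p =>
  2^-1 * (N p * s p * cplx (coef_a l - 1) + s p * cplx (coef_b l)).

Definition mu_transform (f N : X -> H) (l : R[i]) (s : X -> H) : X -> H :=
  fun p => f p + s p * (beta N l s p)^-1.

Definition is_mu_darboux (f N : X -> H) (l : R[i]) (h : X -> H) :=
  exists s, [/\ parallel N l s, nontrivial s, forall p, beta N l s p <> 0 &
                h =1 mu_transform f N l s].

Definition direct_sum (V : zmodType) (A B : set V) :=
  (forall v, exists a b, [/\ A a, B b & v = a + b]) /\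
  (forall v, A v -> B v -> v = 0).

(** A section of the trivial H^2-bundle is a pair of functions. *)
Definition pairsec (phi psi : X -> H) (p : X) : H * H := (phi p, psi p).

Definition span2 (phi : X -> H * H) (p : X) : set (H * H) :=
  [set w | exists q, w = ((phi p).1 * q, (phi p).2 * q)].

Definition line (h : X -> H) (p : X) : set (H * H) := span2 (pairsec h (cstf 1)) p.

Definition fst_sec (phi : X -> H * H) : X -> H := fun p => (phi p).1.
Definition snd_sec (phi : X -> H * H) : X -> H := fun p => (phi p).2.

(** The map [h] may have branch points: the condition only involves its line
    bundle. *)
Definition darboux_section (h : X -> H) (phi : X -> H * H) :=
  [/\ smooth (fst_sec phi) /\ smooth (snd_sec phi),
      forall c p v, atlas c -> dom c p ->
        line h p (d (fst_sec phi) c p v, d (snd_sec phi) c p v) &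
      forall p, direct_sum (span2 phi p) (line h p)].

Definition section_of (h : X -> H) (phi : X -> H * H) :=
  forall p, span2 phi p = line h p.

Definition is_darboux (h k : X -> H) :=
  exists phi, darboux_section h phi /\ section_of k phi.

(** [k] is obtained from the Darboux transforms [f1] and [f2] of [f] by Bianchi
    permutability. *)
Definition bianchi (f f1 f2 k : X -> H) :=
  exists (phi1 phi2 : X -> H * H) (chi : X -> H),
    [/\ darboux_section f phi1 /\ section_of f1 phi1,
        darboux_section f phi2 /\ section_of f2 phi2,
        smooth chi,
        form_eq (d (fst_sec phi2)) (rmulf (d (fst_sec phi1)) chi) /\
        form_eq (d (snd_sec phi2)) (rmulf (d (snd_sec phi1)) chi) &
        section_of k (fun p => ((phi2 p).1 - (phi1 p).1 * chi p,
                                (phi2 p).2 - (phi1 p).2 * chi p))].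

Definition two_step_darboux (f k : X -> H) := exists f1 f2, bianchi f f1 f2 k.

Definition cspan (s : X -> H) (p : X) : set H :=
  [set w | exists z : R[i], w = s p * cplx z].

Definition timesj (E : set H) : set H := [set e * quat_j R | e in E].

Definition complex_line_bundle (E : X -> set H) := forall p, exists U s,
  [/\ open U, U p, smooth_in U s & forall q, U q -> s q <> 0 /\ E q = cspan s q].

Definition stable (N : X -> H) (l : R[i]) (E : X -> set H) :=
  forall U s, open U -> smooth_in U s -> (forall q, U q -> E q (s q)) ->
  forall c p v, atlas c -> dom c p -> U p -> E p (assoc N l s c p v).

(** The projection onto [A] along [B], for complementary [A] and [B]. *)
Definition proj (A B : set H) (v : H) : H := xget 0 [set a | A a /\ B (v - a)].

Definition dress_factor (mu l : R[i]) : R[i] :=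
  (1 - (conjc mu)^-1) / (1 - mu) * ((l - mu) / (l - (conjc mu)^-1)).

Definition dress (E : X -> set H) (mu l : R[i]) (p : X) (v : H) : H :=
  proj (E p) (timesj (E p)) v * cplx (dress_factor mu l)
  + proj (timesj (E p)) (E p) v.

(** [h] is a simple factor dressing, given by [E] and [mu], of a CMC surface
    with Gauss map [N]. The gauge equation
    d^Nc_l = r_l o d^N_l o r_l^-1 is stated as d^Nc_l o r_l = r_l o d^N_l; the
    excluded values of [l] are those where r_l is not defined or not
    invertible. *)
Definition is_simple_factor_dressing (N : X -> H) (mu : R[i]) (E : X -> set H)
    (h : X -> H) :=
  [/\ complex_line_bundle E,
      forall p, direct_sum (E p) (timesj (E p)),
      stable N mu E &
      exists Nc, cmc_surface h Nc /\
        forall l, l != 0 -> l != mu -> l != (conjc mu)^-1 ->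
        forall s, smooth s ->
          form_eq (assoc Nc l (fun p => dress E mu l p (s p)))
                  (fun c p v => dress E mu l p (assoc N l s c p v))].

End Forms.

(* Main.v *)
From HB Require Import structures.
Require Import Defs.
From mathcomp Require Import all_boot all_order all_algebra.
From mathcomp Require Import complex.
From mathcomp Require Import all_classical all_reals all_analysis.
From mathcomp Require Import ring lra.

Set Implicit Arguments.
Unset Strict Implicit.
Unset Printing Implicit Defensive.

Import Order.TTheory GRing.Theory Num.Theory numFieldNormedType.Exports.

Local Open Scope classical_set_scope.
Local Open Scope ring_scope.

(* Since *df = N df = -df N, parallelity reads d alpha = - df beta, and the mean curvature
   condition gives d beta = 1/2 dg alpha (a - 1) for g = f + N. Put T = alpha beta^-1 and
   c = alpha b / (a - 1) alpha^-1. Then T N T^-1 = T + c, and df_check = - 2 S df T^-1 with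
   S = 1/2 (N + c) invertible; so f_check = f - c is a conformal immersion with Gauss map
   T + c = f^mu - f_check, and since *df^mu = - (T + c) df^mu it has mean curvature 1.

   In the Cayley coordinate b_l / (a_l - 1) of the spectral parameter, the dressing matrix
   conjugated by alpha is, up to a scalar, left multiplication subtracted from right
   multiplication, and the gauge equation becomes an identity using only N^2 = -1 and
   N df = - df N. Comparing the families at l = -1 determines df_check from the gauge
   equation.

   For Bianchi permutability, d beta_0 = d beta chi holds with
   chi = - 2 (a - 1)^-1 alpha^-1 alpha_0, where alpha_0 is a global parallel section at
   l = -1: it exists locally by flatness, and on the simply connected surface by
   continuation along paths. Sections controlled by their derivative vanish identically or
   nowhere, so alpha and alpha_0 have no zeros. The projection of the universal covering is
   an immersion because an injective holomorphic function has nonvanishing derivative, by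
   a maximum principle. *)

(** * Calculus in the plane *)

(** Two scalar facts drive the algebra: N^2 = -1 and a^2 + b^2 = 1. With c0 = b / (a - 1) the second
    reads (a - 1) (1 + c0^2) = - 2, and together they give N beta = alpha + beta c0. The conjugation
    formula for T, the invertibility of S and the cancellation in d beta all come from this
    relation. No surface is integrated from its Gauss map: f_check is explicit, and f^mu plays for
    it the part of the parallel surface that g plays for f. Conjugation by alpha keeps real parts,
    so f_check has the constant real part - Re c0 and needs a translation before it lies in Im H.
    The value l = -1 is special because b = 0 and a - 1 = - 2 is real there. The connection is then
    linear over the right action of all of H, so one parallel section normalized to 1 at a point
    spans all of them over H; transport and gluing only have to adjust right factors. The section
    alpha_0 is not part of the data, and a covering projection comes only with continuous local
    inverses. These two gaps account for the analysis: a linear equation with uniform existence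
    radius, a lifting argument on squares, and the injectivity theorem. *)

Section PlaneCalculus.
Variable R : realType.
Implicit Types (U : set (R * R)) (F G : R * R -> R) (x v : R * R).

Lemma pairE v : v = v.1 *: ((1, 0) : R * R) + v.2 *: ((0, 1) : R * R).
Proof.
case: v => a b; congr (_, _) => /=.
  by rewrite /GRing.scale /= mulr1 mulr0 addr0.
by rewrite /GRing.scale /= mulr1 mulr0 add0r.
Qed.

Lemma differentiable_deriv F x v : differentiable F x ->
  'D_v F x = v.1 * 'D_(1, 0) F x + v.2 * 'D_(0, 1) F x.
Proof.
by move=> dF; rewrite !deriveE // [in LHS](pairE v) linearD !linearZ.
Qed.

Lemma differentiable_eps F x : differentiable F x ->
  forall e : R, 0 < e -> \forall h \near (0 : R * R),
    `|F (h + x) - F x - 'D_h F x| <= e * `|h|.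
Proof.
move=> dF e e0; near=> h.
have aux (a b c : R) : a + b + c - a - b = c by ring.
by rewrite (diff_locallyx dF h) deriveE // aux; near: h; apply: littleoP.
Unshelve. all: by end_near. Qed.

(** Differentials are unique, so an explicit first-order expansion identifies the differential. This
    gives differentiability of functions known only through estimates, such as the section built in
    [flat_section]. *)
Lemma eps_differentiable F x (a b : R) :
  (forall e : R, 0 < e -> \forall h \near (0 : R * R),
    `|F (h + x) - F x - (h.1 * a + h.2 * b)| <= e * `|h|) ->
  differentiable F x /\ forall v, 'D_v F x = v.1 * a + v.2 * b.
Proof.
move=> H.
pose L (h : R * R) := h.1 * a + h.2 * b.
have Llin : linear L.
  by move=> k u v; rewrite /L /= /GRing.scale /=; ring.
pose LM := GRing.isLinear.Build _ _ _ _ _ Llin.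
pose LL : {linear (R * R)%type -> R} := HB.pack L LM.
have Lc : continuous LL.
  move=> h; apply: (@cvgD _ R^o); apply: (@cvgM R); try exact: cvg_cst.
    exact: cvg_fst.
  exact: cvg_snd.
have FL : F \o shift x = cst (F x) + LL +o_ (0 : R * R) id.
  apply/eqaddoP => _/posnumP[e]; near=> h.
  have -> : (F \o shift x - (cst (F x) + LL)) h
      = F (h + x) - F x - (h.1 * a + h.2 * b) by rewrite -addrA -opprD.
  near: h; exact: H.
have dL := diff_unique Lc FL.
have dF : differentiable F x by apply/diff_locallyP; rewrite dL.
by split => // v; rewrite deriveE // dL.
Unshelve. all: by end_near. Qed.

Lemma near_eq_differentiable F G x : (\near x, F x = G x) ->
  differentiable F x -> differentiable G x.
Proof.
move=> FG dF.
have FGx : F x = G x by exact: nbhs_singleton FG.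
apply: (proj1 (@eps_differentiable G x ('D_(1, 0) F x) ('D_(0, 1) F x) _)).
move=> e e0; near=> h.
rewrite -differentiable_deriv // -FGx.
have <- : F (h + x) = G (h + x).
  near: h; move: FG; rewrite (near_shift 0) subr0; apply: filterS => h /=.
  by [].
by near: h; exact: differentiable_eps.
Unshelve. all: by end_near. Qed.

(** The recursion peels off the innermost derivative, whereas [iterD] adds outermost ones. In this
    order the product and chain rules express ['D_v] of the result through functions of lower order,
    and induction on [n] applies. *)
Fixpoint smoothn n U F : Prop :=
  (forall x, U x -> differentiable F x) /\
  (if n is m.+1 then forall v, smoothn m U ('D_v F) else True).

Lemma smooth_on_rec U F : smooth_on U F <->
  (forall x, U x -> differentiable F x) /\ forall v, smooth_on U ('D_v F).
Proof.
have iterD_rcons s v G : Defs.iterD (rcons s v) G = Defs.iterD s ('D_v G).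
  by elim: s => //= w s ->.
split=> [FU|[F0 FD] s]; last first.
  elim/last_ind: s => [//|s v _] x Ux; rewrite iterD_rcons; exact: FD.
split=> [x Ux|v s x Ux]; first exact: (FU [::]).
by rewrite -iterD_rcons; exact: FU.
Qed.

Lemma smooth_on_smoothn U F : smooth_on U F <-> forall n, smoothn n U F.
Proof.
split=> [FU n|FU s].
  elim: n F FU => [|n IHn] F /smooth_on_rec[F0 FD]; split => // v.
  exact/IHn/FD.
elim/last_ind: s F FU => [|s v IHs] F FU x Ux; first exact: (proj1 (FU 0)).
have -> : Defs.iterD (rcons s v) F = Defs.iterD s ('D_v F).
  by elim: s {IHs} => //= w s ->.
by apply: IHs => // n; exact: (proj2 (FU n.+1)).
Qed.

Lemma smoothn_diff n U F x : smoothn n U F -> U x -> differentiable F x.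
Proof. by case: n => [|n] [FU _]; exact: FU. Qed.

Lemma smoothnW n U F : smoothn n.+1 U F -> smoothn n U F.
Proof.
elim: n F => [|n IHn] F [F0 FD]; split=> // v.
exact/IHn/FD.
Qed.

Lemma smoothn_derive n U F v : smoothn n.+1 U F -> smoothn n U ('D_v F).
Proof. by case=> _; exact. Qed.

Lemma eq_smoothn n U F G : open U -> {in U, F =1 G} ->
  smoothn n U F -> smoothn n U G.
Proof.
move=> oU; elim: n F G => [|n IHn] F G FG [F0 FD].
  split=> // x Ux; apply: near_eq_differentiable (F0 _ Ux).
  near=> y; apply: FG; rewrite inE; near: y; exact: open_nbhs_nbhs.
split=> [x Ux|v].
  apply: near_eq_differentiable (F0 _ Ux).
  near=> y; apply: FG; rewrite inE; near: y; exact: open_nbhs_nbhs.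
apply: (IHn ('D_v F)); last exact: FD.
move=> x; rewrite inE => Ux.
apply: near_eq_derive; near=> y.
apply: FG; rewrite inE; near: y; exact: open_nbhs_nbhs.
Unshelve. all: by end_near. Qed.

Lemma smoothn_cst n U (c : R) : smoothn n U (cst c).
Proof.
elim: n c => [|n IHn] c; split=> // v.
by have -> : 'D_v (cst c) = cst (0 : R) by apply/funext => x; rewrite derive_cst.
Qed.

Lemma smoothnD n U F G : open U -> smoothn n U F -> smoothn n U G ->
  smoothn n U (fun x => F x + G x).
Proof.
move=> oU; elim: n F G => [|n IHn] F G [F0 FD] [G0 GD].
  by split=> // x Ux; apply: differentiableD; [exact: F0|exact: G0].
split=> [x Ux|v]; first by apply: differentiableD; [exact: F0|exact: G0].
apply: (@eq_smoothn n U (fun x => 'D_v F x + 'D_v G x)) => //;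
    last by apply: IHn; [exact: FD|exact: GD].
move=> x; rewrite inE => Ux.
by rewrite -[RHS]/('D_v (F + G) x) deriveD //; apply: diff_derivable;
  [exact: F0|exact: G0].
Qed.

Lemma smoothnM n U F G : open U -> smoothn n U F -> smoothn n U G ->
  smoothn n U (fun x => F x * G x).
Proof.
move=> oU; elim: n F G => [|n IHn] F G sF sG.
  split=> // x Ux; exact: differentiableM (smoothn_diff sF Ux) (smoothn_diff sG Ux).
split=> [x Ux|v]; first by exact: differentiableM (smoothn_diff sF Ux) (smoothn_diff sG Ux).
apply: (@eq_smoothn n U (fun x => F x * 'D_v G x + G x * 'D_v F x)) => //.
  move=> x; rewrite inE => Ux.
  by rewrite -[RHS]/('D_v (F * G) x) deriveM //; apply: diff_derivable;
    [exact: smoothn_diff sF Ux|exact: smoothn_diff sG Ux].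
by apply: smoothnD => //; apply: IHn;
  [exact: smoothnW|exact: smoothn_derive|exact: smoothnW|exact: smoothn_derive].
Qed.

(** The derivative of 1/F is - F^-2 times that of F, and 1/F has order [n] by induction; [F] stays
    fixed throughout. *)
Lemma smoothnV n U F : open U -> (forall x, U x -> F x != 0) ->
  smoothn n U F -> smoothn n U (fun x => (F x)^-1).
Proof.
move=> oU F0; elim: n => [|n IHn] sF.
  split=> // x Ux; apply: differentiableV; [exact: smoothn_diff sF Ux|exact: F0].
split=> [x Ux|v].
  apply: differentiableV; [exact: smoothn_diff sF Ux|exact: F0].
apply: (@eq_smoothn n U (fun x => (-1) * (((F x)^-1 * (F x)^-1) * 'D_v F x))) => //.
  move=> x; rewrite inE => Ux.
  rewrite deriveV ?F0 //; last by apply: diff_derivable; exact: smoothn_diff sF Ux.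
  by rewrite mulN1r -exprVn scaleNr.
apply: smoothnM => //; first exact: smoothn_cst.
apply: smoothnM => //; last exact: smoothn_derive.
by apply: smoothnM => //; apply: IHn; exact: smoothnW.
Qed.

Lemma derive_comp2 F (g1 g2 : R * R -> R) x v :
  differentiable g1 x -> differentiable g2 x -> differentiable F (g1 x, g2 x) ->
  differentiable (fun y => F (g1 y, g2 y)) x /\
  'D_v (fun y => F (g1 y, g2 y)) x = 'D_('D_v g1 x, 'D_v g2 x) F (g1 x, g2 x).
Proof.
move=> d1 d2 dF.
have dg : differentiable (fun y => (g1 y, g2 y)) x by exact: differentiable_pair.
have dFg : differentiable (F \o (fun y => (g1 y, g2 y))) x.
  exact: differentiable_comp.
split=> //; rewrite deriveE // -/(F \o (fun y => (g1 y, g2 y))) diff_comp //=.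
by rewrite deriveE // diff_pair //= deriveE // deriveE.
Qed.

Lemma smoothn_comp n U V F (g1 g2 : R * R -> R) : open U ->
  (forall x, U x -> V (g1 x, g2 x)) ->
  smoothn n U g1 -> smoothn n U g2 -> smoothn n V F ->
  smoothn n U (fun x => F (g1 x, g2 x)).
Proof.
move=> oU UV; elim: n F => [|n IHn] F s1 s2 sF.
  split=> // x Ux; have d1 := smoothn_diff s1 Ux; have d2 := smoothn_diff s2 Ux.
  have dF := smoothn_diff sF (UV _ Ux).
  exact: (proj1 (derive_comp2 0 d1 d2 dF)).
split=> [x Ux|v].
  have d1 := smoothn_diff s1 Ux; have d2 := smoothn_diff s2 Ux.
  have dF := smoothn_diff sF (UV _ Ux).
  exact: (proj1 (derive_comp2 0 d1 d2 dF)).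
apply: (@eq_smoothn n U (fun x => 'D_v g1 x * 'D_(1, 0) F (g1 x, g2 x)
    + 'D_v g2 x * 'D_(0, 1) F (g1 x, g2 x))) => //.
  move=> x; rewrite inE => Ux.
  have d1 := smoothn_diff s1 Ux; have d2 := smoothn_diff s2 Ux.
  have dF := smoothn_diff sF (UV _ Ux).
  by rewrite (proj2 (derive_comp2 v d1 d2 dF)); exact/esym/differentiable_deriv.
apply: smoothnD => //; (apply: smoothnM => //; first exact: smoothn_derive).
  exact: (IHn ('D_(1, 0) F) (smoothnW s1) (smoothnW s2) (smoothn_derive _ sF)).
exact: (IHn ('D_(0, 1) F) (smoothnW s1) (smoothnW s2) (smoothn_derive _ sF)).
Qed.

Lemma smooth_on_diff U F x : smooth_on U F -> U x -> differentiable F x.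
Proof. by move=> /smooth_on_rec[FU _]; exact: FU. Qed.

Lemma smooth_onS U V F : U `<=` V -> smooth_on V F -> smooth_on U F.
Proof. by move=> UV FV s x /UV; exact: FV. Qed.

Lemma smooth_on_loc U F :
  (forall x, U x -> exists2 V, V x & smooth_on V F) -> smooth_on U F.
Proof. by move=> H s x /H[V Vx]; exact. Qed.

Lemma eq_smooth_on U F G : open U -> {in U, F =1 G} ->
  smooth_on U F -> smooth_on U G.
Proof.
move=> oU FG /smooth_on_smoothn FU; apply/smooth_on_smoothn => n.
exact: eq_smoothn (FU n).
Qed.

Lemma smooth_on_cst U (c : R) : smooth_on U (fun=> c).
Proof. by apply/smooth_on_smoothn => n; exact: smoothn_cst. Qed.

Lemma smooth_onD U F G : open U -> smooth_on U F -> smooth_on U G ->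
  smooth_on U (fun x => F x + G x).
Proof.
move=> oU /smooth_on_smoothn FU /smooth_on_smoothn GU.
by apply/smooth_on_smoothn => n; apply: smoothnD.
Qed.

Lemma smooth_onM U F G : open U -> smooth_on U F -> smooth_on U G ->
  smooth_on U (fun x => F x * G x).
Proof.
move=> oU /smooth_on_smoothn FU /smooth_on_smoothn GU.
by apply/smooth_on_smoothn => n; apply: smoothnM.
Qed.

Lemma smooth_onN U F : open U -> smooth_on U F -> smooth_on U (fun x => - F x).
Proof.
move=> oU FU; apply: (@eq_smooth_on U (fun x => -1 * F x)) => //.
  by move=> x _; rewrite mulN1r.
by apply: smooth_onM => //; exact: smooth_on_cst.
Qed.

Lemma smooth_onB U F G : open U -> smooth_on U F -> smooth_on U G ->
  smooth_on U (fun x => F x - G x).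
Proof. by move=> oU FU GU; apply: smooth_onD => //; exact: smooth_onN. Qed.

Lemma smooth_onV U F : open U -> (forall x, U x -> F x != 0) ->
  smooth_on U F -> smooth_on U (fun x => (F x)^-1).
Proof.
move=> oU F0 /smooth_on_smoothn FU.
by apply/smooth_on_smoothn => n; apply: smoothnV.
Qed.

Lemma smooth_on_comp U V F (g1 g2 : R * R -> R) : open U ->
  (forall x, U x -> V (g1 x, g2 x)) ->
  smooth_on U g1 -> smooth_on U g2 -> smooth_on V F ->
  smooth_on U (fun x => F (g1 x, g2 x)).
Proof.
move=> oU UV /smooth_on_smoothn s1 /smooth_on_smoothn s2 /smooth_on_smoothn sF.
apply/smooth_on_smoothn => n; exact: (@smoothn_comp n U V).
Qed.

End PlaneCalculus.

(** * Symmetry of second derivatives *)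

Section MixedDerivatives.
Variable R : realType.
Implicit Types (U : set (R * R)) (F G : R * R -> R) (x v w : R * R).

Lemma near_norm (P : set (R * R)) x : (\near x, P x) ->
  exists2 r : R, 0 < r & forall h, `|h| < r -> P (h + x).
Proof.
move=> /nbhs_ballP[r r0 rP]; exists r => // h hr; apply: rP.
by rewrite -ball_normE /= opprD addrCA subrr addr0 normrN.
Qed.

Lemma derive_lin F x (a : R) v w : differentiable F x ->
  'D_(a *: v + w) F x = a * 'D_v F x + 'D_w F x.
Proof. by move=> dF; rewrite !deriveE // linearP. Qed.

Lemma is_derive_line F x v (t : R) : differentiable F (t *: v + x) ->
  is_derive t 1 (fun s : R => F (s *: v + x)) ('D_v F (t *: v + x)).
Proof.
move=> dF.
have E : (fun h : R => h^-1 *: (((fun s : R => F (s *: v + x)) \o shift t) (h *: (1 : R))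
            - F (t *: v + x)))
       = (fun h : R => h^-1 *: ((F \o shift (t *: v + x)) (h *: v) - F (t *: v + x))).
  apply/funext => h /=; congr (_ *: (F _ - _)).
  by rewrite /GRing.scale /= mulr1 -/(GRing.scale _ _) scalerDl addrA.
split; first by rewrite /derivable E; exact: diff_derivable.
by rewrite /derive E.
Qed.

(** The mean value theorem in the direction [v], applied to the increment in the direction [w],
    turns the second difference into an increment of ['D_v F], which is then expanded to first order
    at [x]. *)
Lemma second_difference U F x v w : open U -> U x ->
  (forall y, U y -> differentiable F y) -> differentiable ('D_v F) x ->
  forall e : R, 0 < e -> \forall t \near (0 : R)^'+,
    `|F (t *: v + (t *: w + x)) - F (t *: v + x) - F (t *: w + x) + F x
      - t ^+ 2 * 'D_w ('D_v F) x| <= e * t ^+ 2.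
Proof.
move=> oU Ux dF dG e e0.
set G := 'D_v F in dG *.
(* The two expansion points have norms at most t (|v| + |w|) and t |v|, in total less than [t * K];
   the summand 1 keeps [K] positive when [v] and [w] vanish. *)
pose K := 2 * `|v| + `|w| + 1.
have K0 : 0 < K by rewrite /K; have := normr_ge0 v; have := normr_ge0 w; lra.
have eK0 : 0 < e / K by exact: divr_gt0.
have nG := differentiable_eps dG eK0.
have [d d0 Hd] : exists2 d : R, 0 < d & forall h : R * R, `|h| < d ->
    `|G (h + x) - G x - 'D_h G x| <= e / K * `|h| /\ U (h + x).
  have [d1 d10 H1] := near_norm nG.
  have [d2 d20 H2] := near_norm (open_nbhs_nbhs (conj oU Ux)).
  exists (Num.min d1 d2); first by rewrite lt_min d10.
  by move=> h; rewrite lt_min => /andP[/H1 + /H2]; rewrite addr0.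
have nrm (s t : R) : 0 <= s <= t -> `|s *: v + t *: w| <= t * (`|v| + `|w|)
     /\ `|s *: v| <= t * `|v| /\ `|t *: w| <= t * `|w|.
  move=> /andP[s0 st].
  have t0 := le_trans s0 st.
  rewrite !normrZ (ger0_norm s0) (ger0_norm t0).
  split; last by split => //; apply: ler_wpM2r.
  rewrite mulrDr (le_trans (ler_normD _ _)) // !normrZ (ger0_norm s0) (ger0_norm t0).
  by rewrite lerD2r ler_wpM2r.
near=> t.
have t0 : 0 < t by near: t; exact: nbhs_right_gt.
have tK : t * K < d.
  rewrite -ltr_pdivlMr //; near: t; apply: nbhs_right_lt; exact: divr_gt0.
have small (s : R) : 0 <= s <= t ->
   [/\ `|s *: v + t *: w| < d , `|s *: v| < d & `|t *: w| < d].
  move=> /nrm[a [b c]].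
  have v0 := mulr_ge0 (ltW t0) (normr_ge0 v).
  have w0 := mulr_ge0 (ltW t0) (normr_ge0 w).
  move: tK a; rewrite /K !mulrDr => tK a.
  by split; [apply: le_lt_trans a _|apply: le_lt_trans b _|apply: le_lt_trans c _]; lra.
pose phi (s : R) := F (s *: v + (t *: w + x)) - F (s *: v + x).
pose dphi (s : R) := G (s *: v + (t *: w + x)) - G (s *: v + x).
have der (s : R) : 0 <= s <= t -> is_derive s 1 phi (dphi s).
  move=> /small[a b c]; apply: is_deriveB; apply: is_derive_line.
    by apply: dF; rewrite addrA; apply: (Hd _ a).2.
  by apply: dF; apply: (Hd _ b).2.
have [||s + E] := @MVT R phi dphi 0 t t0.
- by move=> s; rewrite in_itv /= => /andP[s0 st]; apply: der; rewrite !ltW.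
- apply: derivable_within_continuous => s; rewrite in_itv /= => /der ds.
  exact: ex_derive.
rewrite in_itv /= => /andP[s0 st].
have sI : 0 <= s <= t by rewrite !ltW.
have [a b c] := small _ sI.
have [a' [b' c']] := nrm _ _ sI.
have -> : F (t *: v + (t *: w + x)) - F (t *: v + x) - F (t *: w + x) + F x
    = dphi s * t.
  move: E; rewrite /phi subr0 !scale0r !add0r => <-; ring.
have [Ha _] := Hd _ a; have [Hb _] := Hd _ b.
have lin : 'D_(s *: v + t *: w) G x = 'D_(s *: v) G x + t * 'D_w G x.
  rewrite addrC derive_lin // addrC; congr (_ + _).
rewrite lin in Ha.
rewrite /dphi addrA.
set g1 := G (s *: v + t *: w + x) in Ha *; set g2 := G (s *: v + x) in Hb *.
set g0 := G x in Ha Hb; set l := 'D_(s *: v) G x in Ha Hb.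
set m := 'D_w G x in Ha *.
have -> : (g1 - g2) * t - t ^+ 2 * m
  = t * ((g1 - g0 - (l + t * m)) - (g2 - g0 - l)) by ring.
rewrite normrM (gtr0_norm t0).
have -> : e * t ^+ 2 = t * (e * t) by ring.
apply: ler_wpM2l; first exact: ltW.
apply: le_trans (ler_normB _ _) _.
apply: le_trans (lerD Ha Hb) _.
rewrite -mulrDr -mulrA; apply: ler_wpM2l; first exact: ltW.
rewrite ler_pdivrMl //.
have v0 := mulr_ge0 (ltW t0) (normr_ge0 v).
have w0 := mulr_ge0 (ltW t0) (normr_ge0 w).
move: a'; rewrite /K mulrDr => a'.
have -> : (2 * `|v| + `|w| + 1) * t = 2 * (t * `|v|) + t * `|w| + t by ring.
rewrite -[leLHS]addr0; apply: lerD; last exact: ltW.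
apply: le_trans (lerD a' b') _; rewrite mulr_natl mulr2n; set p := t * `|v|.
by rewrite -!addrA lerD2l addrC.
Unshelve. all: by end_near. Qed.

(** The second difference is symmetric in [v] and [w], so it approximates t^2 times either mixed
    derivative. *)
Lemma derive_commute U F x v w : open U -> U x ->
  (forall y, U y -> differentiable F y) ->
  differentiable ('D_v F) x -> differentiable ('D_w F) x ->
  'D_w ('D_v F) x = 'D_v ('D_w F) x.
Proof.
move=> oU Ux dF dv dw.
have Hv := second_difference w oU Ux dF dv.
have Hw := second_difference v oU Ux dF dw.
apply/eqP; rewrite -subr_eq0 -normr_eq0 eq_le normr_ge0 andbT.
apply/ler_addgt0Pr => e e0; rewrite add0r.
have e20 : 0 < e / 2 by lra.
near (0 : R)^'+ => t.
have t0 : 0 < t by near: t; exact: nbhs_right_gt.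
have := near (Hv _ e20) t _ => /(_ _)/wrap[//|A].
have := near (Hw _ e20) t _ => /(_ _)/wrap[//|B].
have E : F (t *: v + (t *: w + x)) = F (t *: w + (t *: v + x)).
  by rewrite addrCA.
rewrite E in A.
set a := F _ in A B; set b := F (t *: v + x) in A B; set c := F (t *: w + x) in A B.
set L1 := 'D_w _ _ in A *; set L2 := 'D_v _ _ in B *.
have t20 : 0 < t ^+ 2 by rewrite exprn_gt0.
rewrite -(ler_pM2r t20) -{1}(gtr0_norm t20) -normrM.
have -> : (L1 - L2) * t ^+ 2 = (a - c - b + F x - t ^+ 2 * L2)
  - (a - b - c + F x - t ^+ 2 * L1) by ring.
apply: le_trans (ler_normB _ _) _.
by apply: le_trans (lerD B A) _; rewrite -mulrDl -splitr.
Unshelve. all: by end_near. Qed.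

Lemma smooth_on_commute U F x v w : open U -> U x -> smooth_on U F ->
  'D_w ('D_v F) x = 'D_v ('D_w F) x.
Proof.
move=> oU Ux sF; apply: (derive_commute oU Ux).
- by move=> y; exact: smooth_on_diff.
- by move/smooth_on_rec: sF => [_ /(_ v)] /smooth_on_diff; exact.
- by move/smooth_on_rec: sF => [_ /(_ w)] /smooth_on_diff; exact.
Qed.

End MixedDerivatives.

(** * Quaternionic linear ODEs and flat connections *)

Section OneVariable.
Variable R : realType.
Local Notation H := (quat R).

(** The function (phi + e) exp (- (K + 1) t) is nonincreasing: as K + 1 >= 1, replacing phi by phi +
    e absorbs the inhomogeneous term. The rate K + 1 is the one met in [qgronwall]. *)
Lemma gronwall (phi dphi : R -> R) (K e : R) : 0 <= K -> 0 <= e ->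
  (forall t : R, 0 <= t <= 1 -> is_derive t 1 phi (dphi t)) ->
  (forall t : R, 0 <= t <= 1 -> dphi t <= (K + 1) * phi t + e) ->
  forall t : R, 0 <= t <= 1 -> phi t <= (phi 0 + e) * expR ((K + 1) * t).
Proof.
move=> K0 e0 dp le_dp t tI.
pose psi (s : R) := (phi s + e) * expR (- (K + 1) * s).
pose dpsi (s : R) := (dphi s - (K + 1) * (phi s + e)) * expR (- (K + 1) * s).
have dpsiE (s : R) : 0 <= s <= 1 -> is_derive s 1 psi (dpsi s).
  move=> sI; have := dp _ sI => dps.
  have dl : is_derive s 1 (fun s : R => - (K + 1) * s) (- (K + 1)).
    have := @is_deriveZ _ _ _ id (- (K + 1)) s 1 1 _.
    by rewrite /GRing.scale /= mulr1; apply.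
  have de := is_derive1_comp (is_derive_expR (- (K + 1) * s)) dl.
  have dpe : is_derive s 1 (fun s => phi s + e) (dphi s).
    have := @is_deriveD _ _ _ phi (cst e) s 1 _ _ dps (is_derive_cst _ _ _).
    by rewrite addr0.
  have := is_deriveM dpe de.
  rewrite /psi /dpsi /GRing.scale /= => X.
  by apply: (is_derive_eq X); ring.
have nonpos (s : R) : s \in `]0, t[ -> (psi^`())%classic s <= 0.
  rewrite in_itv /= => /andP[s0 st].
  have sI : 0 <= s <= 1.
    by rewrite ltW //= (le_trans (ltW st)) //; case/andP: tI.
  rewrite derive1E; have [_ ->] := dpsiE _ sI.
  rewrite /dpsi mulr_le0_ge0 ?expR_ge0 // subr_le0.
  apply: le_trans (le_dp _ sI) _; rewrite mulrDr lerD2l.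
  by rewrite mulrDl mul1r lerDr mulr_ge0.
have : psi t <= psi 0.
  case/andP: (tI) => t0 t1.
  apply: (@ler0_derive1_le_cc _ psi 0 t) => //.
  - move=> s; rewrite in_itv /= => /andP[s0 st].
    have [] // := dpsiE s.
    by rewrite ltW //= (le_trans (ltW st)).
  - apply: derivable_within_continuous => s; rewrite in_itv /= => /andP[s0 st].
    have [] // := dpsiE s.
    by rewrite s0 /= (le_trans st).
  - by rewrite in_itv /= lexx t0.
  - by rewrite in_itv /= lexx t0.
rewrite /psi mulr0 expR0 mulr1 => le_psi.
have : phi t + e <= (phi 0 + e) * expR ((K + 1) * t).
  rewrite -ler_pdivrMr ?expR_gt0 // -expRN -mulNr.
  exact: le_psi.
by apply: le_trans; rewrite lerDl.
Qed.

Lemma qnorm2M (x y : H) : qnorm2 (x * y) = qnorm2 x * qnorm2 y.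
Proof.
case: x y => [a b c d] [a' b' c' d'].
by rewrite /qnorm2 /=; ring.
Qed.

Lemma qnorm2_ge0 (x : H) : 0 <= qnorm2 x.
Proof. by rewrite /qnorm2 !addr_ge0 // sqr_ge0. Qed.

Definition qder (u : R -> H) (t : R) (u' : H) :=
  [/\ is_derive t 1 (q1 \o u) (q1 u'), is_derive t 1 (qi \o u) (qi u'),
      is_derive t 1 (qj \o u) (qj u') & is_derive t 1 (qk \o u) (qk u')].

(** The derivative of |u|^2 is 2 <u, u'>, at most |u|^2 + |u'|^2; the first summand is the 1 in K +
    1. *)
Lemma qgronwall (u u' : R -> H) (K e : R) : 0 <= K -> 0 <= e ->
  (forall t : R, 0 <= t <= 1 -> qder u t (u' t)) ->
  (forall t : R, 0 <= t <= 1 -> qnorm2 (u' t) <= K * qnorm2 (u t) + e) ->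
  forall t : R, 0 <= t <= 1 ->
    qnorm2 (u t) <= (qnorm2 (u 0) + e) * expR (K + 1).
Proof.
move=> K0 e0 du le_u t tI.
pose dphi (s : R) := 2 * (q1 (u s) * q1 (u' s) + qi (u s) * qi (u' s)
  + qj (u s) * qj (u' s) + qk (u s) * qk (u' s)).
have := @gronwall (fun s => qnorm2 (u s)) dphi K e K0 e0 _ _ t tI.
move=> /(_ _ _)/wrap[].
- move=> s /du[d1 d2 d3 d4].
  have sq (g : R -> R) g' : is_derive s 1 g g' ->
      is_derive s 1 (fun x => g x ^+ 2) (2 * (g s * g')).
    move=> dg; have := is_deriveM dg dg; rewrite /GRing.scale /= => X.
    apply: (is_derive_eq X); ring.
  have := is_deriveD (is_deriveD (is_deriveD (sq _ _ d1) (sq _ _ d2)) (sq _ _ d3)) (sq _ _ d4).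
  by move=> X; apply: (is_derive_eq X); rewrite /dphi /=; ring.
- move=> s sI; have := le_u _ sI; rewrite /dphi /qnorm2.
  case: (u s) => a b c d; case: (u' s) => a' b' c' d' /= le1.
  have := sqr_ge0 (a - a'); have := sqr_ge0 (b - b').
  have := sqr_ge0 (c - c'); have := sqr_ge0 (d - d').
  clear -le1; move: le1; rewrite !sqrrB => *; nra.
move=> H1; apply: le_trans (H1) _; apply: ler_wpM2l.
  by rewrite addr_ge0 ?qnorm2_ge0.
rewrite ler_expR -[leRHS]mulr1 ler_wpM2l //; first lra.
by case/andP: tI.
Qed.

End OneVariable.

(** * Picard iteration for linear equations *)

Section LinearODE.
Variable R : realType.
Local Notation H := (quat R).

Lemma primitive_exists (g : R -> R) : continuous g -> exists G : R -> R,
  G 0 = 0 /\ forall t : R, -1 < t < 1 -> is_derive t 1 G (g t).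
Proof.
move=> cg.
(* Integration starts at -1, to the left of 0, so that the derivative at 0 is two-sided. *)
pose G0 (x : R) := (\int[lebesgue_measure]_(t in [set` `[(-1 : R), x]]) (g t))%R.
have ig : lebesgue_measure.-integrable `[(-1 : R), 1] (EFin \o g).
  apply: continuous_compact_integrable; first exact: segment_compact.
  by apply: continuous_subspaceT => x; exact: cg.
exists (fun x => G0 x - G0 0); split; first by rewrite subrr.
move=> t /andP[t1 t2].
have [d1 d2] := continuous_FTC1_closed t2 ig t1 (cg t).
rewrite -[g t]subr0; apply: is_deriveB.
by split; [exact: d1|rewrite -derive1E d2].
Qed.

(** A total choice of primitive makes the Picard operator a plain function; the value for a
    discontinuous [g] is a dummy. *)
Definition prim (g : R -> R) : R -> R :=
  if pselect (continuous g) is left cg then sval (cid (primitive_exists cg))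
  else fun=> 0.

Lemma primP g : continuous g ->
  prim g 0 = 0 /\ forall t : R, -1 < t < 1 -> is_derive t 1 (prim g) (g t).
Proof. by rewrite /prim; case: pselect => // cg _; case: cid. Qed.

Lemma zero_at_0_le (G g : R -> R) (r M : R) : 0 <= r -> G 0 = 0 ->
  (forall t, - r <= t <= r -> is_derive t 1 G (g t)) ->
  (forall t, `|g t| <= M) ->
  forall t, - r <= t <= r -> `|G t| <= r * M.
Proof.
move=> r0 G0 dG gM t /andP[t1 t2].
have cG (a b : R) : - r <= a -> b <= r -> {within `[a, b], continuous G}.
  move=> a1 b1; apply: derivable_within_continuous => s.
  rewrite in_itv /= => /andP[s1 s2].
  by have [] // := dG s; rewrite (le_trans a1) // (le_trans s2).
have dG' (a b : R) : - r <= a -> b <= r ->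
    forall s, s \in `]a, b[ -> is_derive s 1 G (g s).
  move=> a1 b1 s; rewrite in_itv /= => /andP[s1 s2]; apply: dG.
  by rewrite (le_trans a1 (ltW s1)) (le_trans (ltW s2)).
have [t0|t0] := leP 0 t.
  have [||s _ E] := @MVT_segment R G g 0 t t0.
  - by apply: dG' => //; rewrite oppr_le0.
  - by apply: cG => //; rewrite oppr_le0.
  rewrite -[G t]subr0 -[X in _ - X]G0 E subr0 mulrC normrM (ger0_norm t0).
  by apply: ler_pM.
have [||s _ E] := @MVT_segment R G g t 0 (ltW t0).
- exact: dG'.
- exact: cG.
move: E; rewrite G0 !sub0r => /(congr1 (fun x => `|x|)).
rewrite normrN normrM normrN => ->; rewrite mulrC.
by apply: ler_pM => //; rewrite ltr0_norm // lerNl.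
Qed.

Lemma prim_bound g (r M : R) : 0 <= r < 1 -> continuous g ->
  (forall t, `|g t| <= M) ->
  forall t, - r <= t <= r -> `|prim g t| <= r * M.
Proof.
move=> /andP[r0 r1] cg gM; have [p0 dp] := primP cg.
apply: (zero_at_0_le r0 p0 _ gM) => s /andP[s1 s2]; apply: dp.
by apply/andP; split; [apply: lt_le_trans s1; rewrite ltrN2|apply: le_lt_trans r1].
Qed.

Lemma prim_lip g1 g2 (r M : R) : 0 <= r < 1 -> continuous g1 -> continuous g2 ->
  (forall t, `|g1 t - g2 t| <= M) ->
  forall t, - r <= t <= r -> `|prim g1 t - prim g2 t| <= r * M.
Proof.
move=> /andP[r0 r1] c1 c2 gM.
have [p1 d1] := primP c1; have [p2 d2] := primP c2.
apply: (@zero_at_0_le (fun t => prim g1 t - prim g2 t) _ _ _ r0 _ _ gM).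
  by rewrite p1 p2 subrr.
move=> s /andP[s1 s2].
have sI : -1 < s < 1.
  by apply/andP; split; [apply: lt_le_trans s1; rewrite ltrN2|apply: le_lt_trans r1].
exact: is_deriveB (d1 _ sI) (d2 _ sI).
Qed.

Definition qcont (u : R -> H) :=
  [/\ continuous (q1 \o u), continuous (qi \o u), continuous (qj \o u) &
      continuous (qk \o u)].

Lemma qcontM u v : qcont u -> qcont v -> qcont (fun t => u t * v t).
Proof.
move=> [u1 u2 u3 u4] [v1 v2 v3 v4].
have cM (f g : R -> R) : continuous f -> continuous g ->
    continuous (fun x => f x * g x).
  by move=> cf cg x; apply: continuousM; [exact: cf|exact: cg].
have cD (f g : R -> R) : continuous f -> continuous g ->
    continuous (fun x => f x + g x).
  by move=> cf cg x; apply: (@continuousD _ R^o); [exact: cf|exact: cg].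
have cB (f g : R -> R) : continuous f -> continuous g ->
    continuous (fun x => f x - g x).
  by move=> cf cg x; apply: (@continuousB _ R^o); [exact: cf|exact: cg].
split.
- exact: cB (cB _ _ (cB _ _ (cM _ _ u1 v1) (cM _ _ u2 v2)) (cM _ _ u3 v3))
    (cM _ _ u4 v4).
- exact: cB (cD _ _ (cD _ _ (cM _ _ u1 v2) (cM _ _ u2 v1)) (cM _ _ u3 v4))
    (cM _ _ u4 v3).
- exact: cD (cD _ _ (cB _ _ (cM _ _ u1 v3) (cM _ _ u2 v4)) (cM _ _ u3 v1))
    (cM _ _ u4 v2).
- exact: cD (cB _ _ (cD _ _ (cM _ _ u1 v4) (cM _ _ u2 v3)) (cM _ _ u3 v2))
    (cM _ _ u4 v1).
Qed.

(** The l^1 norm: submultiplicative on quaternions and a plain sum over components, so real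
    estimates add up without square roots. *)
Definition N1 (x : H) := `|q1 x| + `|qi x| + `|qj x| + `|qk x|.

Lemma N1_ge0 x : 0 <= N1 x.
Proof. by rewrite /N1 !addr_ge0. Qed.

Lemma N1_comp x : [/\ `|q1 x| <= N1 x, `|qi x| <= N1 x, `|qj x| <= N1 x
  & `|qk x| <= N1 x].
Proof.
rewrite /N1; have := normr_ge0 (q1 x); have := normr_ge0 (qi x).
have := normr_ge0 (qj x); have := normr_ge0 (qk x).
move: `|q1 x| `|qi x| `|qj x| `|qk x| => a b c d a0 b0 c0 d0; split; lra.
Qed.

Lemma ler_norm4 (a b c d : R) : `|a + b + c + d| <= `|a| + `|b| + `|c| + `|d|.
Proof.
apply: le_trans (ler_normD _ _) _; rewrite lerD2r.
by apply: le_trans (ler_normD _ _) _; rewrite lerD2r ler_normD.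
Qed.

Lemma N1M x y : N1 (x * y) <= N1 x * N1 y.
Proof.
case: x y => [a b c d] [a' b' c' d']; rewrite /N1 /=.
have E1 := ler_norm4 (a * a') (- (b * b')) (- (c * c')) (- (d * d')).
have E2 := ler_norm4 (a * b') (b * a') (c * d') (- (d * c')).
have E3 := ler_norm4 (a * c') (- (b * d')) (c * a') (d * b').
have E4 := ler_norm4 (a * d') (b * c') (- (c * b')) (d * a').
apply: le_trans (lerD (lerD (lerD E1 E2) E3) E4) _.
rewrite !normrN !normrM le_eqVlt; apply/orP; left; apply/eqP; ring.
Qed.

Lemma N1_eq0 x : N1 x <= 0 -> x = 0.
Proof.
have [h1 h2 h3 h4] := N1_comp x; move=> x0.
have z (a : R) : `|a| <= N1 x -> a = 0.
  by move=> aN; apply/normr0_eq0/le_anti; rewrite normr_ge0 (le_trans aN).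
case: x {x0} z h1 h2 h3 h4 => a b c d z /= h1 h2 h3 h4.
by congr Quat; exact: z.
Qed.

Lemma N1D x y : N1 (x + y) <= N1 x + N1 y.
Proof.
rewrite /N1; case: x y => [a b c d] [a' b' c' d'] /=.
have := ler_normD a a'; have := ler_normD b b'; have := ler_normD c c'.
have := ler_normD d d'.
move: `|_| `|_| `|_| `|_|  => x1 x2 x3 x4.
move: `|_| `|_| `|_| `|_|  => y1 y2 y3 y4.
move: `|_| `|_| `|_| `|_|  => z1 z2 z3 z4.
lra.
Qed.

(** Nested intervals: with radii e k = 2 M 2^-k one has e k - e (k + 1) = M 2^-k, so each interval
    around [c k] contains the next, and the supremum of the left ends lies in all of them. *)
Lemma geometric_limit (c : nat -> R) (M : R) :
  (forall k, `|c k.+1 - c k| <= M * 2^-1 ^+ k) ->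
  exists l, forall k, `|l - c k| <= 2 * M * 2^-1 ^+ k.
Proof.
move=> cM.
pose e k := 2 * M * 2^-1 ^+ k.
have M0 : 0 <= M by have := le_trans (normr_ge0 _) (cM 0); rewrite expr0 mulr1.
have e_ge0 k : 0 <= e k by rewrite /e !mulr_ge0 ?exprn_ge0.
have eS k : e k - e k.+1 = M * 2^-1 ^+ k.
  by rewrite /e exprS; field.
have lo j k : c j - e j <= c (j + k)%N - e (j + k)%N.
  elim: k => [|k IH]; first by rewrite addn0.
  apply: le_trans IH _; rewrite addnS.
  have := cM (j + k)%N; rewrite -eS ler_norml => /andP[]; set a := c _; set b := c _.
  set x := e _; set y := e _; lra.
have hi j k : c (j + k)%N + e (j + k)%N <= c j + e j.
  elim: k => [|k IH]; first by rewrite addn0.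
  apply: le_trans IH; rewrite addnS.
  have := cM (j + k)%N; rewrite -eS ler_norml => /andP[]; set a := c _; set b := c _.
  set x := e _; set y := e _; lra.
have cross j k : c j - e j <= c k + e k.
  have := lo j k; have := hi k j; rewrite addnC => h1 h2.
  apply: le_trans h2 (le_trans _ h1).
  by rewrite lerD2l (le_trans _ (e_ge0 _)) // oppr_le0.
pose S := [set c k - e k | k in [set: nat]].
have S0 : S !=set0 by exists (c 0%N - e 0%N), 0%N.
have Sub k : ubound S (c k + e k) by move=> _ [j _ <-].
exists (sup S) => k; rewrite ler_norml -/(e k); apply/andP; split.
  rewrite lerBrDl; apply: ub_le_sup; first by exists (c 0%N + e 0%N).
  by exists k.
by rewrite lerBlDl; apply: ge_sup.
Qed.

(** Each of the four components contributes r K M, hence the factor 8 for a contraction by 1/2. *)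
Lemma four_le_half (r K M : R) : 8 * (r * K) <= 1 -> 0 <= M ->
  r * (K * M) + r * (K * M) + r * (K * M) + r * (K * M) <= M / 2.
Proof. by move=> rK M0; have := ler_wpM2r M0 rK; lra. Qed.

Section Picard.
Variables (a : R -> H) (K r : R).
Hypotheses (ca : qcont a) (aK : forall t, N1 (a t) <= K).
Hypotheses (r0 : 0 < r) (r1 : r < 1) (rK : 8 * (r * K) <= 1).

(** The iterates live on the whole line with time clamped to [-r, r], so that all bounds hold for
    every [t]; inside the interval nothing changes. *)
Let clamp (t : R) : R := Num.max (- r) (Num.min r t).

Let clampP t : - r <= clamp t <= r.
Proof.
rewrite /clamp le_max lexx /= ge_max ge_min lexx /= andbT.
by rewrite -subr_ge0 opprK addr_ge0 // ltW.
Qed.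

Let clamp_id t : - r <= t <= r -> clamp t = t.
Proof. by rewrite /clamp => /andP[t1 t2]; rewrite min_r // max_r. Qed.

Let clamp_cont : continuous clamp.
Proof.
move=> t.
apply: (@continuous_max R R (cst (- r)) (Num.min r)); first exact: cst_continuous.
by apply: (@continuous_min R R (cst r) id); first exact: cst_continuous.
Qed.

Let rI : 0 <= r < 1. Proof. by rewrite ltW. Qed.

Let prim_cont g : continuous g -> continuous (prim g \o clamp).
Proof.
move=> cg t; apply: continuous_comp; first exact: clamp_cont.
have [_ dp] := primP cg.
apply: differentiable_continuous; apply/derivable1_diffP.
have [] // := dp (clamp t).
have /andP[c1 c2] := clampP t.
by apply/andP; split; [apply: lt_le_trans c1; rewrite ltrN2|apply: le_lt_trans r1].
Qed.

Let P (u : R -> H) (t : R) : H := 1 + Quat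
  (prim (fun s => q1 (a s * u s)) (clamp t))
  (prim (fun s => qi (a s * u s)) (clamp t))
  (prim (fun s => qj (a s * u s)) (clamp t))
  (prim (fun s => qk (a s * u s)) (clamp t)).

Let P_cont u : qcont u -> qcont (P u).
Proof.
move=> cu; have [c1 c2 c3 c4] := qcontM ca cu.
have h (c : R) g : continuous g -> continuous (fun t => c + prim g (clamp t)).
  move=> cg t; apply: (@cvgD _ R^o); first exact: cvg_cst.
  exact: (prim_cont cg).
by split; exact: h.
Qed.

Let P_lip u v (M : R) : qcont u -> qcont v -> (forall t, N1 (u t - v t) <= M) ->
  forall t, N1 (P u t - P v t) <= M / 2.
Proof.
move=> cu cv uM t.
have [c1 c2 c3 c4] := qcontM ca cu; have [d1 d2 d3 d4] := qcontM ca cv.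
have K0 : 0 <= K by apply: le_trans (aK 0); exact: N1_ge0.
have M0 : 0 <= M by apply: le_trans (uM 0); exact: N1_ge0.
have B s : N1 (a s * u s - a s * v s) <= K * M.
  rewrite -mulrBr; apply: le_trans (N1M _ _) _.
  by apply: ler_pM => //; exact: N1_ge0.
have -> : P u t - P v t = Quat
    (prim (fun s => q1 (a s * u s)) (clamp t) - prim (fun s => q1 (a s * v s)) (clamp t))
    (prim (fun s => qi (a s * u s)) (clamp t) - prim (fun s => qi (a s * v s)) (clamp t))
    (prim (fun s => qj (a s * u s)) (clamp t) - prim (fun s => qj (a s * v s)) (clamp t))
    (prim (fun s => qk (a s * u s)) (clamp t) - prim (fun s => qk (a s * v s)) (clamp t)).
  by congr Quat; rewrite /= ?add0r // opprD addrACA subrr add0r.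
rewrite /N1 /=.
have L1 := prim_lip rI c1 d1 (fun s => le_trans (let: And4 x _ _ _ := N1_comp _ in x) (B s)) (clampP t).
have L2 := prim_lip rI c2 d2 (fun s => le_trans (let: And4 _ x _ _ := N1_comp _ in x) (B s)) (clampP t).
have L3 := prim_lip rI c3 d3 (fun s => le_trans (let: And4 _ _ x _ := N1_comp _ in x) (B s)) (clampP t).
have L4 := prim_lip rI c4 d4 (fun s => le_trans (let: And4 _ _ _ x := N1_comp _ in x) (B s)) (clampP t).
apply: le_trans (lerD (lerD (lerD L1 L2) L3) L4) _.
exact: four_le_half.
Qed.

Let u_ k := iter k P (fun=> 1).

Let u_cont k : qcont (u_ k).
Proof. by elim: k => [|k IH]; [split=> t; exact: cst_continuous|exact: P_cont]. Qed.

Let u_step : exists M : R, forall k t, N1 (u_ k.+1 t - u_ k t) <= M * 2^-1 ^+ k.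
Proof.
exists (r * K + r * K + r * K + r * K); elim=> [|k IH] t; last first.
  rewrite exprSr mulrA; exact: (P_lip (u_cont _) (u_cont _) IH).
rewrite expr0 mulr1 /u_ /= /P addrAC subrr add0r.
have B s : N1 (a s * (1 : H)) <= K by rewrite mulr1.
have [c1 c2 c3 c4] := qcontM ca (u_cont 0%N).
have L1 := prim_bound rI c1 (fun s => le_trans (let: And4 x _ _ _ := N1_comp _ in x) (B s)) (clampP t).
have L2 := prim_bound rI c2 (fun s => le_trans (let: And4 _ x _ _ := N1_comp _ in x) (B s)) (clampP t).
have L3 := prim_bound rI c3 (fun s => le_trans (let: And4 _ _ x _ := N1_comp _ in x) (B s)) (clampP t).
have L4 := prim_bound rI c4 (fun s => le_trans (let: And4 _ _ _ x := N1_comp _ in x) (B s)) (clampP t).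
exact: (lerD (lerD (lerD L1 L2) L3) L4).
Qed.

Let u_lim : exists (u : R -> H) (M : R), forall k t, N1 (u t - u_ k t) <= M * 2^-1 ^+ k.
Proof.
have [M HM] := u_step.
have lim (pr : H -> R) : (forall x y, pr (x - y) = pr x - pr y) ->
    (forall x, `|pr x| <= N1 x) -> exists l : R -> R, forall k t,
      `|l t - pr (u_ k t)| <= 2 * M * 2^-1 ^+ k.
  move=> prB prN.
  have H t : exists l, forall k, `|l - pr (u_ k t)| <= 2 * M * 2^-1 ^+ k.
    apply: geometric_limit => k; rewrite -prB; exact: le_trans (prN _) (HM _ _).
  by have [l Hl] := choice H; exists l.
have [l1 L1] := lim (@q1 R) (fun _ _ => erefl) (fun x => let: And4 h _ _ _ := N1_comp x in h).
have [l2 L2] := lim (@qi R) (fun _ _ => erefl) (fun x => let: And4 _ h _ _ := N1_comp x in h).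
have [l3 L3] := lim (@qj R) (fun _ _ => erefl) (fun x => let: And4 _ _ h _ := N1_comp x in h).
have [l4 L4] := lim (@qk R) (fun _ _ => erefl) (fun x => let: And4 _ _ _ h := N1_comp x in h).
exists (fun t => Quat (l1 t) (l2 t) (l3 t) (l4 t)), (8 * M) => k t.
apply: le_trans (lerD (lerD (lerD (L1 k t) (L2 k t)) (L3 k t)) (L4 k t)) _.
by rewrite le_eqVlt; apply/orP; left; apply/eqP; ring.
Qed.

Let small (M e : R) : 0 < e -> exists k, M * 2^-1 ^+ k < e.
Proof.
move=> e0.
have /cvgrPdist_lt /(_ _ e0) [k _ Hk] := @cvg_geometric R M 2^-1 (ltac:(rewrite ger0_norm //; lra)).
exists k; have := Hk k (leqnn _); rewrite /= sub0r normrN; exact/le_lt_trans/ler_norm.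
Qed.

Lemma picard : exists u : R -> H, u 0 = 1 /\
  forall t, - r < t < r -> qder u t (a t * u t).
Proof.
have [u [M uM]] := u_lim.
have comp_cont (pr : H -> R) : (forall x y, pr (x - y) = pr x - pr y) ->
    (forall x, `|pr x| <= N1 x) -> (forall k, continuous (pr \o u_ k)) ->
    continuous (pr \o u).
  move=> prB prN prc t; apply/cvgrPdist_lt => e e0.
  have e30 : 0 < e / 3 by lra.
  have [k Hk] := small M e30.
  have /cvgrPdist_lt /(_ _ e30) := prc k t.
  apply: filterS => s /=.
  have U s' : `|pr (u s') - pr (u_ k s')| < e / 3.
    rewrite -prB; apply: le_lt_trans (prN _) (le_lt_trans (uM _ _) Hk).
  have := U t; have := U s.
  move: (pr _) (pr _) (pr _) (pr _) => x1 x2 x3 x4.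
  rewrite !ltr_norml => /andP[? ?] /andP[? ?] /andP[? ?]; apply/andP; split; lra.
have cu : qcont u.
  split; apply: comp_cont => //.
  - by move=> x; have [] := N1_comp x.
  - by move=> k; have [] := u_cont k.
  - by move=> x; have [] := N1_comp x.
  - by move=> k; have [] := u_cont k.
  - by move=> x; have [] := N1_comp x.
  - by move=> k; have [] := u_cont k.
  - by move=> x; have [] := N1_comp x.
  - by move=> k; have [] := u_cont k.
(* The difference is (P u - P u_k) - (u - u_(k+1)), and both terms are of order 2^-k, the first by
   the contraction property. *)
have fix_u t : P u t = u t.
  apply/eqP; rewrite -subr_eq0; apply/eqP/N1_eq0/ler_addgt0Pr => e e0; rewrite add0r.
  have M0 : 0 <= M.
    by have := le_trans (N1_ge0 _) (uM 0%N 0); rewrite expr0 mulr1.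
  have e20 : 0 < e / 2 by lra.
  have [k Hk] := small M e20.
  have -> : P u t - u t = (P u t - P (u_ k) t) + - (u t - u_ k.+1 t).
    by rewrite opprB addrA subrK.
  apply: le_trans (N1D _ _) _.
  have N1N x : N1 (- x) = N1 x by rewrite /N1 /= !normrN.
  rewrite N1N; apply: le_trans (lerD (P_lip cu (u_cont k) (uM k) t) (uM k.+1 t)) _.
  rewrite exprSr mulrA -splitr (le_trans (ltW Hk)) //.
  by rewrite ler_pdivrMr // mulr_natr mulr2n lerDl ltW.
have [c1 c2 c3 c4] := qcontM ca cu.
exists u; split.
  rewrite -fix_u /P clamp_id ?(primP _).1 //; last by rewrite oppr_le0 ltW.
  exact: addr0.
move=> t /andP[t1 t2].
have der g (c : R) : continuous g -> is_derive t 1 (fun s => c + prim g (clamp s)) (g t).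
  move=> cg; apply: (@near_eq_is_derive _ _ _ (fun s => c + prim g s)).
    near=> s; rewrite clamp_id //.
    have : s \in `]- r, r[.
      by near: s; apply: near_in_itvoo; rewrite in_itv /= t1.
    by rewrite in_itv /= => /andP[s1 s2]; rewrite !ltW.
  rewrite -[g t]add0r; apply: is_deriveD.
  apply: (primP cg).2; apply/andP; split; [apply: lt_trans t1; rewrite ltrN2|exact: lt_trans r1].
  exact: r1.
have -> : u = P u by apply/funext => s; rewrite fix_u.
rewrite /= fix_u.
by split; exact: der.
Unshelve. all: by end_near. Qed.

End Picard.

(** The radius depends on the bound [K] alone and not on the coefficient; this uniformity lets
    [flat_section] solve along all vertical lines at once. *)
Lemma linear_ode (K : R) : exists2 r : R, 0 < r & forall a : R -> H,
  qcont a -> (forall t, N1 (a t) <= K) ->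
  exists u : R -> H, u 0 = 1 /\ forall t, - r < t < r -> qder u t (a t * u t).
Proof.
pose L := Num.max K 0.
have L0 : 0 <= L by rewrite le_max lexx orbT.
exists (8 * (L + 1))^-1; first by rewrite invr_gt0; lra.
move=> a ca aK; apply: (@picard a L) => //.
- by move=> t; apply: le_trans (aK t) _; rewrite le_max lexx.
- by rewrite invr_gt0; lra.
- by rewrite invf_lt1; lra.
- have L1 : 0 < L + 1 by lra.
  rewrite (_ : 8 * _ = L / (L + 1)); last by field; exact: lt0r_neq0.
  by rewrite ler_pdivrMr // mul1r; lra.
Qed.

End LinearODE.

Section QuatDerivative.
Variable R : realType.
Local Notation H := (quat R).
Implicit Types (u v : R -> H) (x y : H) (t : R).

Definition rq (c : R) : H := Quat c 0 0 0.

Lemma N1N x : N1 (- x) = N1 x.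
Proof. by rewrite /N1 /= !normrN. Qed.

Lemma N1_rq c : N1 (rq c) = `|c|.
Proof. by rewrite /N1 /= normr0 !addr0. Qed.

Lemma qderD u v t (u' v' : H) : qder u t u' -> qder v t v' ->
  qder (fun s => u s + v s) t (u' + v').
Proof. by move=> [? ? ? ?] [? ? ? ?]; split; exact: is_deriveD. Qed.

Lemma qderN u t (u' : H) : qder u t u' -> qder (fun s => - u s) t (- u').
Proof. by move=> [? ? ? ?]; split; exact: is_deriveN. Qed.

Lemma qderB u v t (u' v' : H) : qder u t u' -> qder v t v' ->
  qder (fun s => u s - v s) t (u' - v').
Proof. by move=> du dv; apply: qderD => //; exact: qderN. Qed.

Lemma qder_cst x t : qder (fun=> x) t 0.
Proof. by split; exact: is_derive_cst. Qed.

Lemma qderM u v t (u' v' : H) : qder u t u' -> qder v t v' ->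
  qder (fun s => u s * v s) t (u' * v t + u t * v').
Proof.
move=> [u1 u2 u3 u4] [v1 v2 v3 v4].
have D (f g : R -> R) (f' g' : R) : is_derive t 1 f f' -> is_derive t 1 g g' ->
    is_derive t 1 (fun s => f s + g s) (f' + g') by move=> ? ?; exact: is_deriveD.
have B (f g : R -> R) (f' g' : R) : is_derive t 1 f f' -> is_derive t 1 g g' ->
    is_derive t 1 (fun s => f s - g s) (f' - g') by move=> ? ?; exact: is_deriveB.
have M (f g : R -> R) (f' g' : R) : is_derive t 1 f f' -> is_derive t 1 g g' ->
    is_derive t 1 (fun s => f s * g s) (f' * g t + f t * g').
  move=> df dg; have X := is_deriveM df dg; apply: (is_derive_eq X).
  by rewrite /GRing.scale /=; ring.
split.
- have X := B _ _ _ _ (B _ _ _ _ (B _ _ _ _ (M _ _ _ _ u1 v1) (M _ _ _ _ u2 v2))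
    (M _ _ _ _ u3 v3)) (M _ _ _ _ u4 v4).
  by apply: (is_derive_eq X) => /=; ring.
- have X := B _ _ _ _ (D _ _ _ _ (D _ _ _ _ (M _ _ _ _ u1 v2) (M _ _ _ _ u2 v1))
    (M _ _ _ _ u3 v4)) (M _ _ _ _ u4 v3).
  by apply: (is_derive_eq X) => /=; ring.
- have X := D _ _ _ _ (D _ _ _ _ (B _ _ _ _ (M _ _ _ _ u1 v3) (M _ _ _ _ u2 v4))
    (M _ _ _ _ u3 v1)) (M _ _ _ _ u4 v2).
  by apply: (is_derive_eq X) => /=; ring.
- have X := D _ _ _ _ (B _ _ _ _ (D _ _ _ _ (M _ _ _ _ u1 v4) (M _ _ _ _ u2 v3))
    (M _ _ _ _ u3 v2)) (M _ _ _ _ u4 v1).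
  by apply: (is_derive_eq X) => /=; ring.
Qed.

Lemma qderMr u t (u' : H) x : qder u t u' -> qder (fun s => u s * x) t (u' * x).
Proof. by move=> du; have := qderM du (qder_cst x t); rewrite mulr0 addr0. Qed.

Lemma qderMl u t (u' : H) x : qder u t u' -> qder (fun s => x * u s) t (x * u').
Proof. by move=> du; have := qderM (qder_cst x t) du; rewrite mul0r add0r. Qed.

Lemma qder_rq t : qder rq t 1.
Proof. by split; [exact: is_derive_id|exact: is_derive_cst..]. Qed.

Lemma qder_affine u (c k t : R) (u' : H) : qder u (k * t + c) u' ->
  qder (fun s => u (k * s + c)) t (rq k * u').
Proof.
have A (f : R -> R) f' : is_derive (k * t + c) 1 f f' ->
    is_derive t 1 (fun s => f (k * s + c)) (k * f').
  move=> df.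
  have dl : is_derive t 1 (fun s : R => k * s + c) k.
    have X := is_deriveD (is_deriveZ k (is_derive_id t (1 : R))) (is_derive_cst c t 1).
    by apply: (is_derive_eq X); rewrite /GRing.scale /= mulr1 addr0.
  have X := @is_derive1_comp _ f (fun s : R => k * s + c) t _ _ df dl.
  by apply: (is_derive_eq X); rewrite mulrC.
move=> [u1 u2 u3 u4]; split.
- by have X := A _ _ u1; apply: (is_derive_eq X) => /=; ring.
- by have X := A _ _ u2; apply: (is_derive_eq X) => /=; ring.
- by have X := A _ _ u3; apply: (is_derive_eq X) => /=; ring.
- by have X := A _ _ u4; apply: (is_derive_eq X) => /=; ring.
Qed.

Lemma qnorm2_le_N1 x : qnorm2 x <= N1 x ^+ 2.
Proof.
rewrite /qnorm2 /N1 -(real_normK (num_real (q1 x))) -(real_normK (num_real (qi x))).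
rewrite -(real_normK (num_real (qj x))) -(real_normK (num_real (qk x))).
have := normr_ge0 (q1 x); have := normr_ge0 (qi x).
have := normr_ge0 (qj x); have := normr_ge0 (qk x).
move: `|q1 x| `|qi x| `|qj x| `|qk x| => a b c d; nra.
Qed.

Lemma N1_le_qnorm2 x : N1 x ^+ 2 <= 4 * qnorm2 x.
Proof.
rewrite /qnorm2 /N1 -(real_normK (num_real (q1 x))) -(real_normK (num_real (qi x))).
rewrite -(real_normK (num_real (qj x))) -(real_normK (num_real (qk x))).
move: `|q1 x| `|qi x| `|qj x| `|qk x| => a b c d.
have := sqr_ge0 (a - b); have := sqr_ge0 (a - c); have := sqr_ge0 (a - d).
have := sqr_ge0 (b - c); have := sqr_ge0 (b - d); have := sqr_ge0 (c - d).
nra.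
Qed.

(** The affine substitution t -> (y - y0) t + y0 reduces both directions from [y0] to the interval
    [0, 1]; since |y - y0| <= 1 the constant depends on [K] only. *)
Lemma N1_gronwall (K : R) : 0 <= K -> exists2 C : R, 0 <= C &
  forall (u u' : R -> H) (y0 y e : R), 0 <= e -> `|y - y0| <= 1 ->
  (forall t, `|t - y0| <= `|y - y0| -> qder u t (u' t)) ->
  (forall t, `|t - y0| <= `|y - y0| -> N1 (u' t) <= K * N1 (u t) + e) ->
  N1 (u y) <= C * (N1 (u y0) + e).
Proof.
(* (K n + e)^2 <= 2 K^2 n^2 + 2 e^2, and n^2 is at most 4 times the squared Euclidean norm. *)
move=> K0; pose L := 8 * K ^+ 2; pose E := expR (L + 1).
have L0 : 0 <= L by rewrite mulr_ge0 // sqr_ge0.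
have E1 : 1 <= E by rewrite -[leLHS]expR0 ler_expR addr_ge0.
exists (8 * E); first by rewrite mulr_ge0 // (le_trans _ E1).
move=> u u' y0 y e e0 y1 du le_u.
pose k := y - y0.
have seg t : 0 <= t <= 1 -> `|k * t + y0 - y0| <= `|y - y0|.
  move=> /andP[t0 t1]; rewrite addrK normrM (ger0_norm t0).
  by rewrite -[leRHS]mulr1; apply: ler_wpM2l.
have := @qgronwall R (fun t => u (k * t + y0)) (fun t => rq k * u' (k * t + y0))
  L (2 * e ^+ 2) L0 _ _ _ 1 _.
rewrite mulr1 mulr0 add0r subrK => /(_ _ _ _ _)/wrap[].
- by rewrite mulr_ge0 // sqr_ge0.
- by move=> t tI; apply: qder_affine; apply: du; exact: seg.
- move=> t tI; rewrite qnorm2M.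
  have k1 : qnorm2 (rq k) <= 1.
    rewrite /qnorm2 /= expr0n /= !addr0 -(real_normK (num_real k)).
    by rewrite expr_le1.
  apply: le_trans (ler_wpM2r (qnorm2_ge0 _) k1) _; rewrite mul1r.
  apply: le_trans (qnorm2_le_N1 _) _.
  have h := le_u _ (seg _ tI).
  have n0 := N1_ge0 (u' (k * t + y0)).
  have h2 : N1 (u' (k * t + y0)) ^+ 2 <= (K * N1 (u (k * t + y0)) + e) ^+ 2.
    by rewrite ler_sqr ?nnegrE // (le_trans n0).
  apply: le_trans h2 _.
  have := N1_le_qnorm2 (u (k * t + y0)).
  move: (N1 (u _)) (qnorm2 (u _)) => n q nq.
  have : K ^+ 2 * n ^+ 2 <= K ^+ 2 * (4 * q) by apply: ler_wpM2l => //; exact: sqr_ge0.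
  have := sqr_ge0 (K * n - e).
  rewrite /L; clear; rewrite sqrrB sqrrD exprMn; lra.
- by rewrite lexx ler01.
move=> h.
have C0 : 0 <= 8 * E * (N1 (u y0) + e).
  by rewrite mulr_ge0 ?mulr_ge0 ?addr_ge0 ?N1_ge0 // (le_trans _ E1).
rewrite -(ler_sqr (N1_ge0 _) C0).
apply: le_trans (N1_le_qnorm2 _) _.
have := qnorm2_le_N1 (u y0).
have n0 := N1_ge0 (u y0).
move: h; rewrite -/E.
move: (N1 (u _)) (qnorm2 (u y)) (qnorm2 (u y0)) n0 => n q q0 n0 h q0n.
have h2 : q <= 2 * E * (n + e) ^+ 2.
  apply: le_trans h _; rewrite [leRHS]mulrAC; apply: ler_wpM2r; first by rewrite (le_trans _ E1).
  have := mulr_ge0 n0 e0; rewrite sqrrD; have := sqr_ge0 n; clear -q0n; lra.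
apply: le_trans (ler_wpM2l _ h2) _ => //.
rewrite !exprMn mulrA; apply: ler_wpM2r; first exact: sqr_ge0.
have : E <= E ^+ 2 by rewrite expr2 ler_peMl // (le_trans _ E1).
move: E1; clear; lra.
Qed.

Lemma N1_MVT (u u' : R -> H) (x x' M : R) :
  (forall t, `|t - x| <= `|x' - x| -> qder u t (u' t)) ->
  (forall t, `|t - x| <= `|x' - x| -> N1 (u' t) <= M) ->
  N1 (u x' - u x) <= 4 * M * `|x' - x|.
Proof.
move=> du uM.
have comp (f f' : R -> R) :
    (forall t, `|t - x| <= `|x' - x| -> is_derive t 1 f (f' t)) ->
    (forall t, `|t - x| <= `|x' - x| -> `|f' t| <= M) ->
    `|f x' - f x| <= M * `|x' - x|.
  move=> df fM.
  have seg a b t : a <= t <= b -> (a = x /\ b = x') \/ (a = x' /\ b = x) ->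
      `|t - x| <= `|x' - x|.
    move=> /andP[t1 t2] [[<- <-]|[<- <-]].
      by rewrite !ger0_norm ?subr_ge0 ?(le_trans t1) // lerD2r.
    by rewrite !ler0_norm ?subr_le0 ?(le_trans t1) // lerN2 lerD2r.
  have cf a b : (a = x /\ b = x') \/ (a = x' /\ b = x) ->
      {within `[a, b], continuous f}.
    move=> ab; apply: derivable_within_continuous => t; rewrite in_itv /= => tI.
    by have [] // := df t (seg _ _ _ tI ab).
  have df' a b : (a = x /\ b = x') \/ (a = x' /\ b = x) ->
      forall t, t \in `]a, b[ -> is_derive t 1 f (f' t).
    move=> ab t; rewrite in_itv /= => /andP[t1 t2]; apply: df.
    by apply: (seg a b) => //; rewrite !ltW.
  have [xx'|x'x] := leP x x'.
    have ab : (x = x /\ x' = x') \/ (x = x' /\ x' = x) by left.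
    have [t + ->] := MVT_segment xx' (df' _ _ ab) (cf _ _ ab).
    rewrite in_itv /= => tI; rewrite normrM ler_wpM2r // fM //.
    exact: seg ab.
  have ab : (x' = x /\ x = x') \/ (x' = x' /\ x = x) by right.
  have [t + E] := MVT_segment (ltW x'x) (df' _ _ ab) (cf _ _ ab).
  rewrite in_itv /= => tI; rewrite distrC E normrM distrC ler_wpM2r // fM //.
  exact: seg ab.
have L (pr : H -> R) : (forall x, `|pr x| <= N1 x) ->
    (forall t, `|t - x| <= `|x' - x| -> is_derive t 1 (pr \o u) (pr (u' t))) ->
    `|pr (u x') - pr (u x)| <= M * `|x' - x|.
  move=> prN dpr; apply: (comp (pr \o u) (pr \o u')) => // t tI /=.
  exact: le_trans (prN _) (uM _ tI).
have L1 := L (@q1 R) (fun x => let: And4 h _ _ _ := N1_comp x in h) (fun t tI => let: And4 h _ _ _ := du t tI in h).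
have L2 := L (@qi R) (fun x => let: And4 _ h _ _ := N1_comp x in h) (fun t tI => let: And4 _ h _ _ := du t tI in h).
have L3 := L (@qj R) (fun x => let: And4 _ _ h _ := N1_comp x in h) (fun t tI => let: And4 _ _ h _ := du t tI in h).
have L4 := L (@qk R) (fun x => let: And4 _ _ _ h := N1_comp x in h) (fun t tI => let: And4 _ _ _ h := du t tI in h).
apply: le_trans (lerD (lerD (lerD L1 L2) L3) L4) _.
by rewrite le_eqVlt; apply/orP; left; apply/eqP; ring.
Qed.

End QuatDerivative.

Lemma quat_ext (R : realType) (x y : quat R) : q1 x = q1 y -> qi x = qi y ->
  qj x = qj y -> qk x = qk y -> x = y.
Proof. by case: x y => [? ? ? ?] [? ? ? ?] /= -> -> -> ->. Qed.

Ltac qring := apply: quat_ext => /=; ring.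

(** * Carrying the horizontal equation of a flat connection off an axis *)

Section Rectangle.
Variable R : realType.
Local Notation H := (quat R).
Variables (A1 A2 A11 A12 A21 A211 : R -> R -> H) (a b r K : R).
Let box x y := `|x - a| < r /\ `|y - b| < r.
Hypotheses (r0 : 0 < r) (r1 : r <= 1) (K0 : 0 <= K).
Hypotheses
  (dA11 : forall x y, box x y -> qder (A1 ^~ y) x (A11 x y))
  (dA12 : forall x y, box x y -> qder (A1 x) y (A12 x y))
  (dA21 : forall x y, box x y -> qder (A2 ^~ y) x (A21 x y))
  (dA211 : forall x y, box x y -> qder (A21 ^~ y) x (A211 x y)).
Hypotheses
  (bA1 : forall x y, box x y -> N1 (A1 x y) <= K)
  (bA2 : forall x y, box x y -> N1 (A2 x y) <= K)
  (bA11 : forall x y, box x y -> N1 (A11 x y) <= K)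
  (bA21 : forall x y, box x y -> N1 (A21 x y) <= K)
  (bA211 : forall x y, box x y -> N1 (A211 x y) <= K).
Hypothesis flat : forall x y, box x y ->
  A12 x y + A1 x y * A2 x y = A21 x y + A2 x y * A1 x y.
Variable s : R -> R -> H.
Hypotheses (s1 : s a b = 1)
  (ds1 : forall x, `|x - a| < r -> qder (s ^~ b) x (A1 x b * s x b))
  (ds2 : forall x y, box x y -> qder (s x) y (A2 x y * s x y)).

Let boxb x : `|x - a| < r -> box x b.
Proof. by move=> xr; split; rewrite ?subrr ?normr0. Qed.

Let near_box x h t : `|x - a| < r / 2 -> `|h| < r / 2 -> `|t - x| <= `|x + h - x| ->
  `|t - a| < r.
Proof.
move=> xr hr; rewrite addrAC subrr add0r => tx.
have -> : t - a = (t - x) + (x - a) by rewrite addrA subrK.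
apply: le_lt_trans (ler_normD _ _) _; rewrite [ltRHS]splitr ltrD //.
exact: le_lt_trans tx hr.
Qed.

Let s_bound : exists2 C : R, 0 <= C & forall x y, box x y -> N1 (s x y) <= C.
Proof.
have [C C0 HC] := N1_gronwall K0.
exists (C * C); first exact: mulr_ge0.
have K_le (x y : H) : N1 x <= K -> N1 (x * y) <= K * N1 y + 0.
  by move=> xK; rewrite addr0; apply: le_trans (N1M _ _) _; apply: ler_wpM2r => //; exact: N1_ge0.
move=> x y [xr yr].
have sx : N1 (s x b) <= C.
  have := HC (s ^~ b) (fun x => A1 x b * s x b) a x 0 (lexx _).
  rewrite s1 N1_rq normr1 addr0 mulr1; apply.
  - by rewrite ltW // (lt_le_trans xr).
  - by move=> t tx; apply: ds1; exact: le_lt_trans tx xr.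
  - by move=> t tx; apply/K_le/bA1/boxb; exact: le_lt_trans tx xr.
have := HC (s x) (fun y => A2 x y * s x y) b y 0 (lexx _).
rewrite addr0 => /(_ _ _ _)/wrap[].
- by rewrite ltW // (lt_le_trans yr).
- by move=> t ty; apply: ds2; split => //; exact: le_lt_trans ty yr.
- by move=> t ty; apply/K_le/bA2; split => //; exact: le_lt_trans ty yr.
by move=> h; apply: le_trans h _; exact: ler_wpM2l.
Qed.

Let A2_lip x h y : `|x - a| < r / 2 -> `|h| < r / 2 -> `|y - b| < r ->
  N1 (A2 (x + h) y - A2 x y) <= 4 * K * `|h|.
Proof.
move=> xr hr yr.
have -> : `|h| = `|x + h - x| by rewrite addrAC subrr add0r.
apply: (@N1_MVT _ (A2 ^~ y) (A21 ^~ y)) => t tx.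
- by apply: dA21; split => //; exact: near_box tx.
- by apply: bA21; split => //; exact: near_box tx.
Qed.

Let A1_lip x h y : `|x - a| < r / 2 -> `|h| < r / 2 -> `|y - b| < r ->
  N1 (A1 (x + h) y - A1 x y) <= 4 * K * `|h|.
Proof.
move=> xr hr yr.
have -> : `|h| = `|x + h - x| by rewrite addrAC subrr add0r.
apply: (@N1_MVT _ (A1 ^~ y) (A11 ^~ y)) => t tx.
- by apply: dA11; split => //; exact: near_box tx.
- by apply: bA11; split => //; exact: near_box tx.
Qed.

Let A2_taylor x h y : `|x - a| < r / 2 -> `|h| < r / 2 -> `|y - b| < r ->
  N1 (A2 (x + h) y - A2 x y - rq h * A21 x y) <= 16 * K * h ^+ 2.
Proof.
move=> xr hr yr.
have hE : `|x + h - x| = `|h| by rewrite addrAC subrr add0r.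
pose g t := A2 t y - rq t * A21 x y.
have -> : A2 (x + h) y - A2 x y - rq h * A21 x y = g (x + h) - g x.
  by rewrite /g; qring.
have := @N1_MVT _ g (fun t => A21 t y - 1 * A21 x y) x (x + h) (4 * K * `|h|).
rewrite hE => /(_ _ _)/wrap[].
- move=> t tx; apply: qderB; first by apply: dA21; split => //; apply: (near_box xr hr); rewrite hE.
  exact: qderMr (qder_rq t).
- move=> t tx; rewrite mul1r -[t](subrK x) [t - x + x]addrC.
  apply: le_trans (_ : _ <= 4 * K * `|t - x|) _; last first.
    by apply: ler_wpM2l => //; exact: mulr_ge0.
  have tr : `|t - x| < r / 2 by exact: le_lt_trans tx hr.
  have -> : `|t - x| = `|x + (t - x) - x| by rewrite addrAC subrr add0r.
  apply: (@N1_MVT _ (A21 ^~ y) (A211 ^~ y)) => u ux.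
  - by apply: dA211; split => //; exact: near_box ux.
  - by apply: bA211; split => //; exact: near_box ux.
move=> E; apply: le_trans E _.
rewrite -(real_normK (num_real h)) le_eqVlt; apply/orP; left; apply/eqP; ring.
Qed.

(** The defect [delta] of the first-order expansion in [x] is O(h^2) on the axis by the horizontal
    equation. By flatness it solves the vertical equation up to an error O(h^2), so Gronwall's
    inequality in [y] keeps it O(h^2), uniformly in [y]. *)
Lemma rectangle_expansion : exists2 L : R, 0 <= L & forall x h y,
  `|x - a| < r / 2 -> `|h| < r / 2 -> `|y - b| < r ->
  N1 (s (x + h) y - s x y - rq h * (A1 x y * s x y)) <= L * h ^+ 2.
Proof.
have [B B0 sB] := s_bound.
have [C C0 HC] := N1_gronwall K0.
have half x : `|x - a| < r / 2 -> `|x - a| < r.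
  by move=> xr; apply: lt_trans xr _; rewrite ltr_pdivrMr // mulr_natr mulr2n ltrDl.
have s_lipb x h : `|x - a| < r / 2 -> `|h| < r / 2 ->
    N1 (s (x + h) b - s x b) <= 4 * (K * B) * `|h|.
  move=> xr hr.
  have -> : `|h| = `|x + h - x| by rewrite addrAC subrr add0r.
  apply: (@N1_MVT _ (s ^~ b) (fun t => A1 t b * s t b)) => t tx.
    by apply: ds1; exact: near_box tx.
  have bt : box t b by apply: boxb; exact: near_box tx.
  apply: le_trans (N1M _ _) _; apply: ler_pM; try exact: N1_ge0.
    exact: bA1.
  exact: sB.
pose L1 := C * (4 * (K * B) + 4 * K * B).
have L10 : 0 <= L1 by rewrite mulr_ge0 // addr_ge0 // !mulr_ge0.
have s_lip x h y : `|x - a| < r / 2 -> `|h| < r / 2 -> `|y - b| < r ->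
    N1 (s (x + h) y - s x y) <= L1 * `|h|.
  move=> xr hr yr.
  have xhr : `|x + h - a| < r by apply: (near_box xr hr).
  have := HC (fun y => s (x + h) y - s x y)
    (fun y => A2 (x + h) y * s (x + h) y - A2 x y * s x y) b y (4 * K * `|h| * B).
  move=> /(_ _ _ _ _)/wrap[].
  - by rewrite !mulr_ge0.
  - by rewrite ltW // (lt_le_trans yr).
  - move=> t ty; have tr := le_lt_trans ty yr.
    by apply: qderB; apply: ds2; split => //; exact: half.
  - move=> t ty; have tr := le_lt_trans ty yr.
    have -> : A2 (x + h) t * s (x + h) t - A2 x t * s x t
      = A2 (x + h) t * (s (x + h) t - s x t) + (A2 (x + h) t - A2 x t) * s x t.
      by rewrite mulrBr mulrBl addrA subrK.
    apply: le_trans (N1D _ _) _; apply: lerD.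
      apply: le_trans (N1M _ _) _; apply: ler_wpM2r; first exact: N1_ge0.
      exact: bA2.
    apply: le_trans (N1M _ _) _; apply: ler_pM; try exact: N1_ge0.
      exact: A2_lip.
    by apply: sB; split => //; exact: half.
  move=> E; apply: le_trans E _; rewrite /L1 -[leRHS]mulrA; apply: ler_wpM2l => //.
  apply: le_trans (lerD (s_lipb _ _ xr hr) (lexx _)) _.
  by rewrite le_eqVlt; apply/orP; left; apply/eqP; ring.
pose L2 := 4 * (4 * K * B + K * L1).
pose L3 := 16 * K * B + K * L1.
have KL1 : 0 <= K * L1 by exact: mulr_ge0.
have KB : 0 <= K * B by exact: mulr_ge0.
have L20 : 0 <= L2 by apply: mulr_ge0 => //; apply: addr_ge0 => //; rewrite -mulrA mulr_ge0.
have L30 : 0 <= L3 by apply: addr_ge0 => //; rewrite -mulrA mulr_ge0.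
have init x h : `|x - a| < r / 2 -> `|h| < r / 2 ->
    N1 (s (x + h) b - s x b - rq h * (A1 x b * s x b)) <= L2 * h ^+ 2.
  move=> xr hr.
  have br : `|b - b| < r by rewrite subrr normr0.
  have hE : `|x + h - x| = `|h| by rewrite addrAC subrr add0r.
  pose g t := s t b - rq t * (A1 x b * s x b).
  have -> : s (x + h) b - s x b - rq h * (A1 x b * s x b) = g (x + h) - g x.
    by rewrite /g; qring.
  have := @N1_MVT _ g (fun t => A1 t b * s t b - 1 * (A1 x b * s x b)) x (x + h)
    ((4 * K * B + K * L1) * `|h|).
  rewrite hE => /(_ _ _)/wrap[].
  - move=> t tx; apply: qderB; last exact: qderMr (qder_rq t).
    by apply: ds1; apply: (near_box xr hr); rewrite hE.
  - move=> t tx.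
    have tr := le_lt_trans tx hr.
    have bt : box t b by apply: boxb; apply: (near_box xr hr); rewrite hE.
    rewrite mul1r.
    have -> : A1 t b * s t b - A1 x b * s x b
        = (A1 t b - A1 x b) * s t b + A1 x b * (s t b - s x b).
      by rewrite mulrBl mulrBr addrA subrK.
    apply: le_trans (N1D _ _) _; rewrite [leRHS]mulrDl; apply: lerD.
      apply: le_trans (N1M _ _) _; rewrite [leRHS]mulrAC.
      apply: ler_pM; try exact: N1_ge0; last exact: sB.
      rewrite -[t](subrK x) [t - x + x]addrC.
      apply: le_trans (A1_lip xr tr br) _.
      by apply: ler_wpM2l => //; exact: mulr_ge0.
    apply: le_trans (N1M _ _) _; rewrite -[leRHS]mulrA.
    apply: ler_pM; try exact: N1_ge0; first exact/bA1/boxb/half.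
    rewrite -[t](subrK x) [t - x + x]addrC.
    apply: le_trans (s_lip _ _ _ xr tr br) _.
    by apply: ler_wpM2l.
  move=> E; apply: le_trans E _.
  rewrite -(real_normK (num_real h)) /L2 le_eqVlt; apply/orP; left; apply/eqP; ring.
exists (C * (L2 + L3)); first by rewrite mulr_ge0 // addr_ge0.
move=> x h y xr hr yr.
have xhr : `|x + h - a| < r by apply: (near_box xr hr).
pose delta y := s (x + h) y - s x y - rq h * (A1 x y * s x y).
(* What remains once [flat] has replaced [A12]: the second-order Taylor remainder of [A2], and the
   product of two first-order increments. *)
pose err y := (A2 (x + h) y - A2 x y - rq h * A21 x y) * s (x + h) y
  + rq h * A21 x y * (s (x + h) y - s x y).
have := HC delta (fun y => A2 x y * delta y + err y) b y (L3 * h ^+ 2).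
move=> /(_ _ _ _ _)/wrap[].
- by rewrite mulr_ge0 // sqr_ge0.
- by rewrite ltW // (lt_le_trans yr).
- move=> t ty; have tr := le_lt_trans ty yr.
  have bt : box x t by split => //; exact: half.
  have -> : A2 x t * delta t + err t = A2 (x + h) t * s (x + h) t - A2 x t * s x t
      - rq h * (A12 x t * s x t + A1 x t * (A2 x t * s x t)).
    have -> : A12 x t = A21 x t + A2 x t * A1 x t - A1 x t * A2 x t.
      by rewrite -flat // addrK.
    by rewrite /delta /err; qring.
  apply: qderB; first by apply: qderB; apply: ds2.
  by apply: qderMl; apply: qderM; [exact: dA12|exact: ds2].
- move=> t ty; have tr := le_lt_trans ty yr.
  have bt : box x t by split => //; exact: half.
  apply: le_trans (N1D _ _) _; apply: lerD.
    apply: le_trans (N1M _ _) _; apply: ler_wpM2r; first exact: N1_ge0.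
    exact: bA2.
  apply: le_trans (N1D _ _) _; rewrite /L3 [leRHS]mulrDl; apply: lerD.
    apply: le_trans (N1M _ _) _; rewrite [leRHS]mulrAC.
    apply: ler_pM; try exact: N1_ge0; last exact: sB.
    exact: A2_taylor.
  apply: le_trans (N1M _ _) _.
  have -> : K * L1 * h ^+ 2 = (`|h| * K) * (L1 * `|h|).
    by rewrite -(real_normK (num_real h)); ring.
  apply: ler_pM; try exact: N1_ge0; last exact: s_lip.
  apply: le_trans (N1M _ _) _; rewrite N1_rq.
  by apply: ler_wpM2l => //; exact: bA21.
move=> E; apply: le_trans E _; rewrite -[leRHS]mulrA; apply: ler_wpM2l => //.
by rewrite [leRHS]mulrDl lerD2r; exact: init.
Qed.

End Rectangle.

(** * Quaternion-valued functions on plane domains *)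

Section PlaneFields.
Variable R : realType.
Local Notation H := (quat R).
Implicit Types (U : set (R * R)) (F G : R * R -> H) (x v : R * R).

Definition qdiff F x := [/\ differentiable (q1 \o F) x,
  differentiable (qi \o F) x, differentiable (qj \o F) x &
  differentiable (qk \o F) x].

Definition qD v F x : H := Quat ('D_v (q1 \o F) x) ('D_v (qi \o F) x)
  ('D_v (qj \o F) x) ('D_v (qk \o F) x).

Definition qsmooth U F := [/\ smooth_on U (q1 \o F), smooth_on U (qi \o F),
  smooth_on U (qj \o F) & smooth_on U (qk \o F)].

Lemma qsmooth_qdiff U F x : qsmooth U F -> U x -> qdiff F x.
Proof.
by move=> [s1 s2 s3 s4] Ux; split;
  [exact: smooth_on_diff s1 Ux|exact: smooth_on_diff s2 Ux
  |exact: smooth_on_diff s3 Ux|exact: smooth_on_diff s4 Ux].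
Qed.

Lemma qsmooth_qD U F v : qsmooth U F -> qsmooth U (qD v F).
Proof.
by move=> [/smooth_on_rec[_ s1] /smooth_on_rec[_ s2] /smooth_on_rec[_ s3]
  /smooth_on_rec[_ s4]]; split; [exact: s1|exact: s2|exact: s3|exact: s4].
Qed.

Lemma qD_commute U F v w x : open U -> U x -> qsmooth U F ->
  qD v (qD w F) x = qD w (qD v F) x.
Proof.
move=> oU Ux [s1 s2 s3 s4]; apply: quat_ext.
- exact: smooth_on_commute oU Ux s1.
- exact: smooth_on_commute oU Ux s2.
- exact: smooth_on_commute oU Ux s3.
- exact: smooth_on_commute oU Ux s4.
Qed.

Lemma is_derive_x (f : R * R -> R) (x y : R) : differentiable f (x, y) ->
  is_derive x 1 (fun t => f (t, y)) ('D_(1, 0) f (x, y)).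
Proof.
move=> df.
have E : (fun h : R => h^-1 *: (((fun t => f (t, y)) \o shift x) (h *: (1 : R))
            - f (x, y)))
       = (fun h : R => h^-1 *: ((f \o shift (x, y)) (h *: ((1, 0) : R * R)) - f (x, y))).
  apply/funext => h /=; congr (_ *: (f _ - _)).
  by congr (_, _) => /=; rewrite [h *: 0]mulr0 add0r.
split; first by rewrite /derivable E; exact: diff_derivable.
by rewrite /derive E.
Qed.

Lemma is_derive_y (f : R * R -> R) (x y : R) : differentiable f (x, y) ->
  is_derive y 1 (fun t => f (x, t)) ('D_(0, 1) f (x, y)).
Proof.
move=> df.
have E : (fun h : R => h^-1 *: (((fun t => f (x, t)) \o shift y) (h *: (1 : R))
            - f (x, y)))
       = (fun h : R => h^-1 *: ((f \o shift (x, y)) (h *: ((0, 1) : R * R)) - f (x, y))).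
  apply/funext => h /=; congr (_ *: (f _ - _)).
  by congr (_, _) => /=; rewrite [h *: 0]mulr0 add0r.
split; first by rewrite /derivable E; exact: diff_derivable.
by rewrite /derive E.
Qed.

Lemma qder_x F (x y : R) : qdiff F (x, y) ->
  qder (fun t => F (t, y)) x (qD (1, 0) F (x, y)).
Proof.
move=> [d1 d2 d3 d4].
by split; [exact: is_derive_x d1|exact: is_derive_x d2|exact: is_derive_x d3
  |exact: is_derive_x d4].
Qed.

Lemma qder_y F (x y : R) : qdiff F (x, y) ->
  qder (fun t => F (x, t)) y (qD (0, 1) F (x, y)).
Proof.
move=> [d1 d2 d3 d4].
by split; [exact: is_derive_y d1|exact: is_derive_y d2|exact: is_derive_y d3
  |exact: is_derive_y d4].
Qed.

Lemma near_N1 (T : topologicalType) (F : T -> H) (x : T) :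
  {for x, continuous (q1 \o F)} -> {for x, continuous (qi \o F)} ->
  {for x, continuous (qj \o F)} -> {for x, continuous (qk \o F)} ->
  forall e : R, 0 < e -> \forall y \near x, N1 (F y - F x) < e.
Proof.
move=> c1 c2 c3 c4 e e0.
have e4 : 0 < e / 4 by lra.
have /cvgrPdist_lt /(_ _ e4) n1 := c1.
have /cvgrPdist_lt /(_ _ e4) n2 := c2.
have /cvgrPdist_lt /(_ _ e4) n3 := c3.
have /cvgrPdist_lt /(_ _ e4) n4 := c4.
near=> y.
rewrite -N1N opprB /N1 /=.
have -> : e = e / 4 + e / 4 + e / 4 + e / 4 by field.
by rewrite !ltrD //; near: y; [exact: n1|exact: n2|exact: n3|exact: n4].
Unshelve. all: by end_near. Qed.

Lemma qdiff_near F x : qdiff F x -> forall e : R, 0 < e ->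
  \forall y \near x, N1 (F y - F x) < e.
Proof.
by move=> [d1 d2 d3 d4]; apply: near_N1; exact: differentiable_continuous.
Qed.

Lemma qder_near (u : R -> H) (t : R) (u' : H) : qder u t u' ->
  forall e : R, 0 < e -> \forall s \near t, N1 (u s - u t) < e.
Proof.
move=> [[d1 _] [d2 _] [d3 _] [d4 _]]; apply: (@near_N1 R u t).
- by move/derivable1_diffP: d1 => /differentiable_continuous.
- by move/derivable1_diffP: d2 => /differentiable_continuous.
- by move/derivable1_diffP: d3 => /differentiable_continuous.
- by move/derivable1_diffP: d4 => /differentiable_continuous.
Qed.

Lemma near_bound F x : qdiff F x ->
  exists2 K : R, 0 <= K & \forall y \near x, N1 (F y) <= K.
Proof.
move=> dF; exists (N1 (F x) + 1); first by rewrite addr_ge0 // N1_ge0.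
move: dF => /qdiff_near /(_ _ ltr01); apply: filterS => y h.
rewrite -(subrK (F x) (F y)) addrC; apply: le_trans (N1D _ _) _.
by rewrite lerD2l ltW.
Qed.

Lemma continuous_compR (g f : R -> R) : continuous g ->
  (forall t, {for g t, continuous f}) -> continuous (fun t => f (g t)).
Proof. by move=> cg cf t; apply: continuous_comp; [exact: cg|exact: cf]. Qed.

Lemma near0_lt (d : R) : 0 < d -> \forall h \near (0 : R * R), `|h| < d.
Proof.
move=> d0; apply/nbhs_ballP; exists d => // h.
by rewrite -ball_normE /= sub0r normrN.
Qed.

Lemma near_norm1 (P : set R) (x : R) : (\near x, P x) ->
  exists2 r : R, 0 < r & forall h, `|h| < r -> P (h + x).
Proof.
move=> /nbhs_ballP[r r0 rP]; exists r => // h hr; apply: rP.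
by rewrite -ball_normE /= opprD addrCA subrr addr0 normrN.
Qed.

Lemma linear_ode_at (K : R) : exists2 r : R, 0 < r & forall (a : R -> H) (t0 : R),
  qcont a -> (forall t, N1 (a t) <= K) ->
  exists u : R -> H, u t0 = 1 /\ forall t, `|t - t0| < r -> qder u t (a t * u t).
Proof.
have [r r0 Hr] := linear_ode K.
exists r => // a t0 ca aK.
have ca' : qcont (fun t => a (t + t0)).
  have c (f : R -> R) : continuous f -> continuous (fun t => f (t + t0)).
    move=> cf t; apply: (@continuous_comp _ _ _ (fun t => t + t0) f); last exact: cf.
    by apply: (@cvgD _ R^o); [exact: cvg_id|exact: cvg_cst].
  case: ca => c1 c2 c3 c4.
  by split; [exact: c c1|exact: c c2|exact: c c3|exact: c c4].
have [//|u [u0 du]] := Hr _ ca' _.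
exists (fun t => u (1 * t + - t0)); split; first by rewrite mul1r subrr.
move=> t tr; have tr' : - r < t - t0 < r by rewrite -ltr_norml.
have := du _ tr'; rewrite subrK => dt.
have E : 1 * t + - t0 = t - t0 by rewrite mul1r.
have := @qder_affine R u (- t0) 1 t (a t * u (t - t0)).
rewrite E => /(_ dt).
have -> : rq 1 * (a t * u (t - t0)) = a t * u (t - t0) by exact: mul1r.
exact.
Qed.

Lemma norm_pair_lt v (r : R) : (`|v| < r) = (`|v.1| < r) && (`|v.2| < r).
Proof. by rewrite prod_normE /= gt_max. Qed.

(* Solve along the first axis, then along each vertical line; flatness forces the
   equation in the first direction to hold off the axis as well. *)
Theorem flat_section U (A1 A2 : R * R -> H) x0 : open U -> U x0 ->
  qsmooth U A1 -> qsmooth U A2 ->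
  (forall x, U x -> qD (0, 1) A1 x + A1 x * A2 x = qD (1, 0) A2 x + A2 x * A1 x) ->
  exists r (S : R * R -> H), [/\ 0 < r, S x0 = 1 &
    forall h, `|h| < r -> [/\ U (h + x0), qdiff S (h + x0) &
      forall v, qD v S (h + x0)
        = (rq v.1 * A1 (h + x0) + rq v.2 * A2 (h + x0)) * S (h + x0)]].
Proof.
move=> oU Ux0 sA1 sA2 flat.
pose A11 := qD (1, 0) A1; pose A12 := qD (0, 1) A1; pose A21 := qD (1, 0) A2.
pose A211 := qD (1, 0) A21.
have sA11 : qsmooth U A11 by exact: qsmooth_qD.
have sA21 : qsmooth U A21 by exact: qsmooth_qD.
have sA211 : qsmooth U A211 by exact: qsmooth_qD.
have [K K0 [r1 r10 Hr1]] : exists2 K : R, 0 <= K & exists2 r1 : R, 0 < r1 & forall h, `|h| < r1 ->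
    [/\ U (h + x0), N1 (A1 (h + x0)) <= K, N1 (A2 (h + x0)) <= K,
        N1 (A11 (h + x0)) <= K & N1 (A21 (h + x0)) <= K /\ N1 (A211 (h + x0)) <= K].
  have [K1 p1 n1] := near_bound (qsmooth_qdiff sA1 Ux0).
  have [K2 p2 n2] := near_bound (qsmooth_qdiff sA2 Ux0).
  have [K3 p3 n3] := near_bound (qsmooth_qdiff sA11 Ux0).
  have [K4 p4 n4] := near_bound (qsmooth_qdiff sA21 Ux0).
  have [K5 p5 n5] := near_bound (qsmooth_qdiff sA211 Ux0).
  exists (K1 + (K2 + (K3 + (K4 + K5)))); first by rewrite !addr_ge0.
  apply: (@near_norm R (fun y => [/\ U y, N1 (A1 y) <= _, N1 (A2 y) <= _,
        N1 (A11 y) <= _ & N1 (A21 y) <= _ /\ N1 (A211 y) <= _])).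
  have n0 : \near x0, U x0 by exact: open_nbhs_nbhs.
  have l5 : K5 <= K1 + (K2 + (K3 + (K4 + K5))) by rewrite !addrA lerDr !addr_ge0.
  have l4 : K4 <= K1 + (K2 + (K3 + (K4 + K5))).
    by rewrite addrA addrA addrCA lerDl !addr_ge0.
  have l3 : K3 <= K1 + (K2 + (K3 + (K4 + K5))).
    by rewrite addrA addrCA lerDl !addr_ge0.
  have l2 : K2 <= K1 + (K2 + (K3 + (K4 + K5))) by rewrite addrCA lerDl !addr_ge0.
  have l1 : K1 <= K1 + (K2 + (K3 + (K4 + K5))) by rewrite lerDl !addr_ge0.
  near=> y; split; first by near: y.
  - by apply: le_trans l1; near: y.
  - by apply: le_trans l2; near: y.
  - by apply: le_trans l3; near: y.
  - by split; [apply: le_trans l4; near: y|apply: le_trans l5; near: y].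
have [r2 r20 ode] := linear_ode_at K.
(* [r < r1] keeps closed boxes where the bounds hold, [r <= 1] is required by the Gronwall constant,
   and [r <= r2] by solvability along each line. *)
pose r := Num.min (Num.min (r1 / 2) 1) r2.
have r0 : 0 < r by rewrite !lt_min r20 ltr01 divr_gt0.
have rr1 : r < r1.
  apply: (@le_lt_trans _ _ (r1 / 2)); first by rewrite /r !ge_min lexx.
  by rewrite ltr_pdivrMr // mulr_natr mulr2n ltrDl.
have rr2 : r <= r2 by rewrite /r ge_min lexx orbT.
have rle1 : r <= 1 by rewrite /r !ge_min lexx orbT.
case: x0 Ux0 Hr1 => a b Ux0 Hr1.
have inr (x y : R) : `|x - a| <= r -> `|y - b| <= r ->
    [/\ U (x, y), N1 (A1 (x, y)) <= K, N1 (A2 (x, y)) <= K,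
        N1 (A11 (x, y)) <= K & N1 (A21 (x, y)) <= K /\ N1 (A211 (x, y)) <= K].
  move=> xr yr; have -> : (x, y) = (x - a, y - b) + (a, b) by congr (_, _); rewrite subrK.
  by apply: Hr1; rewrite norm_pair_lt /= !(le_lt_trans _ rr1).
(* Clamping makes the coefficients continuous and bounded by [K] on the whole line, as
   [linear_ode_at] demands. *)
pose clamp (c t : R) : R := Num.max (c - r) (Num.min (c + r) t).
have clampP c t : `|clamp c t - c| <= r.
  rewrite ler_norml; apply/andP; split.
    by rewrite lerBrDr addrC /clamp le_max lexx.
  rewrite lerBlDl /clamp ge_max ge_min lexx /= andbT.
  by rewrite lerD2l -subr_ge0 opprK addr_ge0 // ltW.
have clamp_id c t : `|t - c| <= r -> clamp c t = t.
  rewrite ler_norml lerBrDr lerBlDl addrC /clamp => /andP[t1 t2].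
  by rewrite min_r // max_r.
have clamp_cont c : continuous (clamp c).
  move=> t; apply: (@continuous_max R R (cst (c - r)) (Num.min (c + r))).
    exact: cst_continuous.
  by apply: (@continuous_min R R (cst (c + r)) id); first exact: cst_continuous.
have qc_x F (y : R) : qsmooth U F -> `|y - b| <= r -> qcont (fun t => F (clamp a t, y)).
  move=> sF yr.
  have c (f : R * R -> R) : smooth_on U f -> continuous (fun t => f (clamp a t, y)).
    move=> sf; apply: (@continuous_compR (clamp a) (fun x : R => f (x, y))) => // t.
    have [Ut _ _ _ _] := inr _ _ (clampP a t) yr.
    apply: differentiable_continuous; apply/derivable1_diffP.
    by have [] := is_derive_x (smooth_on_diff sf Ut).
  by case: sF => s1 s2 s3 s4; split; [exact: c s1|exact: c s2|exact: c s3|exact: c s4].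
have qc_y F (x : R) : qsmooth U F -> `|x - a| <= r -> qcont (fun t => F (x, clamp b t)).
  move=> sF xr.
  have c (f : R * R -> R) : smooth_on U f -> continuous (fun t => f (x, clamp b t)).
    move=> sf; apply: (@continuous_compR (clamp b) (fun y : R => f (x, y))) => // t.
    have [Ut _ _ _ _] := inr _ _ xr (clampP b t).
    apply: differentiable_continuous; apply/derivable1_diffP.
    by have [] := is_derive_y (smooth_on_diff sf Ut).
  by case: sF => s1 s2 s3 s4; split; [exact: c s1|exact: c s2|exact: c s3|exact: c s4].
have bb : `|b - b| <= r by rewrite subrr normr0 ltW.
have [u [ua du]] := ode (fun t => A1 (clamp a t, b)) a (qc_x _ _ sA1 bb)
  (fun t => let: And5 _ k _ _ _ := inr _ _ (clampP a t) bb in k).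
(* The vertical solutions start from 1 at height [b]; right multiplication by [u x] gives them the
   value of the horizontal solution there and respects the equation. *)
have /choice[w Hw] : forall x : R, exists w : R -> H, w b = 1 /\
    forall t, `|t - b| < r2 -> qder w t (A2 (clamp a x, clamp b t) * w t).
  move=> x; apply: (ode (fun t => A2 (clamp a x, clamp b t)) b (qc_y _ _ sA2 (clampP a x))).
  by move=> t; have [] := inr _ _ (clampP a x) (clampP b t).
pose s (x y : R) := w x y * u x.
have s1 : s a b = 1 by rewrite /s (Hw a).1 ua mulr1.
have ds1 (x : R) : `|x - a| < r -> qder (s ^~ b) x (A1 (x, b) * s x b).
  move=> xr.
  have -> : s ^~ b = u by apply/funext => t; rewrite /s (Hw t).1 mul1r.
  rewrite /s (Hw x).1 mul1r.
  by have := du x (lt_le_trans xr rr2); rewrite clamp_id // ltW.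
have ds2 (x y : R) : `|x - a| < r /\ `|y - b| < r -> qder (s x) y (A2 (x, y) * s x y).
  move=> [xr yr]; rewrite /s mulrA; apply: qderMr.
  by have := (Hw x).2 y (lt_le_trans yr rr2); rewrite !clamp_id // ltW.
have inU (x y : R) : `|x - a| < r /\ `|y - b| < r ->
    [/\ U (x, y), N1 (A1 (x, y)) <= K, N1 (A2 (x, y)) <= K,
        N1 (A11 (x, y)) <= K & N1 (A21 (x, y)) <= K /\ N1 (A211 (x, y)) <= K].
  by move=> [xr yr]; apply: inr; exact: ltW.
have [L L0 HL] := @rectangle_expansion R (fun x y : R => A1 (x, y)) (fun x y : R => A2 (x, y))
  (fun x y : R => A11 (x, y)) (fun x y : R => A12 (x, y)) (fun x y : R => A21 (x, y))
  (fun x y : R => A211 (x, y)) a b r K r0 rle1 K0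
  (fun (x y : R) xy => qder_x (qsmooth_qdiff sA1 (let: And5 k _ _ _ _ := inU x y xy in k)))
  (fun (x y : R) xy => qder_y (qsmooth_qdiff sA1 (let: And5 k _ _ _ _ := inU x y xy in k)))
  (fun (x y : R) xy => qder_x (qsmooth_qdiff sA2 (let: And5 k _ _ _ _ := inU x y xy in k)))
  (fun (x y : R) xy => qder_x (qsmooth_qdiff sA21 (let: And5 k _ _ _ _ := inU x y xy in k)))
  (fun (x y : R) xy => (let: And5 _ k _ _ _ := inU x y xy in k))
  (fun (x y : R) xy => (let: And5 _ _ k _ _ := inU x y xy in k))
  (fun (x y : R) xy => (let: And5 _ _ _ k _ := inU x y xy in k))
  (fun (x y : R) xy => (let: And5 _ _ _ _ k := inU x y xy in k.1))
  (fun (x y : R) xy => (let: And5 _ _ _ _ k := inU x y xy in k.2))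
  (fun (x y : R) xy => (let: And5 k _ _ _ _ := inU x y xy in flat _ k)) s s1 ds1 ds2.
exists (r / 2), (fun p => s p.1 p.2); split => //; first by rewrite divr_gt0.
move=> h; rewrite norm_pair_lt => /andP[h1 h2].
have half (t : R) : `|t| < r / 2 -> `|t| < r.
  by move=> /lt_trans; apply; rewrite ltr_pdivrMr // mulr_natr mulr2n ltrDl.
have xr : `|h.1 + a - a| < r / 2 by rewrite addrK.
have yr : `|h.2 + b - b| < r / 2 by rewrite addrK.
have xy : `|h.1 + a - a| < r /\ `|h.2 + b - b| < r by rewrite !half.
have -> : h + (a, b) = (h.1 + a, h.2 + b) by [].
move: (h.1 + a) (h.2 + b) xr yr xy => x y xr yr xy {h h1 h2}.
have [Uxy _ _ _ _] := inU _ _ xy.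
suff [dS DS] : qdiff (fun p => s p.1 p.2) (x, y) /\ forall v : R * R,
    qD v (fun p => s p.1 p.2) (x, y)
    = (rq v.1 * A1 (x, y) + rq v.2 * A2 (x, y)) * s x y by [].
pose B1 := A1 (x, y) * s x y; pose B2 := A2 (x, y) * s x y.
have yb : `|y - b| < r by case: xy.
(* The increment splits into a horizontal step at height [l + y], controlled by
   [rectangle_expansion], a vertical step over [x], controlled by the mean value inequality, and the
   change of [A1 * s] between the two heights. *)
have expand (e : R) : 0 < e -> \forall h \near (0 : R * R),
    N1 (s (h.1 + x) (h.2 + y) - s x y - (rq h.1 * B1 + rq h.2 * B2)) <= e * `|h|.
  move=> e0.
  have e30 : 0 < e / 3 by lra.
  have e120 : 0 < e / 12 by lra.
  have dB (A : R * R -> H) : qsmooth U A ->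
      qder (fun t => A (x, t) * s x t) y
        (qD (0, 1) A (x, y) * s x y + A (x, y) * B2).
    by move=> sA; apply: qderM; [exact/qder_y/(qsmooth_qdiff sA)|exact: ds2].
  have [d1 d10 n1] := near_norm1 (qder_near (dB _ sA1) e30).
  have [d2 d20 n2] := near_norm1 (qder_near (dB _ sA2) e120).
  near=> h.
  have h1 : `|h| < d1 by near: h; exact: near0_lt.
  have h2 : `|h| < d2 by near: h; exact: near0_lt.
  have h3 : `|h| < r / 2 by near: h; apply: near0_lt; rewrite divr_gt0.
  have h4 : `|h| < r - `|y - b| by near: h; apply: near0_lt; rewrite subr_gt0.
  have h5 : `|h| < e / 3 / (L + 1).
    by near: h; apply: near0_lt; rewrite divr_gt0 // ltr_wpDl.
  have [k0 l0] : `|h.1| <= `|h| /\ `|h.2| <= `|h|.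
    by rewrite prod_normE /= !le_max !lexx orbT.
  move: h.1 h.2 (`|h|) h1 h2 h3 h4 h5 k0 l0 => k l m h1 h2 h3 h4 h5 k0 l0.
  have m0 : 0 <= m := le_trans (normr_ge0 _) k0.
  have yl (t : R) : `|t| <= m -> `|t + y - b| < r.
    move=> tm; rewrite -addrA; apply: le_lt_trans (ler_normD _ _) _.
    by rewrite -ltrBrDr; apply: le_lt_trans tm h4.
  have -> : s (k + x) (l + y) - s x y - (rq k * B1 + rq l * B2)
    = (s (x + k) (l + y) - s x (l + y) - rq k * (A1 (x, l + y) * s x (l + y)))
      + (s x (l + y) - s x y - rq l * B2)
      + rq k * (A1 (x, l + y) * s x (l + y) - A1 (x, y) * s x y).
    by rewrite [k + x]addrC /B1; qring.
  have -> : e * m = e / 3 * m + e / 3 * m + e / 3 * m by field.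
  apply: le_trans (N1D _ _) _; apply: lerD; first apply: le_trans (N1D _ _) _; first apply: lerD.
  - apply: le_trans (HL x k (l + y) xr (le_lt_trans k0 h3) (yl _ l0)) _.
    rewrite -(real_normK (num_real k)) expr2 mulrA; apply: ler_pM => //.
      by rewrite mulr_ge0.
    have Lm : m * (L + 1) <= e / 3.
      by rewrite -ler_pdivlMr ?ltW // ltr_wpDl.
    apply: le_trans Lm; rewrite mulrDr mulr1 mulrC.
    apply: le_trans (_ : m * L <= _); first exact: ler_wpM2r.
    by rewrite lerDl.
  - pose g t := s x t - rq t * B2.
    have -> : s x (l + y) - s x y - rq l * B2 = g (l + y) - g y.
      by rewrite /g; qring.
    have lE : `|l + y - y| = `|l| by rewrite addrK.
    have := @N1_MVT R g (fun t => A2 (x, t) * s x t - 1 * B2) y (l + y) (e / 12).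
    rewrite lE => /(_ _ _)/wrap[].
    + move=> t tl; apply: qderB; last exact: qderMr (qder_rq t).
      apply: ds2; split; first by case: xy.
      by rewrite -[t](subrK y); apply: yl; exact: le_trans tl l0.
    + move=> t tl; rewrite mul1r -[t](subrK y).
      by apply/ltW/n2; apply: le_lt_trans tl (le_lt_trans l0 h2).
    move=> E; apply: le_trans E _; have -> : 4 * (e / 12) = e / 3 by field.
    by apply: ler_wpM2l => //; exact: ltW.
  - apply: le_trans (N1M _ _) _; rewrite N1_rq mulrC; apply: ler_pM => //.
      exact: N1_ge0.
    by apply/ltW/n1; exact: le_lt_trans l0 h1.
have comp (pr : H -> R) : (forall p q : H, pr (p - q) = pr p - pr q) ->
   (forall p q : H, pr (p + q) = pr p + pr q) ->
   (forall (c : R) (p : H), pr (rq c * p) = c * pr p) ->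
   (forall p : H, `|pr p| <= N1 p) ->
   differentiable (pr \o (fun p => s p.1 p.2)) (x, y) /\
   forall v, 'D_v (pr \o (fun p => s p.1 p.2)) (x, y) = v.1 * pr B1 + v.2 * pr B2.
  move=> prB prD prZ prN; apply: eps_differentiable => e e0.
  apply: filterS (expand e e0) => h /=; apply: le_trans.
  by rewrite -!prZ -prD -!prB.
have Z (c : R) (q : H) : [/\ q1 (rq c * q) = c * q1 q, qi (rq c * q) = c * qi q,
    qj (rq c * q) = c * qj q & qk (rq c * q) = c * qk q].
  by split => /=; ring.
have [c1 D1] := comp (@q1 R) (fun _ _ => erefl) (fun _ _ => erefl)
  (fun c q => let: And4 k _ _ _ := Z c q in k) (fun q => let: And4 k _ _ _ := N1_comp q in k).
have [c2 D2] := comp (@qi R) (fun _ _ => erefl) (fun _ _ => erefl)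
  (fun c q => let: And4 _ k _ _ := Z c q in k) (fun q => let: And4 _ k _ _ := N1_comp q in k).
have [c3 D3] := comp (@qj R) (fun _ _ => erefl) (fun _ _ => erefl)
  (fun c q => let: And4 _ _ k _ := Z c q in k) (fun q => let: And4 _ _ k _ := N1_comp q in k).
have [c4 D4] := comp (@qk R) (fun _ _ => erefl) (fun _ _ => erefl)
  (fun c q => let: And4 _ _ _ k := Z c q in k) (fun q => let: And4 _ _ _ k := N1_comp q in k).
split=> // v.
rewrite /qD D1 D2 D3 D4 /= mulrDl -!mulrA -/B1 -/B2.
by apply: quat_ext => /=; ring.
Unshelve. all: by end_near. Qed.

End PlaneFields.

(** * Injective holomorphic functions *)

Section SecondDerivativeTest.
Variable R : realType.

Lemma is_derive_eps (f : R -> R) (x c : R) : is_derive x 1 f c ->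
  forall e : R, 0 < e -> exists2 d : R, 0 < d &
    forall h, `|h| < d -> `|f (h + x) - f x - h * c| <= e * `|h|.
Proof.
move=> [df Df] e e0.
have dif : differentiable f x by exact/derivable1_diffP.
have : \forall h \near (0 : R), `|f (h + x) - f x - h * c| <= e * `|h|.
  near=> h.
  have aux (p q s : R) : p + q + s - p - q = s by ring.
  have E : h * c = 'd f x h.
    have hE : h = h *: (1 : R) by rewrite /GRing.scale /= mulr1.
    by rewrite -Df deriveE // [in RHS]hE linearZ.
  by rewrite E (diff_locallyx dif h) aux; near: h; apply: littleoP.
move=> /nbhs_ballP[d d0 Hd]; exists d => // h hd; apply: Hd.
by rewrite -ball_normE /= sub0r normrN.
Unshelve. all: by end_near. Qed.

Definition der2 (f : R -> R) (c : R) := exists f1 : R -> R,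
  (\forall t \near (0 : R), is_derive t (1 : R) f (f1 t)) /\ is_derive (0 : R) (1 : R) f1 c.

(** Applying the mean value theorem to the even function f t + f (- t) avoids first showing that the
    derivative at 0 vanishes: a positive [c] would force f1 t - f1 (- t) >= c t > 0 for small t >
    0. *)
Lemma der2_max (f : R -> R) c : der2 f c ->
  (\forall t \near (0 : R), f t <= f 0) -> c <= 0.
Proof.
move=> [f1 [df d1]] fmax; rewrite leNgt; apply/negP => c0.
have c20 : 0 < c / 2 by rewrite divr_gt0.
have [d d0 Hd] := is_derive_eps d1 c20.
have [d' d'0 Hd'] : exists2 d' : R, 0 < d' &
    forall t, `|t| < d' -> is_derive t (1 : R) f (f1 t) /\ f t <= f 0.
  have [e1 e10 He1] := near_norm1 df; have [e2 e20 He2] := near_norm1 fmax.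
  exists (Num.min e1 e2); first by rewrite lt_min e10.
  move=> t; rewrite lt_min => /andP[t1 t2].
  by have := He1 _ t1; have := He2 _ t2; rewrite addr0.
pose m := Num.min d d' / 2.
have m0 : 0 < m by rewrite divr_gt0 // lt_min d0.
have [md md'] : m < d /\ m < d'.
  by split; (apply: (@lt_le_trans _ _ (Num.min d d'));
    [rewrite ltr_pdivrMr // mulr_natr mulr2n ltrDl lt_min d0 d'0
    |rewrite ge_min lexx ?orbT]).
have ds (t : R) : 0 <= t <= m -> is_derive t (1 : R) f (f1 t) /\ is_derive (- t) 1 f (f1 (- t)).
  move=> /andP[t0 tm]; split; apply: (Hd' _ _).1; rewrite ?normrN ger0_norm //;
  exact: le_lt_trans md'.
pose g t := f t + f (- t).
have dg (t : R) : 0 <= t <= m -> is_derive t (1 : R) g (f1 t - f1 (- t)).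
  move=> tI; have [da db] := ds t tI.
  have X := @is_derive1_comp _ f (fun s : R => - s) t _ _ db (is_deriveNid _ _).
  have Y := is_deriveD da X.
  by apply: (is_derive_eq Y); rewrite mulrN1.
have [||t + E] := @MVT R g (fun t => f1 t - f1 (- t)) 0 m m0.
- by move=> t; rewrite in_itv /= => /andP[t0 tm]; apply: dg; rewrite !ltW.
- apply: derivable_within_continuous => t; rewrite in_itv /= => tI.
  by have [] := dg t tI.
rewrite in_itv /= => /andP[t0 tm].
have gm : g m - g 0 <= 0.
  rewrite /g oppr0 subr_le0; apply: lerD; apply: (Hd' _ _).2;
  by rewrite ?normrN gtr0_norm.
move: gm; rewrite E subr0 pmulr_lle0 //.
have td : `|t| < d by rewrite gtr0_norm // (lt_trans tm).
have := Hd _ td; rewrite -normrN in td.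
have := Hd _ td; rewrite !addr0 normrN !(gtr0_norm t0) !ler_norml.
move: (f1 t) (f1 (- t)) (f1 0) => x y z /andP[_ h1] /andP[h2 _] h3.
have ct : 0 < c * t by rewrite mulr_gt0.
move: h1 h2 h3 ct; clear; nra.
Qed.

Lemma der2D f g a b : der2 f a -> der2 g b -> der2 (fun t => f t + g t) (a + b).
Proof.
move=> [f1 [df d1]] [g1 [dg e1]]; exists (fun t => f1 t + g1 t); split.
  near=> t; apply: is_deriveD; near: t; [exact: df|exact: dg].
exact: is_deriveD.
Unshelve. all: by end_near. Qed.

Lemma der2Z (k : R) f a : der2 f a -> der2 (fun t => k * f t) (k * a).
Proof.
move=> [f1 [df d1]]; exists (fun t => k * f1 t); split.
  near=> t; apply: is_deriveZ; near: t; exact: df.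
exact: is_deriveZ.
Unshelve. all: by end_near. Qed.

Lemma der2_ln_norm (a b a1 b1 : R -> R) (a2 b2 : R) :
  (\forall t \near (0 : R), is_derive t (1 : R) a (a1 t)) ->
  (\forall t \near (0 : R), is_derive t (1 : R) b (b1 t)) ->
  is_derive (0 : R) (1 : R) a1 a2 -> is_derive (0 : R) (1 : R) b1 b2 ->
  0 < a 0 ^+ 2 + b 0 ^+ 2 ->
  der2 (fun t => ln (a t ^+ 2 + b t ^+ 2))
    (2 * (a 0 * a2 + b 0 * b2 + a1 0 ^+ 2 + b1 0 ^+ 2) / (a 0 ^+ 2 + b 0 ^+ 2)
     - 4 * (a 0 * a1 0 + b 0 * b1 0) ^+ 2 / (a 0 ^+ 2 + b 0 ^+ 2) ^+ 2).
Proof.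
move=> da db da1 db1 n0.
pose n t := a t ^+ 2 + b t ^+ 2.
have dM (f g : R -> R) (t f' g' : R) : is_derive t (1 : R) f f' -> is_derive t (1 : R) g g' ->
    is_derive t (1 : R) (fun s => f s * g s) (f' * g t + f t * g').
  move=> df dg; have X := is_deriveM df dg; apply: (is_derive_eq X).
  by rewrite /GRing.scale /=; ring.
have dD (f g : R -> R) (t f' g' : R) : is_derive t (1 : R) f f' -> is_derive t (1 : R) g g' ->
    is_derive t (1 : R) (fun s => f s + g s) (f' + g') by move=> ? ?; exact: is_deriveD.
have dn (t : R) : is_derive t (1 : R) a (a1 t) -> is_derive t (1 : R) b (b1 t) ->
    is_derive t (1 : R) n (2 * (a t * a1 t + b t * b1 t)).
  move=> at' bt'; have X := dD _ _ _ _ _ (dM _ _ _ _ _ at' at') (dM _ _ _ _ _ bt' bt').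
  by apply: (is_derive_eq X); ring.
have da0 : is_derive (0 : R) (1 : R) a (a1 0) by exact: nbhs_singleton da.
have db0 : is_derive (0 : R) (1 : R) b (b1 0) by exact: nbhs_singleton db.
have nn : \forall t \near (0 : R), 0 < n t.
  have [dn0 _] := dn 0 da0 db0.
  have cn : {for 0, continuous n}.
    by apply: differentiable_continuous; apply/derivable1_diffP.
  exact: (cvgr_gt (n 0) cn).
exists (fun t => (n t)^-1 * (2 * (a t * a1 t + b t * b1 t))); split.
  near=> t.
  have nt : 0 < n t by near: t.
  have dt : is_derive t (1 : R) n (2 * (a t * a1 t + b t * b1 t)).
    by apply: dn; near: t.
  exact: (@is_derive1_comp _ (@ln R) n t _ _ (is_derive1_ln nt) dt).
have d0 := dn 0 da0 db0.
have dV : is_derive (0 : R) (1 : R) (fun t => (n t)^-1)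
    (- (n 0) ^- 2 * (2 * (a 0 * a1 0 + b 0 * b1 0))).
  have n00 : n 0 != 0 by rewrite gt_eqF.
  case: d0 => dn0 Dn0; split; first exact: derivableV.
  by rewrite deriveV // Dn0.
have X := dM _ _ _ _ _ dV (dM _ _ _ _ _ (is_derive_cst (2 : R) (0 : R) (1 : R))
  (dD _ _ _ _ _ (dM _ _ _ _ _ da0 da1) (dM _ _ _ _ _ db0 db1))).
apply: (is_derive_eq X); rewrite -/(n 0).
by field; rewrite gt_eqF.
Unshelve. all: by end_near. Qed.

End SecondDerivativeTest.

Section InjectiveHolomorphic.
Variable R : realType.
Implicit Types (U : set (R * R)) (f : R * R -> R) (x h z w v : R * R).

(** The norm on the product is the max norm; the Laplacian arguments need the squared Euclidean
    one. *)
Definition n2 (z : R * R) : R := z.1 ^+ 2 + z.2 ^+ 2.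

Lemma n2_ge0 z : 0 <= n2 z. Proof. by rewrite addr_ge0 // sqr_ge0. Qed.

Lemma n2_gt0 z : z != 0 -> 0 < n2 z.
Proof.
move=> z0; rewrite lt_def n2_ge0 andbT; apply: contra z0.
rewrite paddr_eq0 ?sqr_ge0 // !sqrf_eq0; case: z => a b /= /andP[/eqP-> /eqP->].
exact: eqxx.
Qed.

Lemma norm_n2 z : `|z| ^+ 2 <= n2 z <= 2 * `|z| ^+ 2.
Proof.
rewrite /n2 prod_normE /= -(real_normK (num_real z.1)) -(real_normK (num_real z.2)).
have := normr_ge0 z.1; have := normr_ge0 z.2; move: `|z.1| `|z.2| => a b b0 a0.
have [ab|ba] := leP a b; apply/andP; split.
- by rewrite lerDr sqr_ge0.
- have : a ^+ 2 <= b ^+ 2 by rewrite ler_sqr.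
  clear; lra.
- by rewrite lerDl sqr_ge0.
- have : b ^+ 2 <= a ^+ 2 by rewrite ler_sqr ?nnegrE // ltW.
  clear; lra.
Qed.

Lemma n2D x z : n2 (x + z) <= 2 * (n2 x + n2 z).
Proof.
rewrite /n2 /=; have := sqr_ge0 (x.1 - z.1); have := sqr_ge0 (x.2 - z.2).
by clear; lra.
Qed.

Lemma n2N z : n2 (- z) = n2 z. Proof. by rewrite /n2 /= !sqrrN. Qed.

Lemma MVT_line f x h : (forall t : R, 0 <= t <= 1 -> differentiable f (t *: h + x)) ->
  exists2 t : R, 0 < t < 1 & f (h + x) - f x = 'D_h f (t *: h + x).
Proof.
move=> df.
have [||t + E] := @MVT R (fun t => f (t *: h + x)) (fun t => 'D_h f (t *: h + x)) 0 1 ltr01.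
- by move=> t; rewrite in_itv /= => /andP[t0 t1]; apply/is_derive_line/df; rewrite !ltW.
- apply: derivable_within_continuous => t; rewrite in_itv /= => tI.
  by have [] := is_derive_line (df t tI).
rewrite in_itv /= => tI; exists t => //.
by move: E; rewrite scale1r scale0r add0r subr0 mulr1.
Qed.

Lemma scale_norm_le (t d : R) h : 0 <= t <= 1 -> `|h| < d -> `|t *: h| < d.
Proof.
move=> /andP[t0 t1]; apply: le_lt_trans.
by rewrite normrZ ger0_norm // -[leRHS]mul1r ler_wpM2r.
Qed.

Lemma derive_norm_le f x h : differentiable f x ->
  `|'D_h f x| <= (`|'D_(1, 0) f x| + `|'D_(0, 1) f x|) * `|h|.
Proof.
move=> df; rewrite differentiable_deriv //.
apply: le_trans (ler_normD _ _) _; rewrite !normrM mulrDl.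
by apply: lerD; rewrite mulrC; apply: ler_wpM2l => //;
  rewrite prod_normE /= le_max lexx ?orbT.
Qed.

(** The first derivatives vanish at [z0] and are differentiable there, hence are O(|h|); the mean
    value theorem along the segment raises this to second order. *)
Lemma quadratic_bound U f z0 : open U -> U z0 -> smooth_on U f ->
  (forall v, 'D_v f z0 = 0) -> exists2 C : R, 0 <= C & exists2 d : R, 0 < d &
  forall h, `|h| < d -> `|f (h + z0) - f z0| <= C * `|h| ^+ 2.
Proof.
move=> oU Uz0 sf f0.
have lip v : exists2 C : R, 0 <= C & exists2 d : R, 0 < d &
    forall h, `|h| < d -> `|'D_v f (h + z0)| <= C * `|h|.
  have /smooth_on_rec[_ /(_ v) sv] := sf.
  have dv := smooth_on_diff sv Uz0.
  have [d d0 Hd] := near_norm (differentiable_eps dv ltr01).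
  exists (1 + (`|'D_(1, 0) ('D_v f) z0| + `|'D_(0, 1) ('D_v f) z0|)).
    by rewrite !addr_ge0.
  exists d => // h hd; have := Hd _ hd; rewrite addr0 f0 subr0 mulrDl.
  have := derive_norm_le h dv.
  move: ('D_h ('D_v f) z0) ('D_v f (h + z0)) => p q pb qp.
  rewrite -(subrK p q); apply: le_trans (ler_normD _ _) _; exact: lerD.
have [C1 C10 [d1 d10 H1]] := lip (1, 0); have [C2 C20 [d2 d20 H2]] := lip (0, 1).
have [d3 d30 H3] := near_norm (open_nbhs_nbhs (conj oU Uz0)).
exists (C1 + C2); first exact: addr_ge0.
exists (Num.min d1 (Num.min d2 d3)); first by rewrite !lt_min d10 d20.
move=> h; rewrite !lt_min => /and3P[h1 h2 h3].
have [|t tI ->] := @MVT_line f z0 h.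
  move=> t tI; apply: smooth_on_diff sf _; apply: H3; exact: scale_norm_le.
have tI' : 0 <= t <= 1 by case/andP: tI => ? ?; rewrite !ltW.
have dt : differentiable f (t *: h + z0).
  by apply: smooth_on_diff sf _; apply: H3; exact: scale_norm_le.
apply: le_trans (derive_norm_le h dt) _; rewrite expr2 mulrA; apply: ler_wpM2r => //.
have th : `|t *: h| <= `|h|.
  by case/andP: tI' => t0 t1; rewrite normrZ ger0_norm // -[leRHS]mul1r ler_wpM2r.
rewrite mulrDl; apply: lerD.
  by apply: le_trans (H1 _ (scale_norm_le tI' h1)) _; exact: ler_wpM2l.
by apply: le_trans (H2 _ (scale_norm_le tI' h2)) _; exact: ler_wpM2l.
Qed.

Lemma holo_linear (u w : R * R -> R) x :
  differentiable u x -> differentiable w x ->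
  (forall v, 'D_(rotJ v) u x = - 'D_v w x /\ 'D_(rotJ v) w x = 'D_v u x) ->
  forall h, 'D_h u x = h.1 * 'D_(1, 0) u x - h.2 * 'D_(1, 0) w x /\
            'D_h w x = h.1 * 'D_(1, 0) w x + h.2 * 'D_(1, 0) u x.
Proof.
move=> du dw CR h; have := CR (1, 0).
rewrite /rotJ /= oppr0 => -[c1 c2].
by rewrite (differentiable_deriv h du) (differentiable_deriv h dw) c1 c2 mulrN.
Qed.

(* At [w] with nonvanishing derivative, [F] expands distances: this makes the
   comparison function of the next lemma small near [w]. *)
Lemma holo_lower_bound (u w : R * R -> R) x :
  differentiable u x -> differentiable w x ->
  (forall v, 'D_(rotJ v) u x = - 'D_v w x /\ 'D_(rotJ v) w x = 'D_v u x) ->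
  (exists v, 'D_v u x <> 0 \/ 'D_v w x <> 0) ->
  exists2 k : R, 0 < k & exists2 d : R, 0 < d & forall h, `|h| < d ->
    k * n2 h <= n2 (u (h + x) - u x, w (h + x) - w x).
Proof.
move=> du dw CR nz; have lin := holo_linear du dw CR.
set p := 'D_(1, 0) u x in lin; set q := 'D_(1, 0) w x in lin.
pose c := p ^+ 2 + q ^+ 2.
have c0 : 0 < c.
  rewrite lt_def addr_ge0 ?sqr_ge0 // andbT; apply/negP.
  rewrite paddr_eq0 ?sqr_ge0 // !sqrf_eq0 => /andP[/eqP p0 /eqP q0].
  by case: nz => v; rewrite (lin v).1 (lin v).2 p0 q0 !mulr0 subr0 addr0 => -[|].
exists (c / 4); first by rewrite divr_gt0.
(* By Cauchy-Riemann the differential has squared norm c |h|^2. From a^2 >= s^2 / 2 - (a - s)^2 in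
   both components the increment is at least c / 2 - 2 c / 8 = c / 4 times |h|^2. *)
pose e := Num.sqrt (c / 8).
have e0 : 0 < e by rewrite sqrtr_gt0 divr_gt0.
have e2 : e ^+ 2 = c / 8 by rewrite sqr_sqrtr // ltW // divr_gt0.
have [d1 d10 H1] := near_norm (differentiable_eps du e0).
have [d2 d20 H2] := near_norm (differentiable_eps dw e0).
exists (Num.min d1 d2); first by rewrite lt_min d10.
move=> h; rewrite lt_min => /andP[h1 h2].
have := H1 _ h1; have := H2 _ h2; rewrite addr0 (lin h).1 (lin h).2.
have := norm_n2 h; rewrite /n2 /=.
move: (u _ - u x) (w _ - w x) => a b /andP[nh _] Hb Ha.
have sq (s : R) : `|s| <= e * `|h| -> s ^+ 2 <= c / 8 * `|h| ^+ 2.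
  move=> se; rewrite -e2 -exprMn -(real_normK (num_real s)).
  by rewrite ler_sqr ?nnegrE // mulr_ge0 // ltW.
have {}Ha := sq _ Ha; have {}Hb := sq _ Hb.
have c8 : c / 8 * `|h| ^+ 2 <= c / 8 * (h.1 ^+ 2 + h.2 ^+ 2).
  by apply: ler_wpM2l => //; rewrite ltW // divr_gt0.
have E : c * (h.1 ^+ 2 + h.2 ^+ 2) = (h.1 * p - h.2 * q) ^+ 2 + (h.1 * q + h.2 * p) ^+ 2.
  by rewrite /c; ring.
have := sqr_ge0 (2 * a - (h.1 * p - h.2 * q)).
have := sqr_ge0 (2 * b - (h.1 * q + h.2 * p)).
move: Ha Hb c8 E; move: (h.1 * p - h.2 * q) (h.1 * q + h.2 * p) (h.1 ^+ 2 + h.2 ^+ 2) => s t n.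
move: (`|h| ^+ 2) => m; clearbody c; clear.
move=> Ha Hb c8 E q1 q2; rewrite !sqrrB in Ha Hb; rewrite !sqrrB in q1 q2.
nra.
Qed.

End InjectiveHolomorphic.

(** * Harmonicity of the logarithm of the modulus *)

Section LogHarmonic.
Variable R : realType.
Implicit Types (U : set (R * R)) (f : R * R -> R) (x h z w v : R * R).

Lemma closed_box_compact z (r : R) : compact [set x | `|x - z| <= r].
Proof.
have -> : [set x : R * R | `|x - z| <= r] =
    `[z.1 - r, z.1 + r] `*` `[z.2 - r, z.2 + r].
  apply/seteqP; split => x /=; rewrite prod_normE /= ge_max !in_itv /= !ler_distl.
    by move=> /andP[-> ->].
  by move=> [-> ->].
by apply: compact_setX; exact: segment_compact.
Qed.

Lemma dist_continuous z : continuous (fun x : R * R => `|x - z|).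
Proof.
move=> x; apply: cvg_norm.
by apply: cvgB; [exact: cvg_id|exact: cvg_cst].
Qed.

Lemma der2_ln_holo U (u w : R * R -> R) z v : open U -> U z ->
  smooth_on U u -> smooth_on U w -> 0 < u z ^+ 2 + w z ^+ 2 ->
  der2 (fun t : R => ln (u (t *: v + z) ^+ 2 + w (t *: v + z) ^+ 2))
    (2 * (u z * 'D_v ('D_v u) z + w z * 'D_v ('D_v w) z
       + ('D_v u z) ^+ 2 + ('D_v w z) ^+ 2) / (u z ^+ 2 + w z ^+ 2)
     - 4 * (u z * 'D_v u z + w z * 'D_v w z) ^+ 2 / (u z ^+ 2 + w z ^+ 2) ^+ 2).
Proof.
move=> oU Uz su sw n0.
have line (f : R * R -> R) : smooth_on U f ->
    (\forall t \near (0 : R), is_derive t (1 : R) (fun s : R => f (s *: v + z)) ('D_v f (t *: v + z)))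
    /\ is_derive (0 : R) (1 : R) (fun t : R => 'D_v f (t *: v + z)) ('D_v ('D_v f) z).
  move=> sf; have /smooth_on_rec[_ /(_ v) sv] := sf.
  split; last first.
    have := @is_derive_line R ('D_v f) z v 0.
    by rewrite scale0r add0r; apply; exact: smooth_on_diff sv Uz.
  have [d d0 Hd] := near_norm (open_nbhs_nbhs (conj oU Uz)).
  have v1 : 0 < `|v| + 1 by rewrite ltr_wpDl.
  apply/nbhs_ballP; exists (d / (`|v| + 1)); first exact: divr_gt0.
  move=> t; rewrite -ball_normE /= sub0r normrN ltr_pdivlMr // => td.
  apply: is_derive_line; apply: smooth_on_diff sf _; apply: Hd.
  rewrite normrZ; apply: le_lt_trans td.
  by apply: ler_wpM2l => //; rewrite lerDl.
have [u1 u2] := line u su; have [w1 w2] := line w sw.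
have := @der2_ln_norm R (fun t => u (t *: v + z)) (fun t => w (t *: v + z))
  (fun t => 'D_v u (t *: v + z)) (fun t => 'D_v w (t *: v + z)) _ _ u1 w1 u2 w2.
rewrite scale0r add0r; exact.
Qed.

Lemma smooth_on_fst U (c : R) : open U -> smooth_on U (fun x => x.1 - c).
Proof.
move=> oU; apply/smooth_on_rec.
have d x : differentiable (fun x : R * R => x.1 - c) x /\
    forall v, 'D_v (fun x : R * R => x.1 - c) x = v.1.
  have [|D E] := @eps_differentiable R (fun x : R * R => x.1 - c) x 1 0.
    move=> e e0; near=> h; rewrite mulr1 mulr0 addr0 /=.
    have -> : h.1 + x.1 - c - (x.1 - c) - h.1 = 0 by ring.
    by rewrite normr0 mulr_ge0 // ltW.
  by split=> // v; rewrite E mulr1 mulr0 addr0.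
split=> [x _|v]; first exact: (d x).1.
apply: (@eq_smooth_on R U (fun=> v.1)) => //; last exact: smooth_on_cst.
by move=> x _; rewrite (d x).2.
Unshelve. all: by end_near. Qed.

Lemma smooth_on_snd U (c : R) : open U -> smooth_on U (fun x => x.2 - c).
Proof.
move=> oU; apply/smooth_on_rec.
have d x : differentiable (fun x : R * R => x.2 - c) x /\
    forall v, 'D_v (fun x : R * R => x.2 - c) x = v.2.
  have [|D E] := @eps_differentiable R (fun x : R * R => x.2 - c) x 0 1.
    move=> e e0; near=> h; rewrite mulr1 mulr0 add0r /=.
    have -> : h.2 + x.2 - c - (x.2 - c) - h.2 = 0 by ring.
    by rewrite normr0 mulr_ge0 // ltW.
  by split=> // v; rewrite E mulr1 mulr0 add0r.
split=> [x _|v]; first exact: (d x).1.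
apply: (@eq_smooth_on R U (fun=> v.2)) => //; last exact: smooth_on_cst.
by move=> x _; rewrite (d x).2.
Unshelve. all: by end_near. Qed.

Definition CR U (u w : R * R -> R) := forall x v, U x ->
  'D_(rotJ v) u x = - 'D_v w x /\ 'D_(rotJ v) w x = 'D_v u x.

Lemma rotJ10 : rotJ (1, 0) = (0, 1) :> R * R.
Proof. by rewrite /rotJ /= oppr0. Qed.

(* [c1 + c2 = 0] says that [ln |F|^2] is harmonic off the zeros of [F]. *)
Lemma laplace_ln_holo U (u w : R * R -> R) z : open U -> U z ->
  smooth_on U u -> smooth_on U w -> CR U u w -> 0 < u z ^+ 2 + w z ^+ 2 ->
  exists c1 c2 : R, [/\ c1 + c2 = 0,
    der2 (fun t : R => ln (u (t *: ((1, 0) : R * R) + z) ^+ 2 + w (t *: ((1, 0) : R * R) + z) ^+ 2)) c1 &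
    der2 (fun t : R => ln (u (t *: ((0, 1) : R * R) + z) ^+ 2 + w (t *: ((0, 1) : R * R) + z) ^+ 2)) c2].
Proof.
move=> oU Uz su sw cr n0.
have cr1 x : U x -> 'D_(0, 1) u x = - 'D_(1, 0) w x /\ 'D_(0, 1) w x = 'D_(1, 0) u x.
  by move=> Ux; rewrite -rotJ10; exact: cr.
have near_eq (f g : R * R -> R) : (forall x, U x -> f x = g x) ->
    forall v, 'D_v f z = 'D_v g z.
  move=> fg v; apply: near_eq_derive; near=> x; apply: fg; near: x.
  exact: open_nbhs_nbhs.
have /smooth_on_rec[_ /(_ (1, 0)) s1] := sw.
have dN : 'D_(0, 1) (fun x => - 'D_(1, 0) w x) z = - 'D_(0, 1) ('D_(1, 0) w) z.
  by apply: deriveN; apply: diff_derivable; exact: smooth_on_diff s1 Uz.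
have dN' : 'D_(1, 0) (fun x => - 'D_(1, 0) w x) z = - 'D_(1, 0) ('D_(1, 0) w) z.
  by apply: deriveN; apply: diff_derivable; exact: smooth_on_diff s1 Uz.
have Cw := smooth_on_commute (1, 0) (0, 1) oU Uz sw.
have Cu := smooth_on_commute (1, 0) (0, 1) oU Uz su.
have E1 := near_eq _ _ (fun x Ux => (cr1 x Ux).1) (0, 1).
have E2 := near_eq _ _ (fun x Ux => (cr1 x Ux).2) (1, 0).
have E3 := near_eq _ _ (fun x Ux => (cr1 x Ux).2) (0, 1).
have E4 := near_eq _ _ (fun x Ux => (cr1 x Ux).1) (1, 0).
(* Both components are harmonic: Cauchy-Riemann twice, with the mixed derivatives exchanged in
   between. *)
have D2u : 'D_(0, 1) ('D_(0, 1) u) z = - 'D_(1, 0) ('D_(1, 0) u) z.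
  exact: etrans E1 (etrans dN (congr1 (fun c : R => - c) (etrans Cw E2))).
have D2w : 'D_(0, 1) ('D_(0, 1) w) z = - 'D_(1, 0) ('D_(1, 0) w) z.
  exact: etrans E3 (etrans Cu (etrans E4 dN')).
have H1 := der2_ln_holo (1, 0) oU Uz su sw n0.
have H2 := der2_ln_holo (0, 1) oU Uz su sw n0.
have [D1u D1w] := cr1 _ Uz.
rewrite D2u D2w D1u D1w in H2.
exists (2 * (u z * 'D_(1, 0) ('D_(1, 0) u) z + w z * 'D_(1, 0) ('D_(1, 0) w) z
       + ('D_(1, 0) u z) ^+ 2 + ('D_(1, 0) w z) ^+ 2) / (u z ^+ 2 + w z ^+ 2)
     - 4 * (u z * 'D_(1, 0) u z + w z * 'D_(1, 0) w z) ^+ 2 / (u z ^+ 2 + w z ^+ 2) ^+ 2).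
exists (2 * (u z * - 'D_(1, 0) ('D_(1, 0) u) z + w z * - 'D_(1, 0) ('D_(1, 0) w) z
       + (- 'D_(1, 0) w z) ^+ 2 + ('D_(1, 0) u z) ^+ 2) / (u z ^+ 2 + w z ^+ 2)
     - 4 * (u z * - 'D_(1, 0) w z + w z * 'D_(1, 0) u z) ^+ 2 / (u z ^+ 2 + w z ^+ 2) ^+ 2).
split; [|exact: H1|exact: H2].
move: ('D_(1, 0) ('D_(1, 0) u) z) ('D_(1, 0) ('D_(1, 0) w) z) ('D_(1, 0) u z)
  ('D_(1, 0) w z) (u z) (w z) n0 => p q r s a b n0; clear -n0.
by field; rewrite gt_eqF.
Unshelve. all: by end_near. Qed.

End LogHarmonic.

(** * A maximum principle against critical points *)

Section CriticalPoints.
Variable R : realType.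
Implicit Types (U : set (R * R)) (x h z w v : R * R).

Lemma der2_comp_max (f : R * R -> R) z v c : der2 (fun t : R => f (t *: v + z)) c ->
  (\forall x \near z, f x <= f z) -> c <= 0.
Proof.
move=> d2 fz; apply: der2_max d2 _; rewrite scale0r add0r.
have [d d0 Hd] := near_norm fz.
have v1 : 0 < `|v| + 1 by rewrite ltr_wpDl.
apply/nbhs_ballP; exists (d / (`|v| + 1)); first exact: divr_gt0.
move=> t; rewrite -ball_normE /= sub0r normrN ltr_pdivlMr // => td.
apply: Hd; rewrite normrZ; apply: le_lt_trans td.
by apply: ler_wpM2l => //; rewrite lerDl.
Qed.

Lemma n2_diff (a b : R * R -> R) x : differentiable a x -> differentiable b x ->
  differentiable (fun y => n2 (a y, b y)) x.
Proof.
move=> da db.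
rewrite (_ : (fun y => _) = (fun y => a y * a y + b y * b y)); last first.
  by apply/funext => y; rewrite /n2 /= !expr2.
by apply: differentiableD; apply: differentiableM.
Qed.

(* If [F' z0 = 0], the function [|z - w|^6 e^(|z - z0|^2) / |F z - F w|^4] takes at
   [z0], for [w] close to [z0] with [F' w <> 0], a value larger than on a fixed
   circle around [z0] and than near [w]; so it has an interior maximum, although
   its logarithm has positive Laplacian. *)
Theorem injective_holomorphic U (u w : R * R -> R) z0 : open U -> U z0 ->
  smooth_on U u -> smooth_on U w -> CR U u w ->
  (forall x y : R * R, U x -> U y -> u x = u y -> w x = w y -> x = y) ->
  exists v, 'D_v u z0 <> 0 \/ 'D_v w z0 <> 0.
Proof.
move=> oU Uz0 su sw cr inj; apply: contrapT => nex.
have Du v : 'D_v u z0 = 0 by apply: contrapT => D; apply: nex; exists v; left.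
have Dw v : 'D_v w z0 = 0 by apply: contrapT => D; apply: nex; exists v; right.
have dif_u x : U x -> differentiable u x := smooth_on_diff su.
have dif_w x : U x -> differentiable w x := smooth_on_diff sw.
pose G x y : R := n2 (u x - u y, w x - w y).
have Gpos x y : U x -> U y -> x != y -> 0 < G x y.
  move=> Ux Uy xy; apply: n2_gt0; apply/eqP => -[/eqP + /eqP].
  by rewrite !subr_eq0 => /eqP ux /eqP wx; move: xy; rewrite (inj x y) ?eqxx.
have cG y x : U x -> {for x, continuous (G ^~ y)}.
  move=> Ux; apply: differentiable_continuous.
  apply: n2_diff; apply: differentiableB => //; [exact: dif_u|exact: dif_w].
have [r1 r10 Hr1] := near_norm (open_nbhs_nbhs (conj oU Uz0)).
pose r := r1 / 2.
have r0 : 0 < r by rewrite divr_gt0.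
have inU x : `|x - z0| <= r -> U x.
  move=> xr; rewrite -(subrK z0 x); apply: Hr1; apply: le_lt_trans xr _.
  by rewrite ltr_pdivrMr // mulr_natr mulr2n ltrDl.
pose B := [set x | `|x - z0| <= r].
pose S := B `&` [set x | `|x - z0| = r].
have cB : compact B by exact: closed_box_compact.
have clS : closed [set x : R * R | `|x - z0| = r].
  rewrite (_ : [set _ | _] = (fun x => `|x - z0|) @^-1` [set r]) //.
  by apply: closed_comp; [move=> x _; exact: dist_continuous|exact: closed_eq].
have cS : compact S.
  apply: (subclosed_compact _ cB) => [|x []//].
  by apply: closedI => //; exact: compact_closed (@norm_hausdorff _ _) cB.
have S0 : S !=set0.
  exists (z0 + (r, 0)); rewrite /S /B /=.
  have -> : z0 + (r, 0) - z0 = (r, 0) by rewrite addrC addKr.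
  have -> : `|(r, 0) : R * R| = r.
    by rewrite prod_normE /= normr0 (ger0_norm (ltW r0)) max_l ?ltW.
  by [].
have withinC (A : set (R * R)) (f : R * R -> R) :
    (forall x, A x -> {for x, continuous f}) -> {within A, continuous f}.
  by move=> cf; apply: continuous_in_subspaceT => x; rewrite inE; exact: cf.
have [s0 s0S min0] := compact_EVT_min S0 cS
  (withinC S _ (fun x Sx => cG z0 x (inU x Sx.1))).
(* The minimum of |F - F z0|^2 on the boundary of the box, positive by injectivity. *)
pose m := G s0 z0.
have m0 : 0 < m.
  move: s0S; rewrite inE => -[s0B /= s0r]; apply: Gpos => //; first exact: inU.
  by apply/eqP => E; move: s0r; rewrite E subrr normr0 => /eqP; rewrite eq_sym gt_eqF.
have GS x : S x -> m <= G x z0 by move=> Sx; apply: min0; rewrite inE.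
have [C1 C10 [d1 d10 H1]] := quadratic_bound oU Uz0 su Du.
have [C2 C20 [d2 d20 H2]] := quadratic_bound oU Uz0 sw Dw.
pose C := C1 ^+ 2 + C2 ^+ 2 + 1.
have C0 : 0 < C by rewrite ltr_wpDl // addr_ge0 // sqr_ge0.
have GC x : `|x - z0| < d1 -> `|x - z0| < d2 -> G z0 x <= C * n2 (x - z0) ^+ 2.
  move=> xd1 xd2.
  have := H1 _ xd1; have := H2 _ xd2; rewrite subrK /G /n2 /=.
  have /andP[nn _] := norm_n2 (x - z0).
  rewrite -/(n2 (x - z0)) -(sqrrN (u z0 - u x)) -(sqrrN (w z0 - w x)) !opprB.
  have sq (t c : R) : 0 <= c -> `|t| <= c * `|x - z0| ^+ 2 ->
      t ^+ 2 <= c ^+ 2 * n2 (x - z0) ^+ 2.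
    move=> c0 tc; rewrite -exprMn -(real_normK (num_real t)).
    rewrite ler_sqr ?nnegrE ?mulr_ge0 ?n2_ge0 //; apply: le_trans tc _.
    exact: ler_wpM2l.
  move=> /(sq _ _ C20) h2 /(sq _ _ C10) h1; apply: le_trans (lerD h1 h2) _.
  by rewrite -mulrDl; apply: ler_wpM2r; rewrite ?sqr_ge0 // /C lerDl.
pose M := expR (2 * r ^+ 2).
have M0 : 0 < M by exact: expR_gt0.
(* A bound for [phi] on the boundary: there |x - y|^2 <= 2 (2 r)^2, the exponential is at most [M],
   and |F x - F y|^2 >= m / 4 because |F y - F z0|^2 < m / 4. *)
pose Q := (8 * r ^+ 2) ^+ 3 * M / (m / 4) ^+ 2 + 1.
have Q0 : 0 < Q.
  have r2 : 0 < 8 * r ^+ 2 by rewrite mulr_gt0 // exprn_gt0.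
  by rewrite addr_gt0 // divr_gt0 ?mulr_gt0 // exprn_gt0 // divr_gt0.
have Gcont : \forall y \near z0, G y z0 < m / 4.
  apply: (cvgr_lt (G z0 z0) (cG z0 _ Uz0)).
  by rewrite /G /n2 /= !subrr expr0n /= addr0 divr_gt0.
have [d3 d30 H3] := near_norm Gcont.
pose d4 := Num.min (Num.min r d1) (Num.min d2 d3).
(* With n = |z0 - y|^2, [phi z0] is at least 1 / (C^2 n), and n <= 2 |y - z0| when the max norm is
   at most 1; the last radius makes this larger than [Q]. *)
pose d5 := Num.min d4 (Num.min 1 ((2 * C ^+ 2 * Q)^-1)).
have d50 : 0 < d5.
  by rewrite !lt_min r0 d10 d20 d30 ltr01 invr_gt0 !mulr_gt0 // exprn_gt0.
(* If all derivatives vanished near [z0], F would be constant there, against injectivity. *)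
have [y [yd [v Dv]]] : exists y, `|y - z0| < d5 /\ exists v, 'D_v u y <> 0 \/ 'D_v w y <> 0.
  apply: contrapT => ney.
  have Dz (f : R * R -> R) : (f = u \/ f = w) -> forall h, `|h| < d5 -> f (h + z0) = f z0.
    move=> fuw h hd.
    have dU (t : R) : 0 <= t <= 1 -> U (t *: h + z0).
      move=> tI; apply: inU; rewrite addrK ltW //; apply: lt_le_trans (scale_norm_le tI hd) _.
      by rewrite /d5 /d4 !ge_min lexx.
    have [|t /andP[t0 t1] E] := @MVT_line R f z0 h.
      by move=> t tI; case: fuw => ->; [apply: dif_u|apply: dif_w]; exact: dU.
    apply/eqP; rewrite -subr_eq0 E; apply/eqP; apply: contrapT => D; apply: ney.
    exists (t *: h + z0); split; last first.
      by exists h; case: fuw D => -> D; [left|right].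
    by rewrite addrK; apply: scale_norm_le => //; rewrite !ltW.
  have hd : `|(d5 / 2, 0) : R * R| < d5.
    rewrite prod_normE /= normr0 (ger0_norm (ltW (divr_gt0 d50 _))) //.
    by rewrite max_l ?ltW ?divr_gt0 // ltr_pdivrMr // mulr_natr mulr2n ltrDl.
  have Uh : U ((d5 / 2, 0) + z0).
    by apply: inU; rewrite addrK ltW // (lt_le_trans hd) // /d5 /d4 !ge_min lexx.
  have E := inj _ _ Uh Uz0 (Dz u (or_introl erefl) _ hd) (Dz w (or_intror erefl) _ hd).
  move: E => /(congr1 (fun p => p.1 - z0.1)); rewrite /= addrK subrr => /eqP.
  by rewrite mulf_eq0 gt_eqF //= invr_eq0 pnatr_eq0.
move: yd; rewrite !lt_min => /andP[/andP[/andP[yr yd1] /andP[yd2 yd3]] /andP[y1 yQ]].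
have Uy : U y by apply: inU; exact: ltW.
have yz0 : y != z0.
  by apply/eqP => E; move: Dv; rewrite E Du Dw => -[|].
have [k k0 [d6 d60 H6]] := holo_lower_bound (dif_u _ Uy) (dif_w _ Uy)
  (fun v => cr y v Uy) (ex_intro _ v Dv).
(* The exponents 3 and 2 separate two rates. At the critical point [z0] the denominator is O(n^4) in
   n = |z0 - y|^2, so the value grows as [y] approaches [z0]; around [y], where the derivative is
   nonzero, the denominator is at least of order n^2 in n = |x - y|^2, so [phi] tends to 0. *)
pose phi x := n2 (x - y) ^+ 3 * expR (n2 (x - z0)) / G x y ^+ 2.
have n2y : 0 < n2 (z0 - y) by apply: n2_gt0; rewrite subr_eq0 eq_sym.
have phi0 : 0 < phi z0.
  by rewrite /phi divr_gt0 // ?mulr_gt0 ?expR_gt0 ?exprn_gt0 // Gpos // eq_sym.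
have nyE : n2 (y - z0) = n2 (z0 - y) by rewrite -n2N opprB.
have phiQ : Q < phi z0.
  have G0 : 0 < G z0 y by apply: Gpos => //; rewrite eq_sym.
  have := GC _ yd1 yd2; rewrite nyE => GCy.
  rewrite /phi subrr (_ : n2 0 = 0); last by rewrite /n2 /= expr0n /= addr0.
  rewrite expR0 mulr1 ltr_pdivlMr ?exprn_gt0 //.
  have GG : G z0 y ^+ 2 <= C ^+ 2 * n2 (z0 - y) ^+ 4.
    have E0 (b n : R) : b ^+ 2 * n ^+ 4 = (b * n ^+ 2) ^+ 2 by ring.
    rewrite E0.
    by rewrite ler_sqr ?nnegrE // ?ltW // mulr_gt0 // exprn_gt0.
  apply: le_lt_trans (ler_wpM2l (ltW Q0) GG) _.
  have E1 (a b n : R) : a * (b ^+ 2 * n ^+ 4) = (a * b ^+ 2 * n) * n ^+ 3 by ring.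
  rewrite E1.
  rewrite -[ltRHS]mul1r ltr_pM2r ?exprn_gt0 //.
  have /andP[_ nle] := norm_n2 (y - z0); rewrite nyE in nle.
  have CQ0 : 0 < 2 * C ^+ 2 * Q by rewrite !mulr_gt0 // exprn_gt0.
  have n1 : n2 (z0 - y) <= 2 * `|y - z0|.
    apply: le_trans nle _; rewrite ler_wpM2l // expr2.
    by rewrite -[leRHS]mul1r ler_wpM2r // ltW.
  apply: (@le_lt_trans _ _ ((2 * C ^+ 2 * Q) * `|y - z0|)); last first.
    by rewrite mulrC -ltr_pdivlMr // mul1r.
  have E2 (a b n : R) : 2 * b ^+ 2 * a * n = a * b ^+ 2 * (2 * n) by ring.
  rewrite E2.
  by apply: ler_wpM2l => //; rewrite mulr_ge0 ?sqr_ge0 // ltW.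
have expM x : B x -> expR (n2 (x - z0)) <= M.
  move=> Bx; rewrite ler_expR; have /andP[_] := norm_n2 (x - z0).
  move=> /le_trans; apply; apply: ler_wpM2l => //; rewrite ler_sqr ?nnegrE //.
  exact: ltW.
have phiS x : S x -> phi x <= Q.
  move=> Sx; have Bx := Sx.1.
  have n8 : n2 (x - y) <= 8 * r ^+ 2.
    have /andP[_ nle] := norm_n2 (x - y); apply: le_trans nle _.
    have E8 (b : R) : 8 * b ^+ 2 = 2 * (2 * b) ^+ 2 by ring.
    rewrite E8.
    have nr : `|x - y| <= 2 * r.
      have -> : x - y = (x - z0) - (y - z0) by rewrite opprB addrA subrK.
      apply: le_trans (ler_normB _ _) _; rewrite mulr_natl mulr2n.
      by apply: lerD => //; exact: ltW.
    have r20 : 0 <= 2 * r := le_trans (normr_ge0 _) nr.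
    by rewrite ler_wpM2l // ler_sqr ?nnegrE.
  have Gm : m / 4 <= G x y.
    have : G x z0 <= 2 * (G x y + G y z0).
      have := n2D (u x - u y, w x - w y) (u y - u z0, w y - w z0).
      rewrite (_ : _ + (u y - u z0, w y - w z0) = (u x - u z0, w x - w z0)) //.
      by congr (_, _); rewrite /= addrA subrK.
    have := GS _ Sx; have := H3 _ yd3; rewrite subrK.
    move: (G x z0) (G x y) (G y z0); clearbody m; clear => a b c; lra.
  have m40 : 0 < m / 4 by rewrite divr_gt0.
  have G0 : 0 < G x y := lt_le_trans m40 Gm.
  apply: (@le_trans _ _ ((8 * r ^+ 2) ^+ 3 * M / (m / 4) ^+ 2)); last by rewrite /Q lerDl.
  rewrite /phi; apply: ler_pM.
  - by rewrite mulr_ge0 ?exprn_ge0 ?n2_ge0 // expR_ge0.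
  - by rewrite invr_ge0 sqr_ge0.
  - apply: ler_pM; rewrite ?exprn_ge0 ?n2_ge0 ?expR_ge0 //; last exact: expM.
    by rewrite lerXn2r ?nnegrE ?n2_ge0 // mulr_ge0 ?sqr_ge0.
  - by rewrite lef_pV2 ?posrE ?exprn_gt0 // lerXn2r ?nnegrE // ltW.
have [eta [eta0 eta1 eta2]] : exists eta : R, [/\ 0 < eta, eta < `|z0 - y| &
    forall x, B x -> `|x - y| = eta -> phi x < phi z0].
  pose e1 := Num.min (Num.min d6 `|z0 - y|) (Num.min 1 (phi z0 * k ^+ 2 / (2 * M))).
  have e10 : 0 < e1.
    have pk : 0 < phi z0 * k ^+ 2 / (2 * M).
      by apply: divr_gt0; apply: mulr_gt0 => //; exact: exprn_gt0.
    by rewrite !lt_min d60 ltr01 normr_gt0 subr_eq0 eq_sym yz0 /=.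
  have e12 : e1 / 2 < e1 by rewrite ltr_pdivrMr // mulr_natr mulr2n ltrDl.
  exists (e1 / 2); split; first exact: divr_gt0.
    by apply: lt_le_trans e12 _; rewrite /e1 !ge_min lexx ?orbT.
  move=> x Bx xe.
  move: e12; rewrite -xe !lt_min => /andP[/andP[x6 _] /andP[x1 xM]].
  have xy : x != y.
    by apply/eqP => E; move: xe; rewrite E subrr normr0 => /eqP; rewrite lt_eqF // divr_gt0.
  have nxy : 0 < n2 (x - y) by apply: n2_gt0; rewrite subr_eq0.
  have := H6 _ x6; rewrite subrK -/(G x y) => Gk.
  have kn : 0 < k * n2 (x - y) by exact: mulr_gt0.
  have G0 : 0 < G x y := lt_le_trans kn Gk.
  apply: (@le_lt_trans _ _ (n2 (x - y) ^+ 3 * M / (k * n2 (x - y)) ^+ 2)).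
    rewrite /phi; apply: ler_pM.
    - by rewrite mulr_ge0 ?exprn_ge0 ?n2_ge0 // expR_ge0.
    - by rewrite invr_ge0 sqr_ge0.
    - by apply: ler_wpM2l; [rewrite exprn_ge0 ?n2_ge0|exact: expM].
    - by rewrite lef_pV2 ?posrE ?exprn_gt0 // lerXn2r ?nnegrE // ltW.
  have /andP[_ nle] := norm_n2 (x - y).
  have n1 : n2 (x - y) <= 2 * `|x - y|.
    apply: le_trans nle _; rewrite ler_wpM2l // expr2.
    by rewrite -[leRHS]mul1r ler_wpM2r // ltW.
  have E9 (n b c : R) : 0 < n -> 0 < c -> n ^+ 3 * b / (c * n) ^+ 2 = n * b / c ^+ 2.
    by move=> n0 c0; field; rewrite !gt_eqF.
  rewrite E9 //.
  rewrite ltr_pdivrMr ?exprn_gt0 //.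
  apply: le_lt_trans (ler_wpM2r (ltW M0) n1) _.
  by rewrite mulrAC mulrC -ltr_pdivlMr // mulr_gt0.
(* A small open square around [y] is removed because the denominator of [phi] vanishes at [y]. *)
pose B' := B `&` [set x | eta <= `|x - y|].
have cB' : compact B'.
  apply: (subclosed_compact _ cB) => [|x []//].
  apply: closedI; first exact: compact_closed (@norm_hausdorff _ _) cB.
  rewrite (_ : [set _ | _] = (fun x => `|x - y|) @^-1` [set t | eta <= t]) //.
  by apply: closed_comp; [move=> x _; exact: dist_continuous|exact: closed_ge].
have B'z0 : B' z0 by split; rewrite /B /= ?subrr ?normr0 ltW.
have B'y x : B' x -> x != y.
  move=> [_ /= xe]; apply/eqP => E; move: xe; rewrite E subrr normr0 leNgt.
  by rewrite eta0.
have B'G x : B' x -> 0 < G x y.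
  by move=> Bx; apply: Gpos => //; [exact: inU Bx.1|exact: B'y].
have cn z x : {for x, continuous (fun x => n2 (x - z))}.
  apply: differentiable_continuous.
  apply: (@n2_diff (fun x => x.1 - z.1) (fun x => x.2 - z.2)).
    exact: smooth_on_diff (smooth_on_fst z.1 openT) I.
  exact: smooth_on_diff (smooth_on_snd z.2 openT) I.
have cphi x : B' x -> {for x, continuous phi}.
  move=> Bx.
  have contc (g : R * R -> R) (f : R -> R) : {for x, continuous g} -> continuous f ->
      {for x, continuous (fun t => f (g t))}.
    by move=> cg cf; apply: continuous_comp; [exact: cg|exact: cf].
  have cg := cG y x (inU x Bx.1).
  have g0 : G x y ^+ 2 != 0 by rewrite expf_neq0 // gt_eqF // B'G.
  have c3 := contc _ (fun t => t ^+ 2) cg (@exprn_continuous R 2).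
  have c1 := contc _ (fun t => t ^+ 3) (cn y x) (@exprn_continuous R 3).
  have c2 := contc _ _ (cn z0 x) (@continuous_expR R).
  apply: cvgM; first by apply: cvgM; [exact: c1|exact: c2].
  by apply: cvgV => //; exact: c3.
have [zm] := compact_EVT_max (ex_intro _ _ B'z0) cB' (withinC _ _ cphi).
rewrite inE => B'zm maxm.
have {}maxm x : B' x -> phi x <= phi zm by move=> Bx; apply: maxm; rewrite inE.
have zm0 : 0 < phi zm := lt_le_trans phi0 (maxm _ B'z0).
have zmr : `|zm - z0| < r.
  rewrite lt_def; case: (B'zm) => /= zB _; rewrite zB andbT; apply/eqP => E.
  have : phi zm <= Q by apply: phiS; split => //=.
  by rewrite leNgt (lt_le_trans phiQ) // maxm.
have zme : eta < `|zm - y|.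
  rewrite lt_def; case: (B'zm) => /= zB ze; rewrite ze andbT; apply/eqP => E.
  by have := eta2 _ zB E; rewrite ltNge maxm.
have Uzm : U zm by apply: inU; exact: ltW.
have near_B' : \forall x \near zm, B' x.
  have n1 : \forall x \near zm, `|x - z0| < r.
    exact: (cvgr_lt _ (@dist_continuous R z0 zm)).
  have n2 : \forall x \near zm, eta < `|x - y|.
    exact: (cvgr_gt _ (@dist_continuous R y zm)).
  by near=> x; split; apply: ltW; near: x.
pose psi x := 3 * ln (n2 (x - y)) + -2 * ln (G x y) + n2 (x - z0).
have psiE x : B' x -> psi x = ln (phi x).
  move=> Bx; have G0 := B'G _ Bx.
  have nx : 0 < n2 (x - y) by apply: n2_gt0; rewrite subr_eq0 B'y.
  rewrite /phi ln_div ?posrE ?mulr_gt0 ?exprn_gt0 ?expR_gt0 //.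
  rewrite lnM ?posrE ?exprn_gt0 ?expR_gt0 // expRK !lnXn // /psi.
  by rewrite -[ln _ *+ 3]mulr_natl -[ln _ *+ 2]mulr_natl; ring.
have near_psi : \forall x \near zm, psi x <= psi zm.
  apply: filterS near_B' => x Bx; rewrite !psiE // ler_ln ?posrE ?maxm //.
  have G0 := B'G _ Bx.
  have nx : 0 < n2 (x - y) by apply: n2_gt0; rewrite subr_eq0 B'y.
  by rewrite /phi divr_gt0 // ?mulr_gt0 ?expR_gt0 ?exprn_gt0.
(* The two logarithms contribute 0 to the sum and |x - z0|^2 contributes 2 in each direction, 4 in
   total. *)
have [c1 [c2 [c12 p1 p2]]] : exists c1 c2 : R, [/\ 0 < c1 + c2,
    der2 (fun t : R => psi (t *: ((1, 0) : R * R) + zm)) c1 &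
    der2 (fun t : R => psi (t *: ((0, 1) : R * R) + zm)) c2].
  (* x - y is one more holomorphic function, so the same lemma gives the harmonicity of both
     logarithms. *)
  have crF : CR [set: R * R] (fun x => x.1 - y.1) (fun x => x.2 - y.2).
    have dc (i : R * R -> R) (c : R) : (forall a b, i (a + b) = i a + i b) ->
        (forall (a : R) b, i (a *: b) = a * i b) -> forall x v,
        'D_v (fun x => i x - c) x = i v.
      move=> iD iZ x t; apply: cvg_lim => //; apply: cvg_near_cst.
      near=> e; have e0 : e != 0 by near: e; exact: nbhs_dnbhs_neq.
      rewrite /= iD iZ.
      have -> : e * i t + i x - c - (i x - c) = e * i t by ring.
      by rewrite /GRing.scale /= mulKf.
    move=> x t _.
    by rewrite !(dc fst) // !(dc snd).
  have smF : smooth_on [set: R * R] (fun x => x.1 - y.1) by exact/smooth_on_fst/openT.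
  have smS : smooth_on [set: R * R] (fun x => x.2 - y.2) by exact/smooth_on_snd/openT.
  have nzm : 0 < n2 (zm - y) by apply: n2_gt0; rewrite subr_eq0 B'y.
  have [a1 [a2 [a12 da1 da2]]] := laplace_ln_holo openT I smF smS crF nzm.
  have su' : smooth_on U (fun x => u x - u y).
    by apply: smooth_onB => //; exact: smooth_on_cst.
  have sw' : smooth_on U (fun x => w x - w y).
    by apply: smooth_onB => //; exact: smooth_on_cst.
  have crG : CR U (fun x => u x - u y) (fun x => w x - w y).
    have dc (f : R * R -> R) (c : R) x t : differentiable f x ->
        'D_t (fun x => f x - c) x = 'D_t f x.
      move=> df; rewrite deriveB //; last exact: diff_derivable.
      by rewrite derive_cst subr0.
    move=> x t Ux; have [E1 E2] := cr x t Ux.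
    rewrite (dc u _ x _ (dif_u _ Ux)) (dc w _ x _ (dif_w _ Ux)).
    by rewrite (dc u _ x _ (dif_u _ Ux)) (dc w _ x _ (dif_w _ Ux)).
  have [b1 [b2 [b12 db1 db2]]] := laplace_ln_holo oU Uzm su' sw' crG (B'G _ B'zm).
  have dn t : der2 (fun s : R => n2 (s *: t + zm - z0)) (2 * n2 t).
    have aff (a b : R) (s : R) : is_derive s (1 : R) (fun s : R => s * a + b) a.
      have X := is_deriveD (is_deriveZ a (is_derive_id s (1 : R))) (is_derive_cst b s (1 : R)).
      have -> : (fun s : R => s * a + b) = (fun s => a * s + b).
        by apply/funext => q; rewrite mulrC.
      by apply: (is_derive_eq X); rewrite /GRing.scale /= mulr1 addr0.
    have sq (a b : R) : der2 (fun s : R => (s * a + b) ^+ 2) (2 * a ^+ 2).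
      exists (fun s => s * (2 * a ^+ 2) + 2 * a * b); split; last exact: aff.
      apply: filterE => s; have X := is_deriveM (aff a b s) (aff a b s).
      by apply: (is_derive_eq X); rewrite /GRing.scale /=; ring.
    have := der2D (sq t.1 (zm.1 - z0.1)) (sq t.2 (zm.2 - z0.2)).
    have E : (fun s : R => n2 (s *: t + zm - z0)) =
       (fun s : R => (s * t.1 + (zm.1 - z0.1)) ^+ 2 + (s * t.2 + (zm.2 - z0.2)) ^+ 2).
      by apply/funext => s; rewrite /n2 /= !addrA.
    by rewrite E /n2 mulrDr.
  have h1 := der2D (der2D (der2Z 3 da1) (der2Z (-2) db1)) (dn (1, 0)).
  have h2 := der2D (der2D (der2Z 3 da2) (der2Z (-2) db2)) (dn (0, 1)).
  eexists; eexists; split; [|exact: h1|exact: h2].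
  by move: a12 b12; rewrite /n2 /= expr0n expr1n /= addr0 add0r mulr1; clear; lra.
have := der2_comp_max p1 near_psi; have := der2_comp_max p2 near_psi.
by move: c12; clear; lra.
Unshelve. all: by end_near. Qed.

End CriticalPoints.

(** * Calculus on Riemann surfaces *)

Section PlaneFieldRules.
Variable R : realType.
Local Notation H := (quat R).
Implicit Types (U : set (R * R)) (F G : R * R -> H) (x v : R * R).

Lemma qdiff_cst (q : H) x : qdiff (fun=> q) x.
Proof. by split; exact: differentiable_cst. Qed.

Lemma qdiffD F G x : qdiff F x -> qdiff G x -> qdiff (fun y => F y + G y) x.
Proof. by move=> [? ? ? ?] [? ? ? ?]; split; exact: differentiableD. Qed.

Lemma qdiffN F x : qdiff F x -> qdiff (fun y => - F y) x.
Proof. by move=> [? ? ? ?]; split; exact: differentiableN. Qed.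

Lemma qdiffM F G x : qdiff F x -> qdiff G x -> qdiff (fun y => F y * G y) x.
Proof.
move=> [f1 f2 f3 f4] [g1 g2 g3 g4].
have M (a b : R * R -> R) : differentiable a x -> differentiable b x ->
    differentiable (fun y => a y * b y) x by exact: differentiableM.
have D (a b : R * R -> R) : differentiable a x -> differentiable b x ->
    differentiable (fun y => a y + b y) x by exact: differentiableD.
have B (a b : R * R -> R) : differentiable a x -> differentiable b x ->
    differentiable (fun y => a y - b y) x by exact: differentiableB.
split.
- exact: B (B _ _ (B _ _ (M _ _ f1 g1) (M _ _ f2 g2)) (M _ _ f3 g3)) (M _ _ f4 g4).
- exact: B (D _ _ (D _ _ (M _ _ f1 g2) (M _ _ f2 g1)) (M _ _ f3 g4)) (M _ _ f4 g3).
- exact: D (D _ _ (B _ _ (M _ _ f1 g3) (M _ _ f2 g4)) (M _ _ f3 g1)) (M _ _ f4 g2).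
- exact: D (B _ _ (D _ _ (M _ _ f1 g4) (M _ _ f2 g3)) (M _ _ f3 g2)) (M _ _ f4 g1).
Qed.

Lemma rqM (c : R) (q : H) :
  rq c * q = Quat (c * q1 q) (c * qi q) (c * qj q) (c * qk q).
Proof. by qring. Qed.

Lemma qD_lin F x (a : R) v w : qdiff F x ->
  qD (a *: v + w) F x = rq a * qD v F x + qD w F x.
Proof.
move=> [d1 d2 d3 d4].
rewrite rqM; apply: quat_ext; [exact: derive_lin d1|exact: derive_lin d2
  |exact: derive_lin d3|exact: derive_lin d4].
Qed.

Lemma qD_e F x v : qdiff F x ->
  qD v F x = rq v.1 * qD (1, 0) F x + rq v.2 * qD (0, 1) F x.
Proof.
move=> [d1 d2 d3 d4].
rewrite !rqM; apply: quat_ext; [exact: differentiable_deriv d1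
  |exact: differentiable_deriv d2|exact: differentiable_deriv d3
  |exact: differentiable_deriv d4].
Qed.

Lemma qD_cst (q : H) x v : qD v (fun=> q) x = 0.
Proof. by rewrite /qD; apply: quat_ext => /=; exact: derive_cst. Qed.

Lemma qD_add F G x v : qdiff F x -> qdiff G x ->
  qD v (fun y => F y + G y) x = qD v F x + qD v G x.
Proof.
move=> [f1 f2 f3 f4] [g1 g2 g3 g4].
have A (a b : R * R -> R) : differentiable a x -> differentiable b x ->
    'D_v (fun y => a y + b y) x = 'D_v a x + 'D_v b x.
  by move=> da db; apply: deriveD; exact: diff_derivable.
by apply: quat_ext; [exact: A f1 g1|exact: A f2 g2|exact: A f3 g3|exact: A f4 g4].
Qed.

Lemma qD_opp F x v : qdiff F x -> qD v (fun y => - F y) x = - qD v F x.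
Proof.
move=> [f1 f2 f3 f4].
have A (a : R * R -> R) : differentiable a x ->
    'D_v (fun y => - a y) x = - 'D_v a x.
  by move=> da; apply: deriveN; exact: diff_derivable.
by apply: quat_ext; [exact: A f1|exact: A f2|exact: A f3|exact: A f4].
Qed.

Lemma qD_line F x v : qdiff F x ->
  qder (fun t : R => F (t *: v + x)) 0 (qD v F x).
Proof.
move=> [f1 f2 f3 f4]; split.
- by have := @is_derive_line R (q1 \o F) x v 0; rewrite scale0r add0r; apply.
- by have := @is_derive_line R (qi \o F) x v 0; rewrite scale0r add0r; apply.
- by have := @is_derive_line R (qj \o F) x v 0; rewrite scale0r add0r; apply.
- by have := @is_derive_line R (qk \o F) x v 0; rewrite scale0r add0r; apply.
Qed.

Lemma qder_unique (u : R -> H) t (a b : H) : qder u t a -> qder u t b -> a = b.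
Proof.
move=> [[_ a1] [_ a2] [_ a3] [_ a4]] [[_ b1] [_ b2] [_ b3] [_ b4]].
by apply: quat_ext; rewrite -?a1 -?a2 -?a3 -?a4.
Qed.

(** The one-variable product rule along the line through [x], combined with uniqueness of
    derivatives. *)
Lemma qD_mul F G x v : qdiff F x -> qdiff G x ->
  qD v (fun y => F y * G y) x = qD v F x * G x + F x * qD v G x.
Proof.
move=> dF dG; apply: qder_unique (qD_line v (qdiffM dF dG)) _.
by have := qderM (qD_line v dF) (qD_line v dG); rewrite scale0r add0r.
Qed.

Lemma near_eq_qdiff F G x : (\near x, F x = G x) -> qdiff F x -> qdiff G x.
Proof.
move=> FG [f1 f2 f3 f4].
have N (pr : H -> R) : differentiable (pr \o F) x -> differentiable (pr \o G) x.
  by apply: near_eq_differentiable; apply: filterS FG => y /= ->.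
by split; exact: N.
Qed.

Lemma near_eq_qD F G x v : (\near x, F x = G x) -> qD v F x = qD v G x.
Proof.
move=> FG.
have N (pr : H -> R) : 'D_v (pr \o F) x = 'D_v (pr \o G) x.
  by apply: near_eq_derive; apply: filterS FG => y /= ->.
by rewrite /qD !N.
Qed.

Lemma qunit (q : H) : (q \is a GRing.unit) = (q != 0).
Proof. by []. Qed.

Lemma qdiffV F x : qdiff F x -> F x != 0 -> qdiff (fun y => (F y)^-1) x.
Proof.
move=> dF F0; have n0 := qnorm2_neq0 F0.
case: (dF) => f1 f2 f3 f4.
have X (a : R * R -> R) : differentiable a x -> differentiable (fun y => a y ^+ 2) x.
  move=> da; rewrite (_ : (fun y => _) = (fun y => a y * a y)).
    exact: differentiableM.
  by apply/funext => y; rewrite expr2.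
have dn : differentiable (fun y => qnorm2 (F y)) x.
  apply: differentiableD; last exact: (X (qk \o F)).
  apply: differentiableD; last exact: (X (qj \o F)).
  by apply: differentiableD; [exact: (X (q1 \o F))|exact: (X (qi \o F))].
have dV : differentiable (fun y => (qnorm2 (F y))^-1) x by exact: differentiableV.
have M (a : R * R -> R) : differentiable a x ->
    differentiable (fun y => a y * (qnorm2 (F y))^-1) x.
  by move=> da; exact: differentiableM.
by split; apply: M => //; exact: differentiableN.
Qed.

(** Differentiate F F^-1 = 1, which holds near [x] because F stays nonzero there. *)
Lemma qD_inv F x v : qdiff F x -> F x != 0 ->
  qD v (fun y => (F y)^-1) x = - ((F x)^-1 * qD v F x * (F x)^-1).
Proof.
move=> dF F0; have dV := qdiffV dF F0.
have nF : \forall y \near x, F y != 0.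
  have := qdiff_near dF; set e := N1 (F x).
  have e0 : 0 < e.
    rewrite lt_def N1_ge0 andbT; apply: contra F0 => /eqP e0.
    by apply/eqP/N1_eq0; rewrite -/e e0.
  move=> /(_ _ e0); apply: filterS => y; apply: contraTN => /eqP ->.
  by rewrite sub0r N1N ltxx.
have E : qD v (fun y => F y * (F y)^-1) x = 0.
  rewrite -(qD_cst 1 x v); apply: near_eq_qD; apply: filterS nF => y Fy.
  by rewrite divrr.
move: E; rewrite qD_mul // => /eqP; rewrite addrC addr_eq0 => /eqP E.
have : (F x)^-1 * (F x * qD v (fun y => (F y)^-1) x)
   = (F x)^-1 * - (qD v F x * (F x)^-1) by rewrite E.
by rewrite mulKr // => ->; rewrite mulrN mulrA.
Qed.

Lemma qsmooth_cst U (q : H) : qsmooth U (fun=> q).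
Proof. by split; exact: smooth_on_cst. Qed.

Lemma qsmoothD U F G : open U -> qsmooth U F -> qsmooth U G ->
  qsmooth U (fun y => F y + G y).
Proof. by move=> oU [? ? ? ?] [? ? ? ?]; split; exact: smooth_onD. Qed.

Lemma qsmoothN U F : open U -> qsmooth U F -> qsmooth U (fun y => - F y).
Proof. by move=> oU [? ? ? ?]; split; exact: smooth_onN. Qed.

Lemma qsmoothM U F G : open U -> qsmooth U F -> qsmooth U G ->
  qsmooth U (fun y => F y * G y).
Proof.
move=> oU [f1 f2 f3 f4] [g1 g2 g3 g4].
have M (a b : R * R -> R) : smooth_on U a -> smooth_on U b ->
    smooth_on U (fun y => a y * b y) by exact: smooth_onM.
have D (a b : R * R -> R) : smooth_on U a -> smooth_on U b ->
    smooth_on U (fun y => a y + b y) by exact: smooth_onD.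
have B (a b : R * R -> R) : smooth_on U a -> smooth_on U b ->
    smooth_on U (fun y => a y - b y) by exact: smooth_onB.
split.
- exact: B (B _ _ (B _ _ (M _ _ f1 g1) (M _ _ f2 g2)) (M _ _ f3 g3)) (M _ _ f4 g4).
- exact: B (D _ _ (D _ _ (M _ _ f1 g2) (M _ _ f2 g1)) (M _ _ f3 g4)) (M _ _ f4 g3).
- exact: D (D _ _ (B _ _ (M _ _ f1 g3) (M _ _ f2 g4)) (M _ _ f3 g1)) (M _ _ f4 g2).
- exact: D (B _ _ (D _ _ (M _ _ f1 g4) (M _ _ f2 g3)) (M _ _ f3 g2)) (M _ _ f4 g1).
Qed.

Lemma qsmoothV U F : open U -> (forall y, U y -> F y != 0) -> qsmooth U F ->
  qsmooth U (fun y => (F y)^-1).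
Proof.
move=> oU F0 [f1 f2 f3 f4].
have X (a : R * R -> R) : smooth_on U a -> smooth_on U (fun y => a y ^+ 2).
  move=> da; rewrite (_ : (fun y => _) = (fun y => a y * a y)).
    exact: smooth_onM.
  by apply/funext => y; rewrite expr2.
have dn : smooth_on U (fun y => qnorm2 (F y)).
  apply: smooth_onD => //; last exact: (X (qk \o F)).
  apply: smooth_onD => //; last exact: (X (qj \o F)).
  by apply: smooth_onD => //; [exact: (X (q1 \o F))|exact: (X (qi \o F))].
have dV : smooth_on U (fun y => (qnorm2 (F y))^-1).
  by apply: smooth_onV => // y Uy; exact/qnorm2_neq0/F0.
have M (a : R * R -> R) : smooth_on U a ->
    smooth_on U (fun y => a y * (qnorm2 (F y))^-1).
  by move=> da; exact: smooth_onM.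
by split; apply: M => //; exact: smooth_onN.
Qed.

Lemma qsmooth_loc U F :
  (forall x, U x -> exists2 V, V x & qsmooth V F) -> qsmooth U F.
Proof.
by move=> L; split; apply: smooth_on_loc => x /L[V Vx [? ? ? ?]]; exists V.
Qed.

Lemma eq_qsmooth U F G : open U -> {in U, F =1 G} -> qsmooth U F -> qsmooth U G.
Proof.
move=> oU FG [? ? ? ?].
have N (pr : H -> R) : smooth_on U (pr \o F) -> smooth_on U (pr \o G).
  by apply: eq_smooth_on => // y yU /=; rewrite FG.
by split; exact: N.
Qed.

(* Each derivative of a solution is a smooth multiple of the solution, so smoothness
   bootstraps from differentiability. *)
Lemma qsmooth_bootstrap U F (B : R * R -> R * R -> H) : open U ->
  (forall v, qsmooth U (B v)) -> (forall x, U x -> qdiff F x) ->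
  (forall x v, U x -> qD v F x = B v x * F x) -> qsmooth U F.
Proof.
move=> oU sB dF DF.
suff X n : [/\ smoothn n U (q1 \o F), smoothn n U (qi \o F),
    smoothn n U (qj \o F) & smoothn n U (qk \o F)].
  by split; apply/smooth_on_smoothn => n; have [] := X n.
elim: n => [|n [f1 f2 f3 f4]].
  by split; split => // x Ux; have [] := dF _ Ux.
have M (a b : R * R -> R) : smooth_on U a -> smoothn n U b ->
    smoothn n U (fun y => a y * b y).
  by move=> /smooth_on_smoothn sa sb; apply: smoothnM.
have D (a b : R * R -> R) : smoothn n U a -> smoothn n U b ->
    smoothn n U (fun y => a y + b y) by exact: smoothnD.
have Nn (b : R * R -> R) : smoothn n U b -> smoothn n U (fun y => - b y).
  move=> sb; apply: (@eq_smoothn _ n U (fun y => -1 * b y)) => //.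
    by move=> y _; rewrite mulN1r.
  by apply: M => //; exact: smooth_on_cst.
have Bn (a b : R * R -> R) : smoothn n U a -> smoothn n U b ->
    smoothn n U (fun y => a y - b y) by move=> sa sb; apply: D => //; exact: Nn.
have E (pr : H -> R) : (forall v x, pr (qD v F x) = 'D_v (pr \o F) x) ->
    (forall x, U x -> differentiable (pr \o F) x) ->
    (forall v, smoothn n U (fun x => pr (B v x * F x))) ->
    smoothn n.+1 U (pr \o F).
  move=> prE prd prB; split=> // v; apply: eq_smoothn (prB v) => // x.
  by rewrite inE => Ux; rewrite -prE DF.
split; (apply: E => [//|x Ux|v]; [by have [] := dF _ Ux|have [b1 b2 b3 b4] := sB v]).
- exact: Bn (Bn _ _ (Bn _ _ (M _ _ b1 f1) (M _ _ b2 f2)) (M _ _ b3 f3)) (M _ _ b4 f4).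
- exact: Bn (D _ _ (D _ _ (M _ _ b1 f2) (M _ _ b2 f1)) (M _ _ b3 f4)) (M _ _ b4 f3).
- exact: D (D _ _ (Bn _ _ (M _ _ b1 f3) (M _ _ b2 f4)) (M _ _ b3 f1)) (M _ _ b4 f2).
- exact: D (Bn _ _ (D _ _ (M _ _ b1 f4) (M _ _ b2 f3)) (M _ _ b3 f2)) (M _ _ b4 f1).
Qed.

(** Gronwall's inequality along the segment from [x0] to [h + x0], with zero initial value and zero
    error. *)
Lemma plane_vanish F x0 (r K : R) : 0 <= K ->
  (forall h, `|h| < r -> qdiff F (h + x0)) ->
  (forall h v, `|h| < r -> N1 (qD v F (h + x0)) <= K * `|v| * N1 (F (h + x0))) ->
  F x0 = 0 -> forall h, `|h| < r -> F (h + x0) = 0.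
Proof.
move=> K0 dF bF F0 h hr.
have Kh : 0 <= K * `|h| by exact: mulr_ge0.
have [C C0 HC] := N1_gronwall Kh.
have sh (t : R) : `|t| <= 1 -> `|t *: h| < r.
  move=> t1; apply: le_lt_trans hr; rewrite normrZ -[leRHS]mul1r.
  exact: ler_wpM2r.
have d (t : R) : `|t - 0| <= 1 ->
    qder (fun t => F (t *: h + x0)) t (qD h F (t *: h + x0)).
  rewrite subr0 => t1; have [d1 d2 d3 d4] := dF _ (sh _ t1).
  by split; [exact: is_derive_line d1|exact: is_derive_line d2
    |exact: is_derive_line d3|exact: is_derive_line d4].
have b (t : R) : `|t - 0| <= 1 ->
    N1 (qD h F (t *: h + x0)) <= K * `|h| * N1 (F (t *: h + x0)) + 0.
  by rewrite subr0 addr0 => t1; apply: bF; exact: sh.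
have := HC (fun t => F (t *: h + x0)) (fun t => qD h F (t *: h + x0)) 0 1 0 (lexx _).
rewrite (_ : `|1 - 0| = 1); last by rewrite subr0 normr1.
move=> /(_ (lexx _) d b).
rewrite scale0r add0r scale1r F0 addr0 => X.
apply: N1_eq0; apply: le_trans X _.
by rewrite /N1 /= normr0 !addr0 mulr0.
Qed.

End PlaneFieldRules.

Local Notation coord := Defs.coord.

Section PlaneComposition.
Variable R : realType.
Local Notation H := (quat R).

Lemma qD_comp (F : R * R -> H) (g1 g2 : R * R -> R) x :
  differentiable g1 x -> differentiable g2 x -> qdiff F (g1 x, g2 x) ->
  qdiff (fun y => F (g1 y, g2 y)) x /\ forall v,
  qD v (fun y => F (g1 y, g2 y)) x = qD ('D_v g1 x, 'D_v g2 x) F (g1 x, g2 x).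
Proof.
move=> d1 d2 [f1 f2 f3 f4].
have h1 v := derive_comp2 v d1 d2 f1; have h2 v := derive_comp2 v d1 d2 f2.
have h3 v := derive_comp2 v d1 d2 f3; have h4 v := derive_comp2 v d1 d2 f4.
split; first by split; [exact: (h1 0).1|exact: (h2 0).1|exact: (h3 0).1|exact: (h4 0).1].
by move=> v; apply: quat_ext; [exact: (h1 v).2|exact: (h2 v).2|exact: (h3 v).2|exact: (h4 v).2].
Qed.

Lemma rotJ_rotJ (v : R * R) : rotJ (rotJ v) = - v.
Proof. by case: v => a b. Qed.

Lemma rotJ_surj (v : R * R) : exists w, v = rotJ w.
Proof. by exists (v.2, - v.1); case: v => a b; rewrite /rotJ /= opprK. Qed.

End PlaneComposition.

Section Surface.
Variables (R : realType) (X : riemannSurface R).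
Local Notation H := (quat R).
Implicit Types (F G : X -> H) (c : chart R X) (p : X) (v : R * R).

Definition sdiff F c p := qdiff (F \o cinv c) (coord c p).

Lemma near_cinv c p (P : set X) : dom c p -> (\near p, P p) ->
  \forall y \near coord c p, P (cinv c y).
Proof.
move=> cp Pp; have [ip E] := coord_img cp.
have cc : cinv c @ coord c p --> cinv c (coord c p) := cinv_cont ip.
by rewrite E in cc; exact: cc _ Pp.
Qed.

Lemma near_coord c p (P : set (R * R)) : dom c p -> (\forall y \near coord c p, P y) ->
  \forall q \near p, P (coord c q).
Proof. by move=> cp Pp; apply: (coord_cont cp); exact: Pp. Qed.

Lemma near_dom c p : dom c p -> \near p, dom c p.
Proof. by move=> cp; apply: open_nbhs_nbhs; split => //; exact: dom_open. Qed.

Lemma near_img c p : dom c p -> \forall y \near coord c p, img c y.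
Proof.
by move=> /coord_img[ip _]; apply: open_nbhs_nbhs; split => //; exact: img_open.
Qed.

Lemma chart_open c (U : set X) : open U -> open (img c `&` cinv c @^-1` U).
Proof.
move=> oU; rewrite openE => y [iy Uy]; rewrite /interior.
apply: filterI; first by apply: open_nbhs_nbhs; split => //; exact: img_open.
by apply: (cinv_cont iy); apply: open_nbhs_nbhs.
Qed.

Lemma smoothP F : smooth F <-> forall c, atlas c -> qsmooth (img c) (F \o cinv c).
Proof.
by split=> sF c ac; have := sF c ac; rewrite preimage_setT setIT.
Qed.

Lemma smooth_sdiff F c p : smooth F -> atlas c -> dom c p -> sdiff F c p.
Proof.
move=> /smoothP sF ac cp; apply: qsmooth_qdiff (sF c ac) _.
by have [] := coord_img cp.
Qed.

Lemma sdiffM F G c p : sdiff F c p -> sdiff G c p -> sdiff (fun q => F q * G q) c p.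
Proof. exact: qdiffM. Qed.

Lemma sdiffD F G c p : sdiff F c p -> sdiff G c p -> sdiff (fun q => F q + G q) c p.
Proof. exact: qdiffD. Qed.

Lemma sdiffN F c p : sdiff F c p -> sdiff (fun q => - F q) c p.
Proof. exact: qdiffN. Qed.

Lemma sdiff_cst (q : H) c p : sdiff (fun=> q) c p.
Proof. exact: qdiff_cst. Qed.

Lemma sdiffV F c p : dom c p -> sdiff F c p -> F p != 0 ->
  sdiff (fun q => (F q)^-1) c p.
Proof.
by move=> cp dF F0; apply: qdiffV => //=; have [_ ->] := coord_img cp.
Qed.

Lemma d_mul F G c p v : dom c p -> sdiff F c p -> sdiff G c p ->
  d (fun q => F q * G q) c p v = d F c p v * G p + F p * d G c p v.
Proof.
move=> cp dF dG; have [_ E] := coord_img cp.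
by have := qD_mul v dF dG; rewrite /= E.
Qed.

Lemma d_add F G c p v : sdiff F c p -> sdiff G c p ->
  d (fun q => F q + G q) c p v = d F c p v + d G c p v.
Proof. exact: qD_add. Qed.

Lemma d_opp F c p v : sdiff F c p -> d (fun q => - F q) c p v = - d F c p v.
Proof. exact: qD_opp. Qed.

Lemma d_sub F G c p v : sdiff F c p -> sdiff G c p ->
  d (fun q => F q - G q) c p v = d F c p v - d G c p v.
Proof. by move=> dF dG; rewrite d_add ?d_opp //; exact: sdiffN. Qed.

Lemma d_cst (q : H) c p v : d (fun=> q) c p v = 0.
Proof. exact: qD_cst. Qed.

Lemma d_inv F c p v : dom c p -> sdiff F c p -> F p != 0 ->
  d (fun q => (F q)^-1) c p v = - ((F p)^-1 * d F c p v * (F p)^-1).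
Proof.
move=> cp dF F0; have [_ E] := coord_img cp.
have F0' : (F \o cinv c) (coord c p) != 0 by rewrite /= E.
by have := qD_inv v dF F0'; rewrite /= E.
Qed.

Lemma d_mulr F (q : H) c p v : dom c p -> sdiff F c p ->
  d (fun r => F r * q) c p v = d F c p v * q.
Proof. by move=> cp dF; rewrite d_mul ?d_cst ?mulr0 ?addr0 //; exact: sdiff_cst. Qed.

Lemma d_mull F (q : H) c p v : dom c p -> sdiff F c p ->
  d (fun r => q * F r) c p v = q * d F c p v.
Proof. by move=> cp dF; rewrite d_mul ?d_cst ?mul0r ?add0r //; exact: sdiff_cst. Qed.

Lemma near_eq_d F G c p v : dom c p -> (\near p, F p = G p) -> d F c p v = d G c p v.
Proof. by move=> cp FG; apply: near_eq_qD; exact: (near_cinv cp FG). Qed.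

Lemma near_eq_sdiff F G c p : dom c p -> (\near p, F p = G p) -> sdiff F c p -> sdiff G c p.
Proof. by move=> cp FG; apply: near_eq_qdiff; exact: (near_cinv cp FG). Qed.

Lemma eq_d F G c p v : F =1 G -> d F c p v = d G c p v.
Proof. by move=> /funext ->. Qed.

Lemma d_rotJ2 F c p v : sdiff F c p -> d F c p (rotJ (rotJ v)) = - d F c p v.
Proof.
move=> dF; rewrite rotJ_rotJ; have := qD_lin (-1) v 0 dF.
rewrite addr0 scaleN1r => E; apply: etrans E _.
rewrite -[qD 0 _ _](_ : 0 = _).
  by rewrite addr0 -[RHS]mulN1r; congr (_ * _); qring.
by rewrite /qD !derive0.
Qed.

Lemma smooth_cst (q : H) : smooth (fun _ : X => q).
Proof. by apply/smoothP => c _; exact: qsmooth_cst. Qed.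

Lemma smoothD F G : smooth F -> smooth G -> smooth (fun p => F p + G p).
Proof.
move=> /smoothP sF /smoothP sG; apply/smoothP => c ac.
by apply: qsmoothD; [exact: img_open|exact: sF|exact: sG].
Qed.

Lemma smoothN F : smooth F -> smooth (fun p => - F p).
Proof.
by move=> /smoothP sF; apply/smoothP => c ac; apply: qsmoothN; [exact: img_open|exact: sF].
Qed.

Lemma smoothB F G : smooth F -> smooth G -> smooth (fun p => F p - G p).
Proof. by move=> sF sG; apply: smoothD => //; exact: smoothN. Qed.

Lemma smoothM F G : smooth F -> smooth G -> smooth (fun p => F p * G p).
Proof.
move=> /smoothP sF /smoothP sG; apply/smoothP => c ac.
by apply: qsmoothM; [exact: img_open|exact: sF|exact: sG].
Qed.

Lemma smoothV F : (forall p, F p != 0) -> smooth F -> smooth (fun p => (F p)^-1).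
Proof.
move=> F0 /smoothP sF; apply/smoothP => c ac.
by apply: qsmoothV; [exact: img_open|move=> y _; exact: F0|exact: sF].
Qed.

End Surface.

(** * Pullback by holomorphic maps *)

Section Pullback.
Variables (R : realType) (X Y : riemannSurface R) (phi : X -> Y).
Local Notation H := (quat R).
Hypothesis hphi : holomorphic_map phi.

Definition jac (c : chart R X) (c' : chart R Y) (p : X) (v : R * R) : R * R :=
  ('D_v (fun x => ((coord c' \o phi \o cinv c) x).1) (coord c p),
   'D_v (fun x => ((coord c' \o phi \o cinv c) x).2) (coord c p)).

Let W (c : chart R X) (c' : chart R Y) :=
  img c `&` cinv c @^-1` (phi @^-1` dom c').

Lemma pullback_open c c' : open (W c c').
Proof.
apply: chart_open; apply: open_comp; last exact: dom_open.
by move=> p _; exact: hphi.1.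
Qed.

Lemma pullback_pt c c' p : dom c p -> dom c' (phi p) -> W c c' (coord c p).
Proof. by move=> cp c'p; have [ip E] := coord_img cp; split => //=; rewrite E. Qed.

(** The differential of a holomorphic map is complex linear; this is why pullback commutes with
    [star]. *)
Lemma jac_rotJ c c' p v : atlas c -> atlas c' -> dom c p -> dom c' (phi p) ->
  jac c c' p (rotJ v) = rotJ (jac c c' p v).
Proof.
move=> ac ac' cp c'p; have [_ _ cr] := hphi.2 c c' ac ac'.
by rewrite /jac /rotJ /=; have [-> ->] := cr _ v (pullback_pt cp c'p).
Qed.

Lemma d_pullback (F : Y -> H) c c' p : atlas c -> atlas c' -> dom c p ->
  dom c' (phi p) -> sdiff F c' (phi p) ->
  sdiff (F \o phi) c p /\
  forall v, d (F \o phi) c p v = d F c' (phi p) (jac c c' p v).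
Proof.
move=> ac ac' cp c'p dF; have [s1 s2 _] := hphi.2 c c' ac ac'.
have Wp := pullback_pt cp c'p; have [_ E] := coord_img cp.
have d1 := smooth_on_diff s1 Wp; have d2 := smooth_on_diff s2 Wp.
have Eg : (((coord c' \o phi \o cinv c) (coord c p)).1,
           ((coord c' \o phi \o cinv c) (coord c p)).2) = coord c' (phi p).
  by rewrite -surjective_pairing /= E.
rewrite /sdiff -Eg in dF; have [dFg DFg] := qD_comp d1 d2 dF.
have eqF : \forall y \near coord c p, (F \o cinv c') (((coord c' \o phi \o cinv c) y).1,
    ((coord c' \o phi \o cinv c) y).2) = ((F \o phi) \o cinv c) y.
  have := open_nbhs_nbhs (conj (@pullback_open c c') Wp); apply: filterS => y [iy Dy].
  by rewrite -surjective_pairing /=; have [_ ->] := coord_img Dy.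
split; first exact: near_eq_qdiff eqF dFg.
move=> v; rewrite -[LHS](near_eq_qD v eqF) DFg Eg; reflexivity.
Qed.

Lemma smooth_pullback (F : Y -> H) : smooth F -> smooth (F \o phi).
Proof.
move=> /smoothP sF; apply/smoothP => c ac; apply: qsmooth_loc => x ix.
have [c' ac' Dx] := atlas_cover (phi (cinv c x)).
exists (W c c') => //; have [s1 s2 _] := hphi.2 c c' ac ac'.
have oW := @pullback_open c c'.
have img' y : W c c' y -> img c' (((coord c' \o phi \o cinv c) y).1,
    ((coord c' \o phi \o cinv c) y).2).
  by move=> [_ /= Dy]; rewrite -surjective_pairing; have [] := coord_img Dy.
have [f1 f2 f3 f4] := sF c' ac'.
apply: (@eq_qsmooth _ _ (fun y => (F \o cinv c') (((coord c' \o phi \o cinv c) y).1,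
    ((coord c' \o phi \o cinv c) y).2))) => //.
  move=> y; rewrite inE => -[iy Dy].
  by rewrite -surjective_pairing /=; have [_ ->] := coord_img Dy.
by split; [exact: (smooth_on_comp oW img' s1 s2 f1)|exact: (smooth_on_comp oW img' s1 s2 f2)
  |exact: (smooth_on_comp oW img' s1 s2 f3)|exact: (smooth_on_comp oW img' s1 s2 f4)].
Qed.

End Pullback.

(** * Zeros of sections controlled by their derivative *)

Section Propagation.
Variables (R : realType) (X : riemannSurface R).
Local Notation H := (quat R).
Implicit Types (F G : X -> H) (c : chart R X) (p : X) (v : R * R).

Lemma near_of_chart c p (P : set X) : dom c p ->
  (\forall y \near coord c p, P (cinv c y)) -> \near p, P p.
Proof.
move=> cp nP; have n := near_coord cp nP.
apply: filterS2 (near_dom cp) n => q cq /=.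
by have [_ ->] := coord_img cq.
Qed.

Lemma sdiff_near F c p : dom c p -> sdiff F c p -> forall e : R, 0 < e ->
  \forall q \near p, N1 (F q - F p) < e.
Proof.
move=> cp dF e e0; apply: (near_of_chart cp).
by have := qdiff_near dF e0; rewrite /=; have [_ ->] := coord_img cp.
Qed.

Lemma sdiff_neq0 F c p : dom c p -> sdiff F c p -> F p <> 0 ->
  \forall q \near p, F q <> 0.
Proof.
move=> cp dF F0.
have e0 : 0 < N1 (F p).
  by rewrite lt_def N1_ge0 andbT; apply/eqP => e0; apply/F0/N1_eq0; rewrite e0.
apply: filterS (sdiff_near cp dF e0) => q + Fq.
by rewrite Fq sub0r N1N ltxx.
Qed.

(** The estimate |dF| <= K |F| around [p]. Parallel sections satisfy it, and it makes their zero set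
    open. *)
Definition self_bounded F c p := exists K : R, 0 <= K /\
  \forall y \near coord c p, qdiff (F \o cinv c) y /\
    forall v, N1 (qD v (F \o cinv c) y) <= K * `|v| * N1 (F (cinv c y)).

Lemma local_vanish F c p : dom c p -> self_bounded F c p -> F p = 0 ->
  \forall q \near p, F q = 0.
Proof.
move=> cp [K [K0 /near_norm[r r0 Hr]]] F0; apply: (near_of_chart cp).
have F0' : (F \o cinv c) (coord c p) = 0 by rewrite /=; have [_ ->] := coord_img cp.
have := @plane_vanish R (F \o cinv c) (coord c p) r K K0 _ _ F0'.
move=> /(_ (fun h hr => (Hr h hr).1) (fun h v hr => (Hr h hr).2 v)) Z.
apply/nbhs_ballP; exists r => // y; rewrite -ball_normE /= distrC => yr.
by have := Z _ yr; rewrite subrK.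
Qed.

(** The zero set is open by [local_vanish], closed by continuity, and the surface is connected. *)
Lemma vanish_everywhere F :
  (forall c p, atlas c -> dom c p -> sdiff F c p /\ self_bounded F c p) ->
  (exists p, F p = 0) -> forall p, F p = 0.
Proof.
move=> bF [p0 Fp0] p.
suff : [set p | F p = 0] = [set: X] by move=> E; have : [set p | F p = 0] p by rewrite E.
have oZ : open [set p | F p = 0].
  rewrite openE => q Fq; have [c ac cq] := atlas_cover q.
  exact: local_vanish cq (bF _ _ ac cq).2 Fq.
have oNZ : open (~` [set p | F p = 0]).
  rewrite openE => q Fq; have [c ac cq] := atlas_cover q.
  exact: sdiff_neq0 cq (bF _ _ ac cq).1 Fq.
apply: (@rs_connected R X); first by exists p0.
  by exists [set p | F p = 0]; rewrite ?setTI.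
exists [set p | F p = 0]; rewrite ?setTI //.
by rewrite -[X in closed X]setCK; exact: open_closedC.
Qed.

Lemma d_eq0_cst F : smooth F ->
  (forall c p v, atlas c -> dom c p -> d F c p v = 0) -> forall p q, F p = F q.
Proof.
move=> sF dF p q; apply/eqP; rewrite -subr_eq0; apply/eqP; move: p.
apply: vanish_everywhere; last by exists q; rewrite subrr.
have sG : smooth (fun p => F p - F q) by apply: smoothB => //; exact: smooth_cst.
move=> c p ac cp; split; first exact: smooth_sdiff.
exists 0; split => //; apply: filterS (near_img cp) => y iy.
have [dy cy] := cinv_dom iy.
split; first by have := smooth_sdiff sG ac dy; rewrite /sdiff cy.
move=> v; have := d_sub v (smooth_sdiff sF ac dy) (sdiff_cst (F q) c (cinv c y)).
rewrite dF // d_cst subrr /d cy => E.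
by rewrite !mul0r [qD _ _ _](_ : _ = 0) // /N1 /= normr0 !addr0.
Qed.

End Propagation.

Lemma cr_zero (R : realType) (a b x y : R) : 0 = x * a - y * b -> 0 = x * b + y * a ->
  0 < x ^+ 2 + y ^+ 2 -> a = 0 /\ b = 0.
Proof.
move=> e1 e2 n0.
have a0 : a * (x ^+ 2 + y ^+ 2) = x * (x * a - y * b) + y * (x * b + y * a) by ring.
have b0 : b * (x ^+ 2 + y ^+ 2) = x * (x * b + y * a) - y * (x * a - y * b) by ring.
move: a0 b0; rewrite -e1 -e2 !mulr0 addr0 subr0 => /eqP + /eqP.
by rewrite !mulf_eq0 (gt_eqF n0) !orbF => /eqP -> /eqP ->.
Qed.

(** * CMC surfaces on the universal cover *)

Section CmcPullback.
Variables (R : realType) (X Y : riemannSurface R) (phi : X -> Y).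
Local Notation H := (quat R).
Hypothesis hphi : holomorphic_map phi.

Lemma star_pullback (F : Y -> H) c c' p v : atlas c -> atlas c' -> dom c p ->
  dom c' (phi p) -> sdiff F c' (phi p) ->
  star (d (F \o phi)) c p v = star (d F) c' (phi p) (jac phi c c' p v).
Proof.
move=> ac ac' cp c'p dF; have [_ E] := d_pullback hphi ac ac' cp c'p dF.
by rewrite /star E jac_rotJ.
Qed.

Lemma weak_cmc_pullback (f N : Y -> H) : weak_cmc f N -> weak_cmc (f \o phi) (N \o phi).
Proof.
move=> [[sf sN] imf imN [e1 e2] e3].
split; [by split; exact: smooth_pullback|by move=> p; exact: imf
  |by move=> p; exact: imN|split|].
- move=> c p v ac cp; have [c' ac' c'p] := atlas_cover (phi p).
  have df := smooth_sdiff sf ac' c'p.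
  rewrite (star_pullback _ ac ac') // e1 // /lmulf.
  by rewrite (d_pullback hphi ac ac' cp c'p df).2.
- move=> c p v ac cp; have [c' ac' c'p] := atlas_cover (phi p).
  have df := smooth_sdiff sf ac' c'p.
  rewrite (star_pullback _ ac ac') // e2 // /Defs.oppf /rmulf.
  by rewrite (d_pullback hphi ac ac' cp c'p df).2.
- move=> c p v ac cp; have [c' ac' c'p] := atlas_cover (phi p).
  have df := smooth_sdiff sf ac' c'p; have dN := smooth_sdiff sN ac' c'p.
  rewrite (d_pullback hphi ac ac' cp c'p df).2 e3 // /lmulf /Defs.addf /Defs.oppf /cstf.
  by rewrite (d_pullback hphi ac ac' cp c'p dN).2 (star_pullback _ ac ac').
Qed.

Hypothesis cphi : covering_map phi.

(** On a sheet over an evenly covered set the local inverse undoes the covering. *)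
Lemma covering_locally_injective p : exists V, [/\ open V, V p &
  forall q r, V q -> V r -> phi q = phi r -> q = r].
Proof.
have [_ _ /(_ (phi p))[U [oU Up [S [oS _ SU HS]]]]] := cphi.
have : (\bigcup_(V in S) V) p by rewrite -SU.
move=> [V SV Vp]; exists V; split => //; first exact: oS.
have [s [_ sV]] := HS _ SV.
by move=> q r Vq Vr qr; rewrite -(sV _ Vq) qr sV.
Qed.

(* A covering is locally injective, and an injective holomorphic function has no
   critical points. *)
Lemma jac_injective c c' p v : atlas c -> atlas c' -> dom c p -> dom c' (phi p) ->
  jac phi c c' p v = 0 -> v = 0.
Proof.
move=> ac ac' cp c'p j0; apply: contrapT => v0.
have [V [oV Vp injV]] := covering_locally_injective p.
have [s1 s2 cr] := hphi.2 c c' ac ac'.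
set u := fun x => _ in s1 cr; set w := fun x => _ in s2 cr.
have [_ Ecp] := coord_img cp.
pose U := (img c `&` cinv c @^-1` (phi @^-1` dom c')) `&` (img c `&` cinv c @^-1` V).
have oU : open U.
  by apply: openI; [exact: (pullback_open hphi)|exact: chart_open].
have Up : U (coord c p).
  split; first exact: pullback_pt.
  by have [ip E] := coord_img cp; split => //=; rewrite E.
have sub : U `<=` img c `&` cinv c @^-1` (phi @^-1` dom c') by move=> x [].
have injU (x y : R * R) : U x -> U y -> u x = u y -> w x = w y -> x = y.
  move=> [[ix /= Dx] [_ /= Vx]] [[iy /= Dy] [_ /= Vy]] Eu Ew.
  have E : coord c' (phi (cinv c x)) = coord c' (phi (cinv c y)).
    by rewrite [LHS]surjective_pairing [RHS]surjective_pairing; congr (_, _).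
  have E' : phi (cinv c x) = phi (cinv c y).
    by have [_ <-] := coord_img Dx; have [_ <-] := coord_img Dy; rewrite E.
  have [_ <-] := cinv_dom ix; have [_ <-] := cinv_dom iy.
  by rewrite (injV _ _ Vx Vy E').
have crU : CR U u w by move=> x t [Ux _]; exact: cr.
have [t nt] := injective_holomorphic oU Up (smooth_onS sub s1) (smooth_onS sub s2) crU injU.
have du := smooth_on_diff s1 (sub _ Up); have dw := smooth_on_diff s2 (sub _ Up).
have lin := holo_linear du dw (fun t => cr _ t (sub _ Up)).
move: j0 => [ju jw].
have [lu lw] := lin v.
have ju' : 'D_v u (coord c p) = 0 := ju; have jw' : 'D_v w (coord c p) = 0 := jw.
rewrite ju' in lu; rewrite jw' in lw.
have nv : 0 < n2 v by apply: n2_gt0; apply/eqP.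
have [lut lwt] := lin t.
move: lu lw lut lwt nt; rewrite /n2 in nv.
move: ('D_(1, 0) u (coord c p)) ('D_(1, 0) w (coord c p)) => a b lu lw lut lwt nt.
(* By Cauchy-Riemann the differential is multiplication by a complex number. If it kills the nonzero
   [v], that number is 0, against the direction [t]. *)
have [a0 b0] := cr_zero lu lw nv.
by move: nt; rewrite lut lwt a0 b0 !mulr0 subr0 addr0 => -[|].
Qed.

Lemma immersion_pullback (f : Y -> H) : smooth f -> immersion f -> immersion (f \o phi).
Proof.
move=> sf imm c p v ac cp; have [c' ac' c'p] := atlas_cover (phi p).
have df := smooth_sdiff sf ac' c'p.
rewrite (d_pullback hphi ac ac' cp c'p df).2 => /(imm _ _ _ ac' c'p).
exact: jac_injective.
Qed.

End CmcPullback.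

(** * Monodromy *)

Section Lifts.
Variables (R : realType) (X : topologicalType).
Local Notation H := (quat R).
(* [Par V s] stands for: [s] is a parallel section over [V] of a flat connection on
   the quaternionic line bundle; [lift A G sg] is a parallel section along [G]. *)
Variable Par : set X -> (X -> H) -> Prop.
Hypotheses
  (ParS : forall V W s, open W -> W `<=` V -> Par V s -> Par W s)
  (ParM : forall V s k, Par V s -> Par V (fun p => s p * k))
  (ParB : forall V s t, Par V s -> Par V t -> Par V (fun p => s p - t p))
  (Par0 : forall V s p, Par V s -> open V -> V p -> s p = 0 -> \near p, s p = 0)
  (ParN0 : forall V s p, Par V s -> open V -> V p -> s p <> 0 -> \near p, s p <> 0)
  (ParE : forall p, exists V s, [/\ open V, V p, Par V s, s p = 1 &
     forall q, V q -> exists g, is_path (R := R) p q g /\ forall t, t \in `[0, 1] -> V (g t)]).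

Section Generic.
Variable Z : topologicalType.
Implicit Types (A B : set Z) (G : Z -> X) (sg tau : Z -> H).

(** Continuity relative to [A], phrased with neighbourhoods in the ambient space so that closed
    pieces combine by intersecting filters. *)
Definition cont_on A G := forall z, A z -> forall O, nbhs (G z) O ->
  \forall z' \near z, A z' -> O (G z').

Definition lift A G sg := forall z, A z -> exists V s, [/\ open V, V (G z), Par V s &
  \forall z' \near z, A z' -> V (G z') /\ sg z' = s (G z')].

Lemma liftS A B G sg : B `<=` A -> lift A G sg -> lift B G sg.
Proof.
move=> BA L z /BA/L[V [s [oV Vz Ps n]]]; exists V, s; split => //.
by apply: filterS n => z' h /BA.
Qed.

Lemma liftM A G sg (k : H) : lift A G sg -> lift A G (fun z => sg z * k).
Proof.
move=> L z /L[V [s [oV Vz Ps n]]]; exists V, (fun p => s p * k); split => //.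
  exact: ParM.
by apply: filterS n => z' h /h[? ->].
Qed.

Lemma liftB A G sg tau : lift A G sg -> lift A G tau -> lift A G (fun z => sg z - tau z).
Proof.
move=> L1 L2 z Az.
have [V [s [oV Vz Ps n]]] := L1 _ Az; have [W [t [oW Wz Pt m]]] := L2 _ Az.
exists (V `&` W), (fun p => s p - t p); split => //.
- exact: openI.
- by apply: ParB; [apply: (ParS _ _ Ps)|apply: (ParS _ _ Pt)];
    first [exact: openI|move=> p []].
- by apply: filterS2 n m => z' h1 h2 Az'; have [? ->] := h1 Az'; have [? ->] := h2 Az'.
Qed.

Lemma eq_lift A G G' sg sg' : (forall z, A z -> G z = G' z) ->
  (forall z, A z -> sg z = sg' z) -> lift A G sg -> lift A G' sg'.
Proof.
move=> GE sE L z Az; have [V [s [oV Vz Ps n]]] := L _ Az.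
exists V, s; split => //; first by rewrite -GE.
by apply: filterS n => z' h Az'; have [? ?] := h Az'; rewrite -GE // -sE.
Qed.

(** The zeros of a lift form a relatively open and closed subset of the connected set [A], by [Par0]
    and [ParN0]. *)
Lemma lift_vanish A G sg : connected A -> cont_on A G -> lift A G sg ->
  (exists2 z, A z & sg z = 0) -> forall z, A z -> sg z = 0.
Proof.
move=> cA cG L [z0 Az0 sz0].
pose B := [set z | A z /\ sg z = 0].
suff BA : B = A by move=> z; rewrite -BA => -[].
apply: cA; first by exists z0.
  exists (interior [set z | A z -> sg z = 0]); first exact: open_interior.
  apply/seteqP; split => z /=; last by move=> [Az /nbhs_singleton h]; split => //; exact: h.
  move=> [Az s0]; split => //.
  have [V [s [oV Vz Ps n]]] := L _ Az.
  have sz : s (G z) = 0 by have [_ <-] := nbhs_singleton n Az.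
  have m := cG _ Az _ (Par0 Ps oV Vz sz).
  rewrite /interior /=; apply: filterS2 n m => z' h1 h2 Az'.
  by have [_ ->] := h1 Az'; exact: h2.
exists (~` interior [set z | A z -> sg z <> 0]).
  by apply: open_closedC; exact: open_interior.
apply/seteqP; split => z /=.
  by move=> [Az s0]; split => // /nbhs_singleton h; exact: h.
move=> [Az ns]; split => //; apply: contrapT => s0; apply: ns.
have [V [s [oV Vz Ps n]]] := L _ Az.
have sz : s (G z) <> 0 by have [_ <-] := nbhs_singleton n Az.
have m := cG _ Az _ (ParN0 Ps oV Vz sz).
rewrite /interior /=; apply: filterS2 n m => z' h1 h2 Az'.
by have [_ ->] := h1 Az'; exact: h2.
Qed.

Lemma lift_unique A G sg tau : connected A -> cont_on A G -> lift A G sg ->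
  lift A G tau -> (exists2 z, A z & sg z = tau z) -> forall z, A z -> sg z = tau z.
Proof.
move=> cA cG L1 L2 [z0 Az0 E] z Az; apply/eqP; rewrite -subr_eq0; apply/eqP.
apply: (lift_vanish cA cG (liftB L1 L2)) => //.
by exists z0 => //; rewrite E subrr.
Qed.

Lemma cont_onU A B G : closed A -> closed B -> cont_on A G -> cont_on B G ->
  cont_on (A `|` B) G.
Proof.
move=> cA cB CA CB z ABz O nO.
have nA : \forall z' \near z, A z' -> O (G z').
  have [Az|Az] := pselect (A z); first exact: CA.
  have : nbhs z (~` A) by apply: open_nbhs_nbhs; split => //; exact: closed_openC.
  by apply: filterS.
have nB : \forall z' \near z, B z' -> O (G z').
  have [Bz|Bz] := pselect (B z); first exact: CB.
  have : nbhs z (~` B) by apply: open_nbhs_nbhs; split => //; exact: closed_openC.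
  by apply: filterS.
by apply: filterS2 nA nB => z' h1 h2 [].
Qed.

Lemma eq_cont_on A G G' : (forall z, A z -> G z = G' z) -> cont_on A G -> cont_on A G'.
Proof.
move=> GE C z Az O; rewrite -GE // => /(C z Az); apply: filterS => z' h Az'.
by rewrite -GE //; exact: h.
Qed.

Lemma cont_onS A B G : B `<=` A -> cont_on A G -> cont_on B G.
Proof. by move=> BA C z /BA/C h O /h; apply: filterS => z' + /BA. Qed.

(** At a common point the two local sections agree nearby, since their difference is parallel and
    vanishes there; at any other point a neighbourhood meets only one of the closed pieces. *)
Lemma liftU A B G sg : closed A -> closed B -> cont_on (A `|` B) G ->
  lift A G sg -> lift B G sg -> lift (A `|` B) G sg.
Proof.
move=> cA cB CG LA LB z ABz.
have oA (C : set Z) : closed C -> ~ C z -> nbhs z (~` C).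
  by move=> cC Cz; apply: open_nbhs_nbhs; split => //; exact: closed_openC.
have [Az|Az] := pselect (A z); last first.
  have Bz : B z by case: ABz.
  have [V [s [oV Vz Ps n]]] := LB _ Bz; exists V, s; split => //.
  by apply: filterS2 n (oA _ cA Az) => z' h1 h2 [].
have [V [s [oV Vz Ps n]]] := LA _ Az.
have [Bz|Bz] := pselect (B z); last first.
  exists V, s; split => //.
  by apply: filterS2 n (oA _ cB Bz) => z' h1 h2 [].
have [W [t [oW Wz Pt m]]] := LB _ Bz.
have [_ E1] := nbhs_singleton n Az; have [_ E2] := nbhs_singleton m Bz.
have oVW : open (V `&` W) by exact: openI.
have Pd : Par (V `&` W) (fun p => s p - t p).
  by apply: ParB; [apply: (ParS _ _ Ps)|apply: (ParS _ _ Pt)] => // p [].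
have := Par0 Pd oVW (conj Vz Wz); rewrite -E1 -E2 subrr => /(_ erefl) st.
have st' := CG _ ABz _ st.
have nV := CG _ ABz _ (open_nbhs_nbhs (conj oV Vz)).
exists V, s; split => //.
apply: filterS3 n m (filterI st' nV) => z' h1 h2 [h3 h4] ABz'.
split; first exact: h4.
case: (ABz') => [Az'|Bz']; first by case: (h1 Az').
have [_ ->] := h2 Bz'.
by apply/esym/eqP; rewrite -subr_eq0; apply/eqP; exact: h3.
Qed.

(** A constant right factor preserves parallelity, so [tau] can be rescaled to meet [sg] at one
    point of the overlap; connectedness of the overlap extends the agreement to all of it. *)
Lemma lift_glue A B G sg tau : closed A -> closed B -> cont_on (A `|` B) G ->
  connected (A `&` B) -> (A `&` B) !=set0 ->
  lift A G sg -> lift B G tau -> (forall z, A z -> sg z != 0) ->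
  (forall z, B z -> tau z != 0) ->
  exists rho, lift (A `|` B) G rho /\ forall z, (A `|` B) z -> rho z != 0.
Proof.
move=> cA cB CG cAB [z0 [Az0 Bz0]] LA LB A0 B0.
pose k := (tau z0)^-1 * sg z0.
have k0 : k != 0.
  apply/eqP => E; have := A0 _ Az0; rewrite -[sg z0](mulVKr (x := tau z0)) ?qunit ?B0 //.
  by rewrite -/k E mulr0 eqxx.
pose rho z := if pselect (A z) then sg z else tau z * k.
have LBk := liftM k LB.
have rA z : A z -> sg z = rho z by move=> Az; rewrite /rho; case: pselect.
have rB z : B z -> tau z * k = rho z.
  move=> Bz; rewrite /rho; case: pselect => // Az.
  apply/esym/(@lift_unique (A `&` B) G sg (fun z => tau z * k)) => //.
  - by apply: cont_onS CG => y [Ay _]; left.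
  - by apply: liftS LA => y [].
  - by apply: liftS LBk => y [].
  - by exists z0 => //; rewrite /k mulVKr // qunit B0.
exists rho; split.
  apply: liftU => //.
    exact: eq_lift rA LA.
  exact: eq_lift rB LBk.
move=> z [Az|Bz]; first by rewrite -rA // A0.
rewrite -rB //; have := B0 _ Bz; rewrite -!qunit => u1.
by rewrite unitrMl // qunit.
Qed.

End Generic.

Lemma lift_comp (Z Z' : topologicalType) (A : set Z) (A' : set Z') (G : Z -> X)
  (sg : Z -> H) (i : Z' -> Z) : continuous i -> (forall z, A' z -> A (i z)) ->
  lift A G sg -> lift A' (G \o i) (sg \o i).
Proof.
move=> ci iA L z A'z; have [V [s [oV Vz Ps n]]] := L _ (iA _ A'z).
exists V, s; split => //.
have m : \forall z' \near z, A (i z') -> V (G (i z')) /\ sg (i z') = s (G (i z')).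
  exact: (ci z _ n).
by apply: filterS m => z' h /iA; exact: h.
Qed.

Lemma cont_on_comp (Z Z' : topologicalType) (A : set Z) (A' : set Z') (G : Z -> X)
  (i : Z' -> Z) : continuous i -> (forall z, A' z -> A (i z)) ->
  cont_on A G -> cont_on A' (G \o i).
Proof.
move=> ci iA C z /iA Az O /(C _ Az) n.
have m : \forall z' \near z, A (i z') -> O (G (i z')) by exact: (ci z _ n).
by apply: filterS m => z' h /iA; exact: h.
Qed.

Lemma within_cont_on (Z : topologicalType) (A : set Z) (G : Z -> X) :
  {within A, continuous G} <-> cont_on A G.
Proof.
split=> [/subspace_continuousP C z Az O nO|C].
  by have := C _ Az _ nO; rewrite /within /= /nbhs /=.
apply/subspace_continuousP => z Az O nO.
by have := C _ Az _ nO.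
Qed.

Lemma continuous_clamp : continuous (fun t : R => Num.max 0 (Num.min t 1)).
Proof.
move=> t; apply: (@continuous_max R R (fun=> 0) (fun t => Num.min t 1)).
  exact: cst_continuous.
by apply: (@continuous_min R R id (fun=> 1)); [exact: cvg_id|exact: cst_continuous].
Qed.

Lemma clamp_itv (t : R) : 0 <= Num.max 0 (Num.min t 1) <= 1.
Proof. by rewrite le_max lexx /= ge_max ler01 ge_min lexx orbT. Qed.

Lemma clamp_id (t : R) : 0 <= t <= 1 -> Num.max 0 (Num.min t 1) = t.
Proof. by move=> /andP[t0 t1]; rewrite min_l // max_r. Qed.

(** Paths are continuous only within [0, 1]; composing with the retraction onto [0, 1] removes the
    restriction. *)
Lemma path_extend x y (g : R -> X) : is_path x y g ->
  exists g' : R -> X, [/\ continuous g', g' 0 = x, g' 1 = y &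
    forall t, 0 <= t <= 1 -> g' t = g t].
Proof.
move=> [/within_cont_on cg g0 g1].
exists (g \o (fun t => Num.max 0 (Num.min t 1))); split.
- move=> t O nO; have := cont_on_comp (A' := setT) continuous_clamp _ cg.
  have iA z : [set: R] z -> `[0, 1]%classic (Num.max 0 (Num.min z 1)).
    by move=> _; rewrite /= in_itv /= clamp_itv.
  by move=> /(_ iA t I O nO); rewrite /nbhs /=; apply: filterS => z; exact.
- by rewrite /= clamp_id ?lexx ?ler01.
- by rewrite /= clamp_id ?lexx ?ler01.
- by move=> t t01; rewrite /= clamp_id.
Qed.

Lemma continuous_cont_on (Z : topologicalType) (A : set Z) (G : Z -> X) :
  continuous G -> cont_on A G.
Proof. by move=> C z _ O /(C z); rewrite /nbhs /=; apply: filterS => z'. Qed.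

Definition box (x1 x2 y1 y2 : R) : set (R * R) :=
  [set z | [/\ x1 <= z.1, z.1 <= x2, y1 <= z.2 & z.2 <= y2]].

Lemma closed_box x1 x2 y1 y2 : closed (box x1 x2 y1 y2).
Proof.
rewrite (_ : box _ _ _ _ = (fst @^-1` `[x1, x2]) `&` (snd @^-1` `[y1, y2])).
  by apply: closedI; apply: preimage_closed; try exact: itv_closed;
    move=> z _; [exact: cvg_fst|exact: cvg_snd].
apply/seteqP; split=> z /=; rewrite !in_itv /=.
  by move=> [-> -> -> ->].
by move=> [/andP[? ?] /andP[? ?]].
Qed.

Lemma connected_vbox m y1 y2 : connected (box m m y1 y2).
Proof.
rewrite (_ : box _ _ _ _ = (fun t => (m, t)) @` `[y1, y2]); last first.
  apply/seteqP; split=> [[z1 z2] [/= h1 h2 h3 h4]|_ [t /= + <-]].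
    by exists z2; rewrite /= ?in_itv /= ?h3 //; congr pair; apply/eqP; rewrite eq_le h1.
  by rewrite in_itv /= => /andP[? ?]; split.
apply: connected_continuous_connected; first exact: segment_connected.
apply: continuous_subspaceT => t.
exact: (cvg_pair (cvg_cst _) cvg_id).
Qed.

Lemma connected_hbox x1 x2 m : connected (box x1 x2 m m).
Proof.
rewrite (_ : box _ _ _ _ = (fun t => (t, m)) @` `[x1, x2]); last first.
  apply/seteqP; split=> [[z1 z2] [/= h1 h2 h3 h4]|_ [t /= + <-]].
    by exists z1; rewrite /= ?in_itv /= ?h1 //; congr pair; apply/eqP; rewrite eq_le h3.
  by rewrite in_itv /= => /andP[? ?]; split.
apply: connected_continuous_connected; first exact: segment_connected.
apply: continuous_subspaceT => t.
exact: (cvg_pair cvg_id (cvg_cst _)).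
Qed.

Definition liftable (G : R * R -> X) (A : set (R * R)) :=
  exists sg, lift A G sg /\ forall z, A z -> sg z != 0.

Lemma liftable_hglue G x1 m x2 y1 y2 : continuous G -> x1 <= m -> m <= x2 -> y1 <= y2 ->
  liftable G (box x1 m y1 y2) -> liftable G (box m x2 y1 y2) ->
  liftable G (box x1 x2 y1 y2).
Proof.
move=> cG h1 h2 h3 [sg [L1 N1]] [tau [L2 N2]].
have -> : box x1 x2 y1 y2 = box x1 m y1 y2 `|` box m x2 y1 y2.
  apply/seteqP; split=> z.
    by move=> [? ? ? ?]; case: (leP z.1 m) => [?|/ltW ?]; [left|right].
  by move=> [] [? ? ? ?]; split=> //; lra.
apply: lift_glue L1 L2 N1 N2 => //; try exact: closed_box.
- exact: continuous_cont_on.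
- rewrite (_ : _ `&` _ = box m m y1 y2); first exact: connected_vbox.
  by apply/seteqP; split=> z [] => [[? ? ? ?] []//|? ? ? ?]; split; split=> //; lra.
- by exists (m, y1); split; split => /=.
Qed.

Lemma liftable_vglue G x1 x2 y1 m y2 : continuous G -> y1 <= m -> m <= y2 -> x1 <= x2 ->
  liftable G (box x1 x2 y1 m) -> liftable G (box x1 x2 m y2) ->
  liftable G (box x1 x2 y1 y2).
Proof.
move=> cG h1 h2 h3 [sg [L1 N1]] [tau [L2 N2]].
have -> : box x1 x2 y1 y2 = box x1 x2 y1 m `|` box x1 x2 m y2.
  apply/seteqP; split=> z.
    by move=> [? ? ? ?]; case: (leP z.2 m) => [?|/ltW ?]; [left|right].
  by move=> [] [? ? ? ?]; split=> //; lra.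
apply: lift_glue L1 L2 N1 N2 => //; try exact: closed_box.
- exact: continuous_cont_on.
- rewrite (_ : _ `&` _ = box x1 x2 m m); first exact: connected_hbox.
  by apply/seteqP; split=> z [] => [[? ? ? ?] []//|? ? ? ?]; split; split=> //; lra.
- by exists (x1, m); split; split => /=.
Qed.

(** Lifts over the four quarters would glue along segments to a lift over the square. *)
Lemma liftable_quarter G (a b h : R) : continuous G -> 0 < h ->
  ~ liftable G (box a (a + h) b (b + h)) ->
  exists a' b', [/\ a <= a' <= a + h / 2, b <= b' <= b + h / 2 &
    ~ liftable G (box a' (a' + h / 2) b' (b' + h / 2))].
Proof.
move=> cG h0 nL; apply: contrapT => nE; apply: nL.
have L a' b' : (a' = a \/ a' = a + h / 2) -> (b' = b \/ b' = b + h / 2) ->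
    liftable G (box a' (a' + h / 2) b' (b' + h / 2)).
  move=> ha hb; apply: contrapT => nL; apply: nE; exists a', b'; split => //.
    by case: ha => ->; lra.
  by case: hb => ->; lra.
have E c : c + h = c + h / 2 + h / 2 by lra.
have h2 c : c <= c + h / 2 by lra.
have h3 c : c + h / 2 <= c + h by lra.
have h4 c : c <= c + h by lra.
apply: (liftable_hglue cG (h2 a) (h3 a) (h4 b)).
  by apply: (liftable_vglue cG (h2 b) (h3 b) (h2 a)); rewrite ?E;
    apply: L; [left|left|left|right].
apply: (liftable_vglue cG (h2 b) (h3 b) (h3 a)); rewrite !E.
  by apply: L; [right|left].
by apply: L; right.
Qed.

Lemma liftable_local G z : continuous G ->
  exists2 r, 0 < r & forall A : set (R * R),
    (forall y, A y -> `|y - z| < r) -> liftable G A.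
Proof.
move=> cG; have [V [s [oV Vz Ps s1 _]]] := ParE (G z).
have s0 : s (G z) <> 0 by rewrite s1; apply/eqP; exact: oner_neq0.
have n1 := ParN0 Ps oV Vz s0.
have n2 := open_nbhs_nbhs (conj oV Vz).
have n : \forall y \near z, V (G y) /\ s (G y) <> 0.
  exact: (cG z _ (filterI n2 n1)).
have [r r0 hr] := near_norm n; exists r => // A hA.
have hA' y : A y -> V (G y) /\ s (G y) <> 0.
  by move=> /hA/hr; rewrite subrK.
exists (s \o G); split; last by move=> y /hA'[_] /eqP.
move=> y Ay; exists V, s; have [Vy _] := hA' _ Ay; split => //.
by apply: filterE => y' /hA'[].
Qed.

(** Bisection: without a lift there would be nested squares of side 2^-n without lifts, shrinking to
    a point, while near every point a local section composed with [G] is a lift. *)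
Lemma liftable_square G : continuous G -> liftable G (box 0 1 0 1).
Proof.
move=> cG; apply: contrapT => nL.
pose St := {st : R * R * nat | ~ liftable G (box st.1.1 (st.1.1 + 2^-1 ^+ st.2)
  st.1.2 (st.1.2 + 2^-1 ^+ st.2))}.
pose rel (x y : St) := [/\ (sval y).2 = (sval x).2.+1,
  (sval x).1.1 <= (sval y).1.1 <= (sval x).1.1 + 2^-1 ^+ (sval x).2 / 2 &
  (sval x).1.2 <= (sval y).1.2 <= (sval x).1.2 + 2^-1 ^+ (sval x).2 / 2].
have step (x : St) : {y : St | rel x y}.
  apply: cid; case: x => -[[a b] n] /= nLx.
  have h0 : 0 < 2^-1 ^+ n :> R by rewrite exprn_gt0 // invr_gt0.
  have [a' [b' [ha hb nL']]] := liftable_quarter cG h0 nLx.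
  have E : 2^-1 ^+ n / 2 = 2^-1 ^+ n.+1 :> R by rewrite exprSr.
  rewrite E in nL'.
  by exists (exist _ (a', b', n.+1) nL').
pose z0 : R * R * nat := (0, 0, 0%N).
have x0P : ~ liftable G (box z0.1.1 (z0.1.1 + 2^-1 ^+ z0.2) z0.1.2 (z0.1.2 + 2^-1 ^+ z0.2)).
  by rewrite /= !add0r expr0.
have [x [hx0 hx]] := dependent_choice step (exist _ z0 x0P).
have n_x k : (sval (x k)).2 = k by elim: k => [|k IH]; [rewrite hx0|have [-> _ _] := hx k; rewrite IH].
pose a k := (sval (x k)).1.1; pose b k := (sval (x k)).1.2.
have da k : `|a k.+1 - a k| <= 1 * 2^-1 ^+ k.
  have [_ + _] := hx k; rewrite n_x -/(a k) -/(a k.+1) => h.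
  have h0 : 0 < 2^-1 ^+ k :> R by rewrite exprn_gt0 // invr_gt0.
  by rewrite ger0_norm; lra.
have db k : `|b k.+1 - b k| <= 1 * 2^-1 ^+ k.
  have [_ _] := hx k; rewrite n_x -/(b k) -/(b k.+1) => h.
  have h0 : 0 < 2^-1 ^+ k :> R by rewrite exprn_gt0 // invr_gt0.
  by rewrite ger0_norm; lra.
have [la hla] := geometric_limit da; have [lb hlb] := geometric_limit db.
have [r r0 hr] := liftable_local (la, lb) cG.
(* The corner is within 2 * 2^-k of its limit in each coordinate, and the side adds 2^-k. *)
have [k hk] : exists k, 3 * 2^-1 ^+ k < r.
  have /cvgrPdist_lt /(_ _ r0) [k _ Hk] :=
    @cvg_geometric R 3 2^-1 (ltac:(rewrite ger0_norm //; lra)).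
  by exists k; have := Hk k (leqnn _); rewrite /= sub0r normrN; exact/le_lt_trans/ler_norm.
apply: (svalP (x k)); apply: hr => -[y1 y2] [/= h1 h2 h3 h4].
rewrite n_x -/(a k) -/(b k) in h1 h2 h3 h4.
have := hla k; have := hlb k.
rewrite !ler_norml => /andP[l1 l2] /andP[l3 l4].
have h0 : 0 < 2^-1 ^+ k :> R by rewrite exprn_gt0 // invr_gt0.
apply: le_lt_trans hk; rewrite prod_normE /= ge_max !ler_norml.
move: (_ ^+ k) (a k) (b k) h0 h1 h2 h3 h4 l1 l2 l3 l4.
clear => e u v h0 h1 h2 h3 h4 l1 l2 l3 l4.
by apply/andP; split; apply/andP; split; lra.
Qed.

Lemma lift_cst (Z : topologicalType) (A : set Z) (p : X) (k : H) : lift A (fun=> p) (fun=> k).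
Proof.
move=> z _; have [V [s [oV Vp Ps s1 _]]] := ParE p.
exists V, (fun q => s q * k); split => //; first exact: ParM.
by apply: filterE => z' _; rewrite s1 mul1r.
Qed.

Local Notation I01 := (`[0, 1]%classic : set R).

(** Parallel transport of 1 from [x] to [y] along some path, as a relation; homotopy invariance will
    make it single-valued. *)
Definition reach (x y : X) (q : H) := exists (g : R -> X) (sg : R -> H),
  [/\ continuous g, g 0 = x, g 1 = y, lift I01 g sg & sg 0 = 1 /\ sg 1 = q].

Lemma cont_square (F : R * R -> X) : {within I01 `*` I01, continuous F} ->
  exists2 G : R * R -> X, continuous G & forall z, box 0 1 0 1 z -> G z = F z.
Proof.
move=> /within_cont_on cF.
exists (F \o (fun z => (Num.max 0 (Num.min z.1 1), Num.max 0 (Num.min z.2 1)))).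
  have ci : continuous (fun z : R * R => (Num.max 0 (Num.min z.1 1), Num.max 0 (Num.min z.2 1))).
    pose cl (t : R) : R := Num.max 0 (Num.min t 1).
    move=> z; have cz w : cl t @[t --> w] --> cl w by exact: continuous_clamp.
    exact: (cvg_pair (cvg_comp fst cl cvg_fst (cz z.1)) (cvg_comp snd cl cvg_snd (cz z.2))).
  move=> t O nO; have := cont_on_comp (A' := setT) ci _ cF.
  have iA z : [set: R * R] z -> (I01 `*` I01)
      (Num.max 0 (Num.min z.1 1), Num.max 0 (Num.min z.2 1)).
    by move=> _; rewrite /= !in_itv /= !clamp_itv.
  by move=> /(_ iA t I O nO); rewrite /nbhs /=; apply: filterS => z; exact.
by case=> z1 z2 [/= h1 h2 h3 h4]; rewrite !clamp_id ?h1 ?h2 ?h3 ?h4.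
Qed.

Lemma edge_vert (m : R) (t : R) : 0 <= m <= 1 -> I01 t -> box 0 1 0 1 (m, t).
Proof. by move=> /andP[? ?]; rewrite /= in_itv /= => /andP[? ?]; split. Qed.

Lemma edge_hor (m : R) (t : R) : 0 <= m <= 1 -> I01 t -> box 0 1 0 1 (t, m).
Proof. by move=> /andP[? ?]; rewrite /= in_itv /= => /andP[? ?]; split. Qed.

Lemma continuous_vert (m : R) : continuous (fun t : R => (m, t)).
Proof. by move=> t; exact: (cvg_pair (cvg_cst _) cvg_id). Qed.

Lemma continuous_hor (m : R) : continuous (fun t : R => (t, m)).
Proof. by move=> t; exact: (cvg_pair cvg_id (cvg_cst _)). Qed.

Lemma lift_square (G : R * R -> X) : continuous G ->
  exists2 rho, lift (box 0 1 0 1) G rho & rho (0, 0) = 1.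
Proof.
move=> cG; have [rho [L N0]] := liftable_square cG.
have n0 : rho (0, 0) \is a GRing.unit.
  by rewrite qunit N0 //; split; rewrite /= ?ler01 ?lexx.
by exists (fun z => rho z * (rho (0, 0))^-1); [exact: liftM|rewrite mulrV].
Qed.

Lemma reach_total x y (g : R -> X) : is_path x y g -> exists q, reach x y q.
Proof.
move=> /path_extend[g' [cg g0 g1 _]].
(* The path becomes a square that is constant in its first variable, so that [lift_square] also
   serves paths. *)
have cG : continuous (g' \o snd : R * R -> X).
  by move=> z; apply: continuous_comp; [exact: cvg_snd|exact: cg].
have [rho L r0] := lift_square cG.
exists (rho (0, 1)), g', (fun t => rho (0, t)); split => //.
have iA t : I01 t -> box 0 1 0 1 (0, t) by apply: edge_vert; rewrite lexx ler01.
exact: (lift_comp (@continuous_vert 0) iA L).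
Qed.

(** A lift over the homotopy square restricts to the two transports on two opposite edges. On the
    other two edges the homotopy is constant, hence so is the lift, and the end values agree. *)
Lemma reach_functional x y q q' : 
  (forall g0 g1 : R -> X, is_path x y g0 -> is_path x y g1 ->
    exists H : R * R -> X,
      [/\ {within I01 `*` I01, continuous H},
          forall t, t \in `[0, 1] -> H (0, t) = g0 t /\ H (1, t) = g1 t &
          forall s, s \in `[0, 1] -> H (s, 0) = x /\ H (s, 1) = y]) ->
  reach x y q -> reach x y q' -> q = q'.
Proof.
move=> sc [g0 [s0 [c0 g00 g01 L0 [s00 s01]]]] [g1 [s1 [c1 g10 g11 L1 [s10 s11]]]].
have p0 : is_path x y g0 by split => //; exact: continuous_subspaceT.
have p1 : is_path x y g1 by split => //; exact: continuous_subspaceT.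
have [F [cF F1 F2]] := sc _ _ p0 p1.
have [G cG GF] := cont_square cF.
have [rho L r00] := lift_square cG.
have in0 : I01 (0 : R) by rewrite /= in_itv /= lexx ler01.
have in1 : I01 (1 : R) by rewrite /= in_itv /= lexx ler01.
have i0 : 0 <= (0 : R) <= 1 by rewrite lexx ler01.
have i1 : 0 <= (1 : R) <= 1 by rewrite lexx ler01.
have cn := @segment_connected R 0 1.
have cc (h : R -> X) : continuous h -> cont_on I01 h by exact: continuous_cont_on.
have V m (im : 0 <= m <= 1) (h : R -> X) : (forall t, I01 t -> F (m, t) = h t) ->
    lift I01 h (fun t => rho (m, t)).
  move=> E; have := lift_comp (@continuous_vert m) (fun t => @edge_vert m t im) L.
  by apply: eq_lift => // t it /=; rewrite GF ?E //; exact: edge_vert.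
have Ho m (im : 0 <= m <= 1) (p : X) : (forall t, I01 t -> F (t, m) = p) ->
    lift I01 (fun=> p) (fun t => rho (t, m)).
  move=> E; have := lift_comp (@continuous_hor m) (fun t => @edge_hor m t im) L.
  by apply: eq_lift => // t it /=; rewrite GF ?E //; exact: edge_hor.
have LU G' sg tau := @lift_unique R I01 G' sg tau cn.
have cx (p : X) : cont_on I01 (fun=> p) by apply: cc => t; exact: cvg_cst.
have HB t : I01 t -> rho (t, 0) = 1.
  have E s : I01 s -> F (s, 0) = x by case/F2.
  have := LU _ _ _ (cx x) (Ho _ i0 _ E) (@lift_cst R I01 x 1).
  by apply=> //; exists 0.
have HT t : I01 t -> rho (t, 1) = rho (0, 1).
  have E s : I01 s -> F (s, 1) = y by case/F2.
  have := LU _ _ _ (cx y) (Ho _ i1 _ E) (@lift_cst R I01 y (rho (0, 1))).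
  by apply=> //; exists 0.
have -> : q = rho (0, 1).
  have E t : I01 t -> F (0, t) = g0 t by case/F1.
  have := LU _ _ _ (cc _ c0) L0 (V _ i0 _ E); rewrite -s01; apply=> //.
  by exists 0; rewrite // s00 r00.
have -> : q' = rho (1, 1).
  have E t : I01 t -> F (1, t) = g1 t by case/F1.
  have := LU _ _ _ (cc _ c1) L1 (V _ i1 _ E); rewrite -s11; apply=> //.
  by exists 0; rewrite // s10 HB.
by rewrite HT.
Qed.

(** Concatenation with a path inside [V], along which the local section times [q] continues the
    transport. *)
Lemma reach_extend x y z (V : set X) (s : X -> H) (q : H) (g : R -> X) :
  open V -> Par V s -> s y = 1 -> reach x y q -> is_path y z g ->
  (forall t, t \in `[0, 1] -> V (g t)) -> reach x z (s z * q).
Proof.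
move=> oV Ps sy [g0 [s0 [c0 g00 g01 L0 [s00 s01]]]] /path_extend[g1 [c1 g10 g11 gE]] gV.
pose cat (T : Type) (a b : R -> T) (t : R) := if t <= 2^-1 then a (2 * t) else b (2 * t - 1).
have cl : closed [set t : R | t <= 2^-1] by exact: closed_le.
have cr : closed [set t : R | 2^-1 <= t] by exact: closed_ge.
have U : [set t : R | t <= 2^-1] `|` [set t : R | 2^-1 <= t] = setT.
  by apply/seteqP; split=> t // _; case: (leP t 2^-1) => [|/ltW] ?; [left|right].
have i1 : continuous (fun t : R => 2 * t).
  by move=> t; apply: mulrl_continuous.
have i2 : continuous (fun t : R => 2 * t - 1).
  by move=> t; apply: cvgB; [exact: mulrl_continuous|exact: cvg_cst].
have catl T (a b : R -> T) t : t <= 2^-1 -> cat T a b t = a (2 * t) by rewrite /cat => ->.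
have catr T (a b : R -> T) t : a 1 = b 0 -> 2^-1 <= t -> cat T a b t = b (2 * t - 1).
  move=> E; rewrite le_eqVlt => /orP[/eqP <-|h]; last by rewrite /cat leNgt h.
  by rewrite /cat lexx divff ?subrr // pnatr_eq0.
have E1 : g0 1 = g1 0 by rewrite g01 g10.
have E2 : s0 1 = s (g1 0) * q by rewrite s01 g10 sy mul1r.
have lq : lift I01 g1 (fun t => s (g1 t) * q).
  move=> t it; have Vt t' : I01 t' -> V (g1 t') by move=> it'; rewrite gE //; exact: gV.
  exists V, (fun p => s p * q); split => //; [exact: Vt|exact: ParM|].
  by apply: filterE => t' it'; split => //; exact: Vt.
have iU : I01 = (I01 `&` [set t : R | t <= 2^-1]) `|` (I01 `&` [set t : R | 2^-1 <= t]).
  by rewrite -setIUr U setIT.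
have j1 t : (I01 `&` [set t : R | t <= 2^-1]) t -> I01 (2 * t).
  by rewrite /= !in_itv /= => -[/andP[? ?] ?]; apply/andP; split; lra.
have j2 t : (I01 `&` [set t : R | 2^-1 <= t]) t -> I01 (2 * t - 1).
  by rewrite /= !in_itv /= => -[/andP[? ?] ?]; apply/andP; split; lra.
have cI : closed I01 by exact: itv_closed.
have cc : continuous (cat X g0 g1).
  suff C : cont_on setT (cat X g0 g1).
    by move=> t O nO; have := C t I O nO; rewrite /nbhs /=; apply: filterS => z'; exact.
  rewrite -U; apply: cont_onU => //.
    apply: (@eq_cont_on _ _ (g0 \o (fun t => 2 * t))).
      by move=> t /(catl _ g0 g1) ->.
    by apply: continuous_cont_on => t; apply: continuous_comp; [exact: i1|exact: c0].
  apply: (@eq_cont_on _ _ (g1 \o (fun t => 2 * t - 1))).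
    by move=> t /(catr _ g0 g1 _ E1) ->.
  by apply: continuous_cont_on => t; apply: continuous_comp; [exact: i2|exact: c1].
have h2 : 2^-1 <= 1 :> R by lra.
have E3 : 2 * 1 - 1 = 1 :> R by ring.
exists (cat X g0 g1), (cat H s0 (fun t => s (g1 t) * q)); split => //.
- by rewrite catl ?mulr0 // invr_ge0 ler0n.
- by rewrite catr // E3.
- rewrite iU; apply: liftU; try exact: closedI.
  + exact: continuous_cont_on.
  + apply: eq_lift (lift_comp i1 j1 L0) => t [_ h] /=; by rewrite catl.
  + apply: eq_lift (lift_comp i2 j2 lq) => t [_ h] /=; by rewrite catr.
- by split; [rewrite catl ?mulr0 // invr_ge0 ler0n|rewrite catr // E3 g11].
Qed.

(** The section is transport from [x0]. On each set given by [ParE] it equals the local section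
    times its value at the centre, and is therefore parallel. *)
Theorem monodromy (x0 : X) : simply_connected R X -> exists sg : X -> H, sg x0 = 1 /\
  forall p, exists V s, [/\ open V, V p, Par V s & forall q, V q -> sg q = s q].
Proof.
move=> [pc sc].
have R1 y : {q | reach x0 y q}.
  by apply: cid; have [g /reach_total] := pc x0 y.
exists (fun y => sval (R1 y)); split.
  apply: (reach_functional (sc x0 x0) (svalP (R1 x0))).
  exists (fun=> x0), (fun=> 1); split => //; last exact: lift_cst.
  by move=> t; exact: cvg_cst.
move=> p; have [V [s [oV Vp Ps s1 h]]] := ParE p.
exists V, (fun q => s q * sval (R1 p)); split => //; first exact: ParM.
move=> q /h[g [pg gV]].
apply: (reach_functional (sc x0 q) (svalP (R1 q))).
exact: (reach_extend oV Ps s1 (svalP (R1 p)) pg gV).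
Qed.

End Lifts.

(** * CMC surfaces and their parallel sections *)

Section Scalars.
Variable R : realType.
Local Notation H := (quat R).

Lemma rq_nat (n : nat) : n%:R = rq (n%:R : R) :> H.
Proof.
elim: n => [|n IH]; first by apply: quat_ext.
by rewrite -addn1 natrD IH; apply: quat_ext; rewrite /= ?natrD ?addr0.
Qed.

Lemma rq_comm (c : R) (x : H) : rq c * x = x * rq c.
Proof. by case: x => *; qring. Qed.

Lemma rqV (c : R) : (rq c)^-1 = rq c^-1.
Proof.
have [->|c0] := eqVneq c 0; first by apply: quat_ext; rewrite /= ?invr0 ?oppr0 ?mul0r.
have c0' : c * c != 0 by rewrite mulf_neq0.
apply: quat_ext; rewrite /= /qnorm2 /= ?oppr0 ?mul0r // expr0n /= !addr0.
by field.
Qed.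

Lemma half_rq : 2^-1 = rq (2^-1 : R) :> H.
Proof. by rewrite rq_nat rqV. Qed.

Lemma quarter_rq : 4^-1 = rq (4^-1 : R) :> H.
Proof. by rewrite rq_nat rqV. Qed.

Lemma cplxD (a b : R[i]) : cplx (a + b) = cplx a + cplx b.
Proof. by case: a b => [? ?] [? ?]; apply: quat_ext; rewrite /= ?addr0. Qed.

Lemma cplxN (a : R[i]) : cplx (- a) = - cplx a.
Proof. by case: a => [? ?]; apply: quat_ext; rewrite /= ?oppr0. Qed.

Lemma cplxM (a b : R[i]) : cplx (a * b) = cplx a * cplx b.
Proof. by case: a b => [? ?] [? ?]; qring. Qed.

Lemma cplx_rq (a : R) : cplx a%:C%C = rq a.
Proof. by []. Qed.

Lemma cplx0 : cplx 0 = 0 :> H. Proof. by []. Qed.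

Lemma cplx1 : cplx 1 = 1 :> H. Proof. by []. Qed.

Lemma cplx_inj : injective (@cplx R).
Proof. by move=> [? ?] [? ?] [-> ->]. Qed.

Lemma cplxV (a : R[i]) : a != 0 -> cplx a^-1 = (cplx a)^-1.
Proof.
move=> a0; apply: (mulrI (x := cplx a)).
  by rewrite qunit -cplx0; apply: contra_neq a0 => /cplx_inj.
rewrite -cplxM divff // mulrV // qunit -cplx0.
by apply: contra_neq a0 => /cplx_inj.
Qed.

Lemma cplx_half (a : R[i]) : cplx (a / 2) = rq 2^-1 * cplx a.
Proof.
rewrite mulrC cplxM -cplx_rq; congr (cplx _ * _).
by rewrite fmorphV rmorph_nat.
Qed.

Lemma cplx_coef_a (l : R[i]) : cplx (coef_a l - 1) = rq 2^-1 * (cplx l + cplx l^-1) - 1.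
Proof. by rewrite cplxD cplxN cplx_half cplxD. Qed.

Lemma cplx_coef_b (l : R[i]) :
  cplx (coef_b l) = rq 2^-1 * (quat_i R * (cplx l^-1 - cplx l)).
Proof. by rewrite /coef_b cplx_half cplxM cplxD cplxN. Qed.

End Scalars.

(** [F] is the value of df, [u] and [w] stand for l and l^-1; A is 1/2 df N and A after J is 1/2 df.
    Both sides depend on [F], [N], [s] only through F N s and F s, so components can be compared. *)
Lemma assoc_identity (R : realType) (F N s I u w : quat R) : let h := rq (2^-1 : R) in
  h * (h * (F * N) * s - h * F * s * I) * (u - 1) +
  h * (h * (F * N) * s + h * F * s * I) * (w - 1) =
  F * (h * (N * s * (h * (u + w) - 1) + s * (h * (I * (w - u))))).
Proof.
move=> h.
have -> : h * (F * N) * s = h * (F * N * s) by rewrite !mulrA.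
have -> : h * F * s * I = h * (F * s * I) by rewrite !mulrA.
have -> : F * (h * (N * s * (h * (u + w) - 1) + s * (h * (I * (w - u))))) =
    h * (F * N * s * (h * (u + w) - 1) + F * s * (h * (I * (w - u)))).
  by rewrite mulrA -rq_comm -mulrA [F * (_ + _)]mulrDr !mulrA.
rewrite /h; move: (F * N * s) (F * s) => [? ? ? ?] [? ? ? ?].
move: I u w => [? ? ? ?] [? ? ? ?] [? ? ? ?].
by apply: quat_ext => /=; field.
Qed.

Section CmcForms.
Variables (R : realType) (X : riemannSurface R) (f N : X -> quat R).
Local Notation H := (quat R).
Implicit Types (c : chart R X) (p : X) (v : R * R) (s : X -> H) (l : R[i]).
Hypothesis W : weak_cmc f N.

Lemma cmc_smooth : smooth f. Proof. by case: W => -[]. Qed.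

Lemma gauss_smooth : smooth N. Proof. by case: W => -[]. Qed.

Lemma gauss_sq p : N p * N p = -1.
Proof. by case: W => _ _ /(_ p)[]. Qed.

Lemma cmc_starl c p v : atlas c -> dom c p -> d f c p (rotJ v) = N p * d f c p v.
Proof. by case: W => _ _ _ [E _] _ ac cp; have := E c p v ac cp. Qed.

Lemma cmc_starr c p v : atlas c -> dom c p -> d f c p (rotJ v) = - (d f c p v * N p).
Proof. by case: W => _ _ _ [_ E] _ ac cp; have := E c p v ac cp. Qed.

Lemma cmc_anti c p v : atlas c -> dom c p -> N p * d f c p v = - (d f c p v * N p).
Proof. by move=> ac cp; rewrite -cmc_starl // cmc_starr. Qed.

Lemma cmc_mean c p v : atlas c -> dom c p ->
  d f c p v = - 2^-1 * (d N c p v - N p * d N c p (rotJ v)).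
Proof. by case: W => _ _ _ _ E ac cp; have := E c p v ac cp. Qed.

Lemma gauss_anti c p v : atlas c -> dom c p -> d N c p v * N p = - (N p * d N c p v).
Proof.
move=> ac cp; apply/eqP; rewrite -addr_eq0.
have sN := smooth_sdiff gauss_smooth ac cp.
rewrite -(d_mul _ cp sN sN) (eq_d c p v (G := fun=> -1)) ?d_cst //.
exact: gauss_sq.
Qed.

Lemma gauss_d2 c p v : atlas c -> dom c p ->
  d N c p (rotJ (rotJ v)) = - d N c p v.
Proof. by move=> ac cp; rewrite d_rotJ2 //; exact: smooth_sdiff gauss_smooth ac cp. Qed.

(** At J X the mean curvature condition says df(J X) = - 2 A(X), while df(J X) = - df(X) N. *)
Lemma Aform_cmc c p v : atlas c -> dom c p -> Aform N c p v = 2^-1 * (d f c p v * N p).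
Proof.
move=> ac cp; have := cmc_starr v ac cp; have := cmc_mean (rotJ v) ac cp.
rewrite gauss_d2 // /Aform /lmulf /cstf /Defs.addf /star mulrN opprK => E E'.
have -> : d f c p v * N p = - d f c p (rotJ v) by rewrite E' opprK.
rewrite E half_rq quarter_rq.
move: (d N c p (rotJ v)) (N p * d N c p v) => x y.
by case: x y => [? ? ? ?] [? ? ? ?]; apply: quat_ext => /=; field.
Qed.

Lemma assoc_cmc l s c p v : atlas c -> dom c p ->
  assoc N l s c p v = d s c p v + d f c p v * beta N l s p.
Proof.
move=> ac cp; rewrite /assoc /Defs.addf; congr (_ + _).
rewrite /rmulf /A10 /A01 /lmulf /Defs.addf /Defs.oppf /rmulf /cstf /star !Aform_cmc //.
have -> : d f c p (rotJ v) * N p = d f c p v.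
  by rewrite cmc_starr // mulNr -mulrA gauss_sq mulrN1 opprK.
rewrite /beta cplx_coef_a cplx_coef_b !cplxD cplxN cplx1 half_rq.
exact: assoc_identity.
Qed.

End CmcForms.

Section SelfBounded.
Variables (R : realType) (X : riemannSurface R) (f : X -> quat R).
Local Notation H := (quat R).
Implicit Types (c : chart R X) (p : X) (v : R * R) (s G : X -> H).
Hypothesis sf : smooth f.

Lemma self_bounded_of s G c p (K : R) : 0 <= K -> atlas c -> dom c p ->
  (\forall q \near p, sdiff s c q /\ forall v, d s c q v = d f c q v * G q) ->
  (\forall q \near p, N1 (G q) <= K * N1 (s q)) -> self_bounded s c p.
Proof.
move=> K0 ac cp n1 n2.
have df := qsmooth_qdiff (proj1 (smoothP _) sf c ac).
have qs w := qsmooth_qD w (proj1 (smoothP _) sf c ac).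
have ip := (coord_img cp).1.
have [K1 K10 m1] := near_bound (qsmooth_qdiff (qs (1, 0)) ip).
have [K2 K20 m2] := near_bound (qsmooth_qdiff (qs (0, 1)) ip).
exists ((K1 + K2) * K); split; first by rewrite mulr_ge0 ?addr_ge0.
have m3 := near_cinv cp n1; have m4 := near_cinv cp n2.
near=> y.
have iy : img c y by near: y; exact: near_img.
have [dy cy] := cinv_dom iy.
have [ds Ds] : sdiff s c (cinv c y) /\ forall v, d s c (cinv c y) v = d f c (cinv c y) v * G (cinv c y).
  by near: y.
have b1 : N1 (qD (1, 0) (f \o cinv c) y) <= K1 by near: y.
have b2 : N1 (qD (0, 1) (f \o cinv c) y) <= K2 by near: y.
have b3 : N1 (G (cinv c y)) <= K * N1 (s (cinv c y)) by near: y.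
split; first by move: ds; rewrite /sdiff cy.
move=> v; have := Ds v; rewrite /d cy => E.
have -> : qD v (s \o cinv c) y = qD v (f \o cinv c) y * G (cinv c y) by exact: E.
apply: le_trans (N1M _ _) _.
have bv : N1 (qD v (f \o cinv c) y) <= (K1 + K2) * `|v|.
  rewrite qD_e; last exact: df.
  apply: le_trans (N1D _ _) _.
  rewrite mulrDl; apply: lerD; apply: le_trans (N1M _ _) _; rewrite N1_rq mulrC.
    by apply: ler_pM => //; [exact: N1_ge0|rewrite prod_normE le_max lexx].
  by apply: ler_pM => //; [exact: N1_ge0|rewrite prod_normE le_max lexx orbT].
apply: le_trans (ler_pM (N1_ge0 _) (N1_ge0 _) bv b3) _.
by rewrite le_eqVlt; apply/orP; left; apply/eqP; ring.
Unshelve. all: by end_near. Qed.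

End SelfBounded.

(** [x], [y] are the partial derivatives of f, [a], [b] those of N, and [z] is N times the mixed
    derivative. The two sides differ by (x + a) y - (y + b) x, and both products equal (x + a) n
    x. *)
Lemma flat_identity (R : realType) (a b x y n z : quat R) : y = n * x ->
  y + b = (x + a) * n -> - (b * x + z) + - y * x = - (a * y + z) + x * - y.
Proof.
move=> e2 e; apply/eqP; rewrite -subr_eq0; apply/eqP.
have -> : - (b * x + z) + - y * x - (- (a * y + z) + x * - y) =
    (x + a) * y - (y + b) * x.
  rewrite !mulrDl mulrN mulNr; move: (b * x) (a * y) (x * y) (y * x) z.
  by move=> [? ? ? ?] [? ? ? ?] [? ? ? ?] [? ? ? ?] [? ? ? ?]; qring.
by rewrite e e2 mulrA subrr.
Qed.

(** * A global parallel section at l = -1 *)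

Section NegOne.
Variables (R : realType) (X : riemannSurface R) (f N : X -> quat R).
Local Notation H := (quat R).
Implicit Types (c : chart R X) (p : X) (v : R * R) (s : X -> H).
Hypothesis W : weak_cmc f N.

(** The equation at l = -1, where beta = - N s. It is local and asks for differentiability only;
    smoothness of the global section is recovered from the equation. *)
Definition neg_parallel (V : set X) s := forall p c, V p -> atlas c -> dom c p ->
  sdiff s c p /\ forall v, d s c p v = d f c p v * (N p * s p).

Lemma neg_parallelS V V' s : open V' -> V' `<=` V -> neg_parallel V s -> neg_parallel V' s.
Proof. by move=> _ VV P p c /VV; exact: P. Qed.

Lemma neg_parallelM V s k : neg_parallel V s -> neg_parallel V (fun p => s p * k).
Proof.
move=> P p c Vp ac cp; have [ds Ds] := P p c Vp ac cp.
split; first by apply: sdiffM => //; exact: sdiff_cst.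
by move=> v; rewrite d_mulr // Ds !mulrA.
Qed.

Lemma neg_parallelB V s t : neg_parallel V s -> neg_parallel V t ->
  neg_parallel V (fun p => s p - t p).
Proof.
move=> P Q p c Vp ac cp; have [ds Ds] := P p c Vp ac cp; have [dt Dt] := Q p c Vp ac cp.
split; first by apply: sdiffD => //; exact: sdiffN.
by move=> v; rewrite d_sub // Ds Dt !mulrBr.
Qed.

Lemma neg_parallel_near0 V s p : neg_parallel V s -> open V -> V p -> s p = 0 ->
  \near p, s p = 0.
Proof.
move=> P oV Vp s0; have [c ac cp] := atlas_cover p.
apply: (local_vanish cp) s0.
have sN := smooth_sdiff (gauss_smooth W) ac cp.
have nV : \near p, V p by apply: open_nbhs_nbhs.
have [K K0 nK] := near_bound sN.
have nK' : \forall q \near p, N1 (N q) <= K by exact: near_of_chart cp nK.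
apply: (@self_bounded_of _ _ _ (cmc_smooth W) _ (fun q => N q * s q) _ _ K) => //.
  by apply: filterS2 nV (near_dom cp) => q Vq cq; exact: P.
apply: filterS nK' => q h; apply: le_trans (N1M _ _) _.
by apply: ler_wpM2r => //; exact: N1_ge0.
Qed.

Lemma neg_parallel_near_neq0 V s p : neg_parallel V s -> open V -> V p -> s p <> 0 ->
  \near p, s p <> 0.
Proof.
move=> P oV Vp s0; have [c ac cp] := atlas_cover p.
exact: (sdiff_neq0 cp (P _ _ Vp ac cp).1 s0).
Qed.

(** Conformality of the parallel surface f + N; it is also the relation that makes the connection at
    l = -1 flat. *)
Lemma parallel_starr c p v : atlas c -> dom c p ->
  d f c p (rotJ v) + d N c p (rotJ v) = (d f c p v + d N c p v) * N p.
Proof.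
move=> ac cp; have := cmc_mean W (rotJ v) ac cp; rewrite (gauss_d2 W) // mulrN opprK => E.
have E2 : d N c p (rotJ v) = - 2 * d f c p (rotJ v) - N p * d N c p v.
  rewrite E half_rq rq_nat; move: (d N c p (rotJ v)) (N p * d N c p v) => [? ? ? ?] [? ? ? ?].
  by apply: quat_ext => /=; field.
rewrite mulrDl (gauss_anti W) // -[d f c p v * N p]opprK -(cmc_starr W) // E2.
by rewrite mulNr mulr_natl mulr2n opprD !addrA addrN add0r.
Qed.

(** As df N = - df after J, the connection at l = -1 has the components - f_y and f_x. Writing f_y =
    N f_x and f_x = - N f_y before the second differentiation leaves only mixed second derivatives
    of f, which cancel. *)
Lemma cmc_flat c y : atlas c -> img c y ->
  let F := f \o cinv c in
  qD (0, 1) (fun y => - qD (0, 1) F y) y + - qD (0, 1) F y * qD (1, 0) F y =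
  qD (1, 0) (qD (1, 0) F) y + qD (1, 0) F y * - qD (0, 1) F y.
Proof.
move=> ac iy F.
have oi := @img_open R X c.
have sF : qsmooth (img c) F := proj1 (smoothP _) (cmc_smooth W) c ac.
have sNc : qsmooth (img c) (N \o cinv c) := proj1 (smoothP _) (gauss_smooth W) c ac.
have dN := qsmooth_qdiff sNc iy.
have dF1 := qsmooth_qdiff (qsmooth_qD (1, 0) sF) iy.
have dF2 := qsmooth_qdiff (qsmooth_qD (0, 1) sF) iy.
have J1 : rotJ (1, 0) = (0, 1) :> R * R by rewrite /rotJ /= oppr0.
have e2 z : img c z -> qD (0, 1) F z = N (cinv c z) * qD (1, 0) F z.
  move=> iz; have [dz cz] := cinv_dom iz.
  by have := cmc_starl W (1, 0) ac dz; rewrite /d cz J1.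
have e1 z : img c z -> qD (1, 0) F z = - (N (cinv c z) * qD (0, 1) F z).
  by move=> iz; rewrite e2 // mulrA (gauss_sq W) mulN1r opprK.
have n2 : \forall z \near y, qD (0, 1) F z = N (cinv c z) * qD (1, 0) F z.
  by apply: filterS (open_nbhs_nbhs (conj oi iy)) => z; exact: e2.
have n1 : \forall z \near y, qD (1, 0) F z = - (N (cinv c z) * qD (0, 1) F z).
  by apply: filterS (open_nbhs_nbhs (conj oi iy)) => z; exact: e1.
have [dy cy] := cinv_dom iy.
have e : qD (0, 1) F y + qD (0, 1) (N \o cinv c) y =
    (qD (1, 0) F y + qD (1, 0) (N \o cinv c) y) * N (cinv c y).
  by have := parallel_starr (1, 0) ac dy; rewrite /d cy J1.
rewrite qD_opp // (near_eq_qD _ n1) (near_eq_qD _ n2).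
rewrite qD_opp; last exact: qdiffM.
rewrite !qD_mul // (qD_commute _ _ oi iy sF).
exact: flat_identity (e2 _ iy) e.
Qed.

Lemma holomorphic_id : holomorphic_map (fun p : X => p).
Proof.
split; first by move=> p; exact: cvg_id.
by move=> c c' ac ac'; exact: atlas_compat.
Qed.

(** A change of charts is the pullback by the identity map, which is holomorphic because charts are
    compatible. *)
Lemma d_chart s c c' p : atlas c -> atlas c' -> dom c p -> dom c' p -> sdiff s c' p ->
  sdiff s c p /\ forall v, d s c p v = d s c' p (jac (fun p : X => p) c c' p v).
Proof. by move=> ac ac' cp c'p; exact: (d_pullback holomorphic_id ac ac' cp). Qed.

Lemma neg_parallel_exists (p : X) : exists V s, [/\ open V, V p, neg_parallel V s, s p = 1 &
  forall q, V q -> exists g, is_path (R := R) p q g /\ forall t, t \in `[0, 1] -> V (g t)].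
Proof.
have [c ac cp] := atlas_cover p.
have [ip Ep] := coord_img cp.
pose F := f \o cinv c.
have sF : qsmooth (img c) F := proj1 (smoothP _) (cmc_smooth W) c ac.
have s1 := qsmooth_qD (1, 0) sF; have s2 := qsmooth_qD (0, 1) sF.
have [r [S [r0 S0 HS]]] := flat_section (@img_open R X c) ip (qsmoothN (@img_open R X c) s2) s1
  (fun y iy => cmc_flat ac iy).
have HS' y : `|y - coord c p| < r -> [/\ img c y, qdiff S y & forall v, qD v S y =
    (rq v.1 * - qD (0, 1) F y + rq v.2 * qD (1, 0) F y) * S y].
  by move=> /HS; rewrite subrK.
(* A ball in the chart: convexity makes straight segments available as paths from [p]. *)
pose V := [set q | dom c q /\ `|coord c q - coord c p| < r].
have oV : open V.
  rewrite openE => q [cq hq].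
  have n : \forall y \near coord c q, `|y - coord c p| < r.
    apply/nbhs_ballP; exists (r - `|coord c q - coord c p|); first by rewrite /= subr_gt0.
    move=> y; rewrite -ball_normE /= ltrBrDr => h; apply: le_lt_trans h.
    rewrite [X in _ <= X + _]distrC -[y - coord c p](subrKA (coord c q)).
    exact: ler_normD.
  by apply: filterS2 (near_dom cq) (near_coord cq n) => q' ? ?; split.
have Vp : V p by split; rewrite // subrr normr0.
exists V, (S \o coord c); split => //=.
- move=> q c' [cq hq] ac' c'q; have [iq dS DS] := HS' _ hq.
  have nS : \forall y \near coord c q, S y = (S \o coord c \o cinv c) y.
    by apply: filterS (near_img cq) => y /cinv_dom[_ E]; rewrite /= E.
  have dSc : sdiff (S \o coord c) c q by apply: near_eq_qdiff dS.
  have [dS' DS'] := d_chart ac' ac c'q cq dSc.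
  split => // v; rewrite DS'.
  have df := smooth_sdiff (cmc_smooth W) ac cq.
  rewrite (d_chart ac' ac c'q cq df).2; move: (jac _ _ _ _ _) => {}v.
  have -> : d (S \o coord c) c q v = qD v S (coord c q).
    by apply/esym/near_eq_qD.
  rewrite DS [RHS]mulrA; congr (_ * _).
  have J1 : rotJ (1, 0) = (0, 1) :> R * R by rewrite /rotJ /= oppr0.
  have e1 := cmc_starr W (1, 0) ac cq; rewrite J1 in e1.
  have E1 : qD (0, 1) F (coord c q) = - (qD (1, 0) F (coord c q) * N q) := e1.
  have -> : d f c q v = qD v F (coord c q) by [].
  have E2 : qD v F (coord c q) = rq v.1 * qD (1, 0) F (coord c q) +
    rq v.2 * qD (0, 1) F (coord c q) := qD_e v df.
  rewrite E2 E1; move: (qD (1, 0) F (coord c q)) => x.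
  by rewrite opprK mulrDl -!mulrA mulNr -mulrA (gauss_sq W) mulrN1 opprK.
move=> q [cq hq].
pose g (t : R) := cinv c (coord c p + t *: (coord c q - coord c p)).
have near_g t : 0 <= t <= 1 ->
    `|coord c p + t *: (coord c q - coord c p) - coord c p| < r.
  move=> /andP[t0 t1]; rewrite addrC addKr normrZ (ger0_norm t0).
  by apply: le_lt_trans hq; rewrite ler_piMl.
exists g; split; last first.
  move=> t; rewrite in_itv /= => /near_g h; have [iy _ _] := HS' _ h.
  by have [dy Ey] := cinv_dom iy; split; rewrite /g ?Ey.
split.
- apply/within_cont_on => t; rewrite /= in_itv /= => /near_g h O nO.
  have [iy _ _] := HS' _ h.
  have ct : continuous (fun t : R => coord c p + t *: (coord c q - coord c p)).
    move=> t'; apply: cvgD; first exact: cvg_cst.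
    by apply: cvgZr_tmp; exact: cvg_id.
  have m : \forall t' \near t, O (g t') by exact: (ct t _ (cinv_cont iy nO)).
  by apply: filterS m.
- by rewrite /g scale0r addr0.
- by rewrite /g scale1r addrC subrK; have [_ ->] := coord_img cq.
Qed.

Lemma beta_neg1 s p : beta N (-1) s p = - (N p * s p).
Proof.
rewrite /beta.
have -> : coef_b (-1 : R[i]) = 0.
  by rewrite /coef_b invrN invr1 subrr mulr0 mul0r.
have -> : coef_a (-1 : R[i]) - 1 = - 2.
  by rewrite /coef_a invrN invr1 -opprD mulNr divff ?pnatr_eq0 // -opprD.
rewrite cplx0 mulr0 addr0 half_rq.
have -> : cplx (- 2 : R[i]) = rq (- 2).
  by rewrite -cplx_rq; congr cplx; rewrite rmorphN rmorph_nat.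
by move: (N p * s p) => [? ? ? ?]; apply: quat_ext => /=; field.
Qed.

Lemma neg_one_parallel (x0 : X) : simply_connected R X ->
  exists s, parallel N (-1) s /\ s x0 = 1.
Proof.
move=> sc.
have [s [s1 Hs]] := monodromy neg_parallelS neg_parallelM neg_parallelB neg_parallel_near0
  neg_parallel_near_neq0 neg_parallel_exists x0 sc.
have P c p : atlas c -> dom c p ->
    sdiff s c p /\ forall v, d s c p v = d f c p v * (N p * s p).
  move=> ac cp; have [V [t [oV Vp Pt E]]] := Hs p.
  have nE : \forall q \near p, t q = s q.
    by apply: filterS (open_nbhs_nbhs (conj oV Vp)) => q /E.
  have [dt Dt] := Pt p c Vp ac cp; split; first exact: near_eq_sdiff dt.
  by move=> v; rewrite -(near_eq_d v cp nE) Dt E.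
exists s; split => //; split; last first.
  move=> c p v ac cp; rewrite (assoc_cmc W) // beta_neg1 (P _ _ ac cp).2.
  by rewrite mulrN subrr.
apply/smoothP => c ac.
have sF := proj1 (smoothP _) (cmc_smooth W) c ac.
have sNc := proj1 (smoothP _) (gauss_smooth W) c ac.
apply: (@qsmooth_bootstrap _ _ _ (fun v y => qD v (f \o cinv c) y * N (cinv c y))).
- exact: img_open.
- by move=> v; apply: qsmoothM; [exact: img_open|exact: qsmooth_qD|].
- by move=> y iy; have [dy cy] := cinv_dom iy; have := (P _ _ ac dy).1; rewrite /sdiff cy.
- move=> y v iy; have [dy cy] := cinv_dom iy.
  by have := (P _ _ ac dy).2 v; rewrite /d cy mulrA.
Qed.

End NegOne.

(** * Algebra of the dressing *)

Section Coefficients.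
Variable R : realType.
Implicit Types l mu : R[i].

(* The Cayley transform [l |-> - i (l + 1) / (l - 1)]; it turns [dress_factor] into a
   quotient of differences. *)
Definition coef_ratio l := coef_b l / (coef_a l - 1).

Lemma coef_a_sub1 l : l != 0 -> coef_a l - 1 = (l - 1) ^+ 2 / (2 * l).
Proof. by move=> l0; rewrite /coef_a; field; rewrite l0. Qed.

Lemma coef_a_neq1 l : l != 0 -> l != 1 -> coef_a l - 1 != 0.
Proof.
move=> l0 l1; rewrite coef_a_sub1 // mulf_neq0 ?invr_eq0 ?mulf_neq0 ?pnatr_eq0 //.
all: by rewrite subr_eq0.
Qed.

Lemma coef_ratioE l : l != 0 -> l != 1 -> coef_ratio l = - 'i%C * (l + 1) / (l - 1).
Proof.
move=> l0 l1; rewrite /coef_ratio coef_a_sub1 // /coef_b; field.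
by rewrite l0 subr_eq0 l1.
Qed.

(** This is a^2 + b^2 = 1 divided by (a - 1)^2. *)
Lemma coef_ratio_sq l : l != 0 -> l != 1 ->
  1 + coef_ratio l ^+ 2 = - 2 / (coef_a l - 1).
Proof.
move=> l0 l1; rewrite coef_ratioE // coef_a_sub1 // !expr_div_n exprMn sqrrN sqr_i.
by field; rewrite l0 subr_eq0 l1.
Qed.

Lemma coef_bE l : l != 0 -> l != 1 -> coef_b l = (coef_a l - 1) * coef_ratio l.
Proof. by move=> l0 l1; rewrite mulrC divfK // coef_a_neq1. Qed.

Lemma coef_ratio_neq0 l : l != 0 -> l != 1 -> l != -1 -> coef_ratio l != 0.
Proof.
move=> l0 l1 lN1; rewrite coef_ratioE // !mulf_neq0 ?invr_eq0 ?subr_eq0 //.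
  by rewrite oppr_eq0 -sqrf_eq0 sqr_i oppr_eq0 oner_eq0.
by rewrite -(opprK 1) subr_eq0.
Qed.

(** The Cayley transform carries the reflection mu -> 1 / conj mu in the unit circle to complex
    conjugation. *)
Lemma conj_coef_ratio mu : mu != 0 -> mu != 1 ->
  conjc (coef_ratio mu) = - 'i%C * ((conjc mu)^-1 + 1) / ((conjc mu)^-1 - 1).
Proof.
move=> m0 m1; rewrite coef_ratioE // !rmorphM rmorphN fmorphV rmorphD rmorphB rmorph1 /=.
rewrite (_ : Complex 0 (-1) = - 'i%C); last by apply/eqP; rewrite eq_complex /= oppr0 !eqxx.
have c0 : conjc mu != 0 by rewrite fmorph_eq0.
have c1 : conjc mu != 1 by rewrite -(rmorph1 (@conjc R)) (inj_eq (fmorph_inj _)).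
rewrite -subr_eq0 in c1; move: (conjc mu) c0 c1 => m c0 c1.
have c1' : 1 - m != 0 by rewrite subr_eq0 eq_sym -subr_eq0.
by field; rewrite mulN1r c0 c1 c1'.
Qed.

Lemma cayley_sub (l m : R[i]) : l != 1 -> m != 1 ->
  - 'i%C * (l + 1) / (l - 1) - - 'i%C * (m + 1) / (m - 1) =
  2 * 'i%C * (l - m) / ((l - 1) * (m - 1)) :> R[i].
Proof. by move=> l1 m1; field; rewrite !subr_eq0 m1 l1. Qed.

Lemma im_neq0 : 'i%C != 0 :> R[i].
Proof. by rewrite -sqrf_eq0 sqr_i oppr_eq0 oner_eq0. Qed.

Lemma conjV_neq1 mu : mu != 1 -> (conjc mu)^-1 != 1.
Proof.
by move=> m1; rewrite invr_eq1 -(rmorph1 (@conjc R)) (inj_eq (fmorph_inj _)).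
Qed.

Lemma conj_coef_neq mu l : mu != 0 -> mu != 1 -> l != 0 -> l != 1 -> l != (conjc mu)^-1 ->
  coef_ratio l - conjc (coef_ratio mu) != 0.
Proof.
move=> m0 m1 l0 l1 lm; have n1 := conjV_neq1 m1.
rewrite conj_coef_ratio // coef_ratioE // cayley_sub //.
by rewrite !mulf_neq0 ?im_neq0 ?invr_eq0 ?mulf_neq0 ?pnatr_eq0 ?subr_eq0.
Qed.

(** The constant in gamma normalizes it to 1 at l = 1, the point sent to infinity by the Cayley
    transform; in that coordinate only the zero and the pole remain. *)
Lemma dress_factorE mu l : mu != 0 -> mu != 1 -> l != 0 -> l != 1 -> l != (conjc mu)^-1 ->
  dress_factor mu l = (coef_ratio l - coef_ratio mu) / (coef_ratio l - conjc (coef_ratio mu)).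
Proof.
move=> m0 m1 l0 l1 lm; have n1 := conjV_neq1 m1.
rewrite conj_coef_ratio // !coef_ratioE // !cayley_sub // /dress_factor.
move: (_^-1) lm n1 => m lm n1; field.
by rewrite !subr_eq0 ?[1 == _]eq_sym im_neq0 l1 m1 lm n1.
Qed.

Lemma dress_factor1 mu : mu != 0 -> mu != 1 -> dress_factor mu 1 = 1.
Proof.
move=> m0 m1; have n1 := conjV_neq1 m1; rewrite /dress_factor; move: (_^-1) n1 => m n1.
by rewrite mulrA divfK ?divff // subr_eq0 eq_sym.
Qed.

Lemma dress_factor_neq0 mu l : mu != 0 -> mu != 1 -> l != mu -> l != (conjc mu)^-1 ->
  dress_factor mu l != 0.
Proof.
move=> m0 m1 lm lm'; have n1 := conjV_neq1 m1.
by rewrite !mulf_neq0 ?invr_eq0 ?subr_eq0 // eq_sym.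
Qed.

End Coefficients.

Section DressingAlgebra.
Variable R : realType.
Local Notation H := (quat R).
Implicit Types x y z n a b F G : H.

Lemma qmulV x : x != 0 -> x^-1 * x = 1.
Proof. by move=> x0; rewrite mulVr // qunit. Qed.

Lemma qdivv x : x != 0 -> x * x^-1 = 1.
Proof. by move=> x0; rewrite mulrV // qunit. Qed.

Lemma qmulK x y : x != 0 -> y * x * x^-1 = y.
Proof. by move=> x0; rewrite mulrK // qunit. Qed.

Lemma qdivK x y : x != 0 -> y * x^-1 * x = y.
Proof. by move=> x0; rewrite mulrVK // qunit. Qed.

Lemma qVmulK x y : x != 0 -> x^-1 * (x * y) = y.
Proof. by move=> x0; rewrite mulKr // qunit. Qed.

Lemma qmulVK x y : x != 0 -> x * (x^-1 * y) = y.
Proof. by move=> x0; rewrite mulVKr // qunit. Qed.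

Lemma qmul_eq0 x y : (x * y == 0) = (x == 0) || (y == 0).
Proof.
apply/eqP/orP => [xy|[] /eqP ->]; rewrite ?mul0r ?mulr0 //.
case: (boolP (x == 0)) => x0; [by left|right; apply/eqP].
by rewrite -(qVmulK y x0) xy mulr0.
Qed.

Lemma qmul_neq0 x y : x != 0 -> y != 0 -> x * y != 0.
Proof. by rewrite qmul_eq0 negb_or => -> ->. Qed.

Lemma qinv_neq0 x : x != 0 -> x^-1 != 0.
Proof. by rewrite -!qunit unitrV. Qed.

Lemma qinvM x y : x != 0 -> y != 0 -> (x * y)^-1 = y^-1 * x^-1.
Proof. by move=> x0 y0; rewrite invrM // qunit. Qed.

Lemma double_half x : 2^-1 * x + 2^-1 * x = x.
Proof. by rewrite half_rq; case: x => *; apply: quat_ext => /=; field. Qed.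

Lemma halfM x y : x * (2^-1 * y) = 2^-1 * (x * y).
Proof. by rewrite mulrA half_rq -rq_comm mulrA. Qed.

Lemma qdouble_inj x y : x + x = y + y -> x = y.
Proof. by move=> E; rewrite -(double_half x) -(double_half y) -!mulrDr E. Qed.

(* At a point, [n], [a], [b] are the values of N, alpha, beta; [ca] is a - 1 and [cc] is
   b / (a - 1) in the notation of the statement; [nc] is the dressed Gauss map. *)
Section Point.
Variables (n a ca cc : H).
Hypotheses (n2 : n * n = -1) (a0 : a != 0) (ca0 : ca != 0)
  (hcomm : ca * cc = cc * ca) (hcc : 1 + cc * cc = - 2 * ca^-1).

Let b := 2^-1 * (n * a * ca + a * (ca * cc)).
Let ch := a * cc * a^-1.
Let B := b * a^-1.
Let S := 2^-1 * (n + ch).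
Let nc := a * b^-1 + ch.

Let caE : ca + ca * cc * cc = - 2.
Proof.
by rewrite hcomm -mulrA hcomm mulrA -[X in X + _]mul1r -mulrDl hcc -mulrA qmulV // mulr1.
Qed.

(** In n b - b cc the terms containing [n] cancel, and - 1/2 a (ca + ca cc^2) = a remains. *)
Lemma beta_eq : n * b = a + b * cc.
Proof.
apply: qdouble_inj; rewrite /b !halfM -!mulrA double_half.
rewrite addrACA double_half.
have -> : a + a = - (a * ca + a * ca * cc * cc).
  by rewrite -!mulrA -mulrDr mulrA caE mulrN mulr_natr mulr2n opprK.
rewrite mulrDr mulrDl !mulrA n2 mulN1r mulNr.
move: (a * ca * cc * cc) => [? ? ? ?]; move: (n * a * ca * cc) (a * ca) => [? ? ? ?] [? ? ? ?].
qring.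
Qed.

Lemma beta_neq0 : b != 0.
Proof.
apply/eqP => b0; have := beta_eq; rewrite b0 mulr0 mul0r addr0 => /esym/eqP.
by rewrite (negPf a0).
Qed.

Lemma beta_conj : b = S * (a * ca).
Proof. by rewrite /S -mulrA mulrDl /b /ch hcomm !mulrA qdivK // mulrA. Qed.

Lemma S_neq0 : S != 0.
Proof. by apply: contraNneq beta_neq0 => S0; rewrite beta_conj S0 mul0r. Qed.

Lemma B_neq0 : B != 0. Proof. by rewrite qmul_neq0 ?beta_neq0 ?qinv_neq0. Qed.

Lemma B_eq : n * B = 1 + B * ch.
Proof. by rewrite /B mulrA beta_eq mulrDl qdivv // /ch !mulrA qdivK. Qed.

(** So [nc] is B^-1 n B, where B^-1 = alpha beta^-1 is the T of the dressing. *)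
Lemma B_nc : B * nc = n * B.
Proof.
by rewrite B_eq /nc mulrDr; congr (_ + _); rewrite /B mulrA qdivK // qdivv // beta_neq0.
Qed.

Lemma nc_sq : nc * nc = -1.
Proof.
have E : B * (nc * nc) = B * -1 by rewrite mulrA B_nc -mulrA B_nc mulrA n2 mulN1r mulrN1.
by rewrite -(qVmulK (nc * nc) B_neq0) E qVmulK // B_neq0.
Qed.

(** B S = 1/2 (B n + n B - 1) commutes with [n] because n^2 = -1, and B carries [nc] to [n]. *)
Lemma S_nc : S * n = nc * S.
Proof.
have SE : B * S = 2^-1 * (B * n + n * B - 1).
  by rewrite halfM mulrDr B_eq [1 + _]addrC !addrA addrK.
have E : B * (S * n) = B * (nc * S).
  rewrite (mulrA B S) (mulrA B nc) B_nc -(mulrA n B S) SE halfM -(mulrA 2^-1).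
  congr (_ * _); move: (B) => x.
  rewrite !mulrDl !mulrDr -(mulrA x) n2 mulrN1 (mulrA n n) n2 mulN1r mulN1r mulrN1 (mulrA n).
  by rewrite [- x + _]addrC.
by rewrite -(qVmulK (S * n) B_neq0) E qVmulK // B_neq0.
Qed.

Lemma T_nc : a * b^-1 * n = nc * (a * b^-1).
Proof.
have TB : (a * b^-1) = B^-1 by rewrite (qinvM beta_neq0 (qinv_neq0 a0)) invrK.
by rewrite TB -(qVmulK (nc * B^-1) B_neq0) mulrA B_nc qmulK // B_neq0.
Qed.

Lemma ch_sq : ch * ch = - (1 + (a * ca^-1 * a^-1 + a * ca^-1 * a^-1)).
Proof.
have E : cc * cc = - 1 - (ca^-1 + ca^-1).
  by apply: (addrI 1); rewrite hcc addrA subrr add0r mulNr mulr_natl mulr2n.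
rewrite /ch !mulrA qdivK // -[a * cc * cc]mulrA E.
by rewrite mulrDr mulrN1 mulrN mulrDr mulrBl mulNr qdivv // mulrDl !opprD.
Qed.

(** The left side is the differential of f - c with [F] for df. By [B_eq] its first two terms are F
    n B = - n F B. *)
Lemma dressed_form F : n * F = - (F * n) ->
  F + F * B * ch - ch * F * B = - (S * F * B + S * F * B).
Proof.
move=> nF.
have -> : S * F * B + S * F * B = (n + ch) * F * B.
  by rewrite /S -!mulrA double_half.
by rewrite mulrDl nF mulrDl opprD mulNr opprK -(mulrA F) -(mulrA F n) B_eq mulrDr mulr1 mulrA.
Qed.

End Point.

(** For identities that become additive once everything is expanded: each monomial is abstracted to
    an atom before components are compared. *)
Ltac qabelian :=
  rewrite ?(mulrDl, mulrDr, mulrN, mulNr, mul1r, mulr1, mulrN1, mulN1r, mulrA, opprD, opprK);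
  repeat match goal with |- context [@GRing.mul ?S ?x ?y] =>
    change (@GRing.mul S x y) with (mulq x y) end;
  repeat match goal with |- context [mulq ?x ?y] =>
    generalize (mulq x y); let v := fresh in intro v; match goal with |- context [v] => idtac end
  end; clear; qring.

(** [n] and [cc] act on the left and [k] on the right, so the two sides never mix, and the claim is
    a polynomial identity modulo n^2 = -1. *)
Lemma gauge_core1 n cc k x : n * n = -1 -> let y := x * k - cc * x in
  - ((n + cc) * x * (1 + k * k)) + n * ((1 + cc * cc) * x) + (1 + cc * cc) * x * k =
  - (n * ((n + cc) * y) + (n + cc) * y * k).
Proof.
move=> n2 /=.
rewrite !(mulrDl, mulrDr, mulrN, mulNr, mul1r, mulr1, mulrA, n2, mulN1r).
qabelian.
Qed.

Lemma gauge_core2 n w cc k u : n * n = -1 -> n * w = - (w * n) ->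
  let Z := n * u + u * k in
  - (w * u * (1 + k * k)) + (n + cc) * (w * Z) = - (w * Z * k - cc * (w * Z)).
Proof.
move=> n2 nw Z.
have -> : (n + cc) * (w * Z) = - (w * (n * Z)) + cc * (w * Z).
  by rewrite mulrDl (mulrA n) nw mulNr -mulrA.
have -> : n * Z = Z * k - u * (1 + k * k).
  rewrite /Z mulrDr (mulrA n n) n2 mulN1r; qabelian.
qabelian.
Qed.

Lemma half_double x : 2^-1 * x * - 2 = - x.
Proof.
by rewrite mulrN mulr_natr mulr2n double_half.
Qed.

(* [rho] is the dressing matrix conjugated by alpha. Up to the right factor [kap] it is
   [u |-> u k - cc u], and the gauge equation reduces to [(n + k) (k - n) = 1 + k^2],
   where [k] acts on the right. *)
Lemma gauge_identity n w ca cc k A kap x (rho : H -> H) :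
  n * n = -1 -> n * w = - (w * n) -> ca != 0 -> ca * cc = cc * ca ->
  1 + cc * cc = - 2 * ca^-1 -> A * (1 + k * k) = - 2 -> A * k = k * A ->
  A * kap = kap * A -> k * kap = kap * k -> kap != 0 ->
  (forall u, rho u * kap = u * k - cc * u) ->
  let b := 2^-1 * ((n + cc) * ca) in
  - (w * b * rho x) - b * ca^-1 * w * (n * b * rho x * A + b * rho x * (A * k)) =
  rho (- (w * b * x) + 2^-1 * (w * (n * x * A + x * (A * k)))).
Proof.
move=> n2 nw ca0 hcomm hcc Ah Ak Akap kkap kap0 rhoE b.
pose h := 1 + k * k; rewrite -/h in Ah.
have h0 : h != 0.
  apply/eqP => E; move: Ah; rewrite E mulr0 => /eqP.
  by rewrite eq_sym oppr_eq0 rq_nat => /eqP[/eqP]; rewrite pnatr_eq0.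
have hk : h * k = k * h by rewrite /h mulrDl mulrDr mul1r mulr1 mulrA.
have hkap : h * kap = kap * h.
  by rewrite /h mulrDl mulrDr mul1r mulr1 -mulrA kkap mulrA kkap mulrA.
pose X := ca * x; pose y := X * k - cc * X; pose u := (n + cc) * y.
pose Z := n * u + u * k.
have Hr : b * (rho x * kap) = 2^-1 * u.
  rewrite rhoE /b /u /y /X -!mulrA; congr (_ * (_ * _)).
  by rewrite mulrBr !mulrA hcomm.
have XE : (1 + cc * cc) * X = - (x + x).
  by rewrite /X -(qVmulK x ca0) hcc -mulrA qVmulK // qVmulK // mulNr mulr_natl mulr2n.
have bx : b * x = 2^-1 * ((n + cc) * X) by rewrite /b /X -!mulrA.
have bca : b * ca^-1 = 2^-1 * (n + cc) by rewrite /b mulrA qmulK.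
have c1 : - ((n + cc) * X * h) + n * ((1 + cc * cc) * X) + (1 + cc * cc) * X * k = - Z.
  exact: gauge_core1.
have c2 : - (w * u * h) + (n + cc) * (w * Z) = - (w * Z * k - cc * (w * Z)).
  exact: gauge_core2.
rewrite XE in c1.
(* Right multiplication by [kap * h] clears denominators: [kap] turns [rho] into the difference of
   multiplications, and [A * h = - 2]. *)
suff E : (- (w * b * rho x) - b * ca^-1 * w * (n * b * rho x * A + b * rho x * (A * k)))
    * (kap * h) = rho (- (w * b * x) + 2^-1 * (w * (n * x * A + x * (A * k)))) * (kap * h).
  have kh0 : kap * h \is a GRing.unit by rewrite qunit qmul_neq0.
  exact: mulIr kh0 _ _ E.
rewrite bca; move: (rho x) Hr => r Hr.
have ZE : Z = n * u + u * k by [].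
clear bca XE hcc hcomm; clearbody Z u; clear y; clearbody b X h.
have L1 : w * b * r * (kap * h) = 2^-1 * (w * u * h).
  by rewrite -(mulrA w b) -(mulrA w) (mulrA (b * r)) -(mulrA b) Hr -(mulrA 2^-1) halfM (mulrA w).
have L2 : n * b * r * A * (kap * h) = - (n * u).
  rewrite -(mulrA (n * b * r)) (mulrA A) Akap -(mulrA kap) Ah (mulrA (n * b * r)).
  by rewrite -(mulrA n b) -(mulrA n) -(mulrA b) Hr -mulrA half_double mulrN.
have L3 : b * r * (A * k) * (kap * h) = - (u * k).
  rewrite -(mulrA (b * r)) -(mulrA A) (mulrA k) kkap -(mulrA kap) -hk (mulrA A) Akap.
  rewrite -(mulrA kap) (mulrA A h) Ah (mulrA (b * r)) -(mulrA b) Hr mulrA half_double.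
  by rewrite mulNr.
have -> : (- (w * b * r) - 2^-1 * (n + cc) * w * (n * b * r * A + b * r * (A * k)))
    * (kap * h) = 2^-1 * (- (w * u * h) + (n + cc) * (w * Z)).
  rewrite mulrBl mulNr L1 -(mulrA (2^-1 * (n + cc) * w)) mulrDl L2 L3 -(opprD (n * u)) -ZE mulrN opprK.
  by rewrite [RHS]mulrDr mulrN -!(mulrA 2^-1) -(mulrA (n + cc)).
rewrite c2 [RHS]mulrA rhoE.
set V := _ + 2^-1 * _.
have Vh : V * h = - (2^-1 * (w * Z)).
  have x2 : x * - 2 = - (x + x) by rewrite mulrN mulr_natr mulr2n.
  have V1 : w * b * x * h = 2^-1 * (w * ((n + cc) * X * h)).
    by rewrite -(mulrA w) bx halfM -(mulrA 2^-1) -(mulrA w).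
  have V2 : (n * x * A + x * (A * k)) * h = n * - (x + x) + - (x + x) * k.
    by rewrite mulrDl -(mulrA (n * x)) -(mulrA x) -(mulrA A) -hk (mulrA A) Ah mulrA -(mulrA n) x2.
  rewrite /V mulrDl mulNr V1 -(mulrA 2^-1) -(mulrA w (_ + _)) V2 -mulrN -mulrDr -mulrN -mulrDr addrA c1.
  by rewrite !mulrN.
rewrite [RHS]mulrBl -(mulrA V) -hk (mulrA V) -(mulrA cc) Vh mulNr mulrN [cc * - _]mulrN -(mulrA 2^-1) halfM.
by rewrite -opprD -mulrBr.
Qed.

End DressingAlgebra.

Lemma q1_comm (R : realType) (x y : quat R) : q1 (x * y) = q1 (y * x).
Proof. by case: x y => [? ? ? ?] [? ? ? ?] /=; ring. Qed.

Lemma q1_conj (R : realType) (a x : quat R) : a != 0 -> q1 (a * x * a^-1) = q1 x.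
Proof. by move=> a0; rewrite -mulrA q1_comm qdivK. Qed.

(** With a nonzero real part, the imaginary components of x^2 = -1 would force [x] to be real, with
    a negative square. *)
Lemma imaginary_sqrtN1 (R : realType) (x : quat R) : x * x = -1 -> imaginary x.
Proof.
case: x => a b c e [/= h1 h2 h3 h4]; rewrite /imaginary /=; apply/eqP; apply: contraT => a0.
have z t : a * t + t * a = 0 -> t = 0.
  move=> h; have /eqP : 2 * a * t = 0 by rewrite -h; ring.
  by rewrite !mulf_eq0 (negPf a0) pnatr_eq0 /= => /eqP.
have b0 : b = 0 by apply: z; move: h2; rewrite oppr0 => <-; ring.
have c0 : c = 0 by apply: z; move: h3; rewrite oppr0 => <-; ring.
have e0 : e = 0 by apply: z; move: h4; rewrite oppr0 => <-; ring.
move: h1; rewrite b0 c0 e0 !mul0r !subr0 => h1.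
have : 0 <= a * a by rewrite -expr2 sqr_ge0.
by rewrite h1 oppr_ge0 ler10.
Qed.

Lemma cplx_eq0 (R : realType) (z : R[i]) : (cplx z == 0) = (z == 0).
Proof. by rewrite -cplx0; apply: (inj_eq (@cplx_inj R)). Qed.

Lemma cplx_comm (R : realType) (y z : R[i]) : cplx y * cplx z = cplx z * cplx y.
Proof. by rewrite -!cplxM mulrC. Qed.

Lemma cplxN2 (R : realType) : cplx (- 2 : R[i]) = - 2.
Proof. by rewrite cplxN (_ : 2 = 1 + 1) // cplxD cplx1. Qed.

(** * The dressed surface *)

Section Parallel.
Variables (R : realType) (X : riemannSurface R) (f N : X -> quat R).
Local Notation H := (quat R).
Implicit Types (c : chart R X) (p : X) (v : R * R) (s : X -> H) (l : R[i]).
Hypothesis W : weak_cmc f N.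

Lemma d_parallel l s c p v : parallel N l s -> atlas c -> dom c p ->
  d s c p v = - (d f c p v * beta N l s p).
Proof.
move=> [_ P] ac cp; have := P c p v ac cp; rewrite (assoc_cmc W) // => /eqP.
by rewrite addr_eq0 => /eqP.
Qed.

Lemma parallel_neq0 l s : parallel N l s -> nontrivial s -> forall p, s p != 0.
Proof.
move=> P [p0 sp0] p; apply/eqP => sp; apply: sp0; move: p0.
apply: vanish_everywhere; last by exists p.
move=> c q ac cq; have ss := P.1; split; first exact: smooth_sdiff.
have [K K0 nK] := near_bound (smooth_sdiff (gauss_smooth W) ac cq).
have nK' : \forall q' \near q, N1 (N q') <= K by exact: near_of_chart cq nK.
pose A := cplx (coef_a l - 1); pose B := cplx (coef_b l).
apply: (@self_bounded_of _ _ _ (cmc_smooth W) _ (fun q => - beta N l s q) _ _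
    (N1 (2^-1 : H) * (K * N1 A + N1 B))) => //.
- by rewrite mulr_ge0 ?addr_ge0 ?mulr_ge0 ?N1_ge0.
- apply: filterS (near_dom cq) => q' cq'; split; first exact: smooth_sdiff.
  by move=> v; rewrite (d_parallel _ P) // mulrN.
apply: filterS nK' => q' Kq'; rewrite N1N /beta -/A -/B.
apply: le_trans (N1M _ _) _; rewrite -[leRHS]mulrA; apply: ler_wpM2l; first exact: N1_ge0.
apply: le_trans (N1D _ _) _; rewrite mulrDl; apply: lerD.
  apply: le_trans (N1M _ _) _; rewrite mulrAC; apply: ler_wpM2r; first exact: N1_ge0.
  by apply: le_trans (N1M _ _) _; apply: ler_wpM2r => //; exact: N1_ge0.
by apply: le_trans (N1M _ _) _; rewrite mulrC.
Qed.

Lemma gauss_conj_cmc c p v : atlas c -> dom c p ->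
  N p * (d f c p v + d N c p v) = - ((d f c p v + d N c p v) * N p).
Proof.
by move=> ac cp; rewrite mulrDr mulrDl (cmc_anti W) // (gauss_anti W) // opprD opprK.
Qed.

Lemma parallel_starl c p v : atlas c -> dom c p ->
  d f c p (rotJ v) + d N c p (rotJ v) = - (N p * (d f c p v + d N c p v)).
Proof. by move=> ac cp; rewrite (parallel_starr W) // gauss_conj_cmc // opprK. Qed.

(** The conclusion is [weak_cmc] as d f + d N may vanish at some points. *)
Lemma parallel_surface_cmc : weak_cmc (fun p => f p + N p) (fun p => - N p).
Proof.
have sf := cmc_smooth W; have sN := gauss_smooth W.
have dg c p v (ac : atlas c) (cp : dom c p) :
    d (fun p => f p + N p) c p v = d f c p v + d N c p v.
  by rewrite d_add //; exact: smooth_sdiff.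
have dmN c p v (ac : atlas c) (cp : dom c p) : d (fun p => - N p) c p v = - d N c p v.
  by rewrite d_opp //; exact: smooth_sdiff.
split.
- by split; [exact: smoothD|exact: smoothN].
- move=> p; case: W => _ If IN _ _; move: (If p) (IN p).1; rewrite /imaginary /= => -> ->.
  by rewrite addr0.
- move=> p; split; last by rewrite mulrNN (gauss_sq W).
  by case: W => _ _ /(_ p)[+ _] _ _; rewrite /imaginary /= => ->; rewrite oppr0.
- split=> c p v ac cp; rewrite /star /lmulf /Defs.oppf /rmulf !dg //.
    by rewrite parallel_starl // mulNr.
  by rewrite (parallel_starr W) // mulrN opprK.
move=> c p v ac cp; rewrite /lmulf /cstf /Defs.addf /Defs.oppf /star !dmN // dg //.
rewrite (cmc_mean W) // mulrNN half_rq.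
move: (N p * _) (d N c p v) => [? ? ? ?] [? ? ? ?].
by apply: quat_ext => /=; field.
Qed.

End Parallel.

Section Dressing.
Variables (R : realType) (X : riemannSurface R) (f N al : X -> quat R) (mu : R[i]).
Local Notation H := (quat R).
Implicit Types (c : chart R X) (p : X) (v : R * R) (s : X -> H) (l : R[i]).
Hypotheses (W : weak_cmc f N) (mu0 : mu != 0) (mu1 : mu != 1).
Hypotheses (P : parallel N mu al) (nt : nontrivial al).

Local Notation ca := (cplx (coef_a mu - 1)).
Local Notation cc := (cplx (coef_ratio mu)).
Local Notation b := (beta N mu al).

(* For T = alpha beta^-1, [dressed_gauss] is T N T^-1, see [darboux_gauss]. *)
Definition ratio_conj p := al p * cc * (al p)^-1.
Definition mid_normal p := 2^-1 * (N p + ratio_conj p).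
Definition beta_quot p := b p * (al p)^-1.
Definition dressed_gauss p := al p * (b p)^-1 + ratio_conj p.
Definition dressed_surface p := f p - ratio_conj p.

Lemma alpha_neq0 p : al p != 0. Proof. exact: parallel_neq0 W _ _ P nt p. Qed.

Lemma ca_neq0 : ca != 0. Proof. by rewrite cplx_eq0 coef_a_neq1. Qed.

Lemma ca_comm : ca * cc = cc * ca. Proof. exact: cplx_comm. Qed.

Lemma cc_sq : 1 + cc * cc = - 2 * ca^-1.
Proof.
rewrite -cplxM -expr2 -cplxV ?coef_a_neq1 // -cplxN2 -cplxM -coef_ratio_sq //.
by rewrite cplxD cplx1.
Qed.

Lemma betaE p : b p = 2^-1 * (N p * al p * ca + al p * (ca * cc)).
Proof. by rewrite /beta coef_bE // cplxM. Qed.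

Lemma gauss_beta p : N p * b p = al p + b p * cc.
Proof. rewrite betaE; exact: beta_eq (gauss_sq W p) ca_neq0 ca_comm cc_sq. Qed.

Lemma beta_alpha_neq0 p : b p != 0.
Proof.
rewrite betaE.
exact: beta_neq0 (gauss_sq W p) (alpha_neq0 p) ca_neq0 ca_comm cc_sq.
Qed.

Lemma mid_normal_neq0 p : mid_normal p != 0.
Proof. exact: S_neq0 (gauss_sq W p) (alpha_neq0 p) ca_neq0 ca_comm cc_sq. Qed.

Lemma beta_mid p : b p = mid_normal p * (al p * ca).
Proof. by rewrite betaE; apply: beta_conj ca_comm; exact: alpha_neq0. Qed.

Lemma beta_quot_neq0 p : beta_quot p != 0.
Proof. by rewrite /beta_quot qmul_neq0 ?beta_alpha_neq0 ?qinv_neq0 ?alpha_neq0. Qed.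

Lemma beta_quot_gauss p : beta_quot p * dressed_gauss p = N p * beta_quot p.
Proof.
rewrite /beta_quot /dressed_gauss betaE.
exact: B_nc (gauss_sq W p) (alpha_neq0 p) ca_neq0 ca_comm cc_sq.
Qed.

Lemma dressed_gauss_sq p : dressed_gauss p * dressed_gauss p = -1.
Proof.
rewrite /dressed_gauss betaE.
exact: nc_sq (gauss_sq W p) (alpha_neq0 p) ca_neq0 ca_comm cc_sq.
Qed.

Lemma mid_normal_gauss p : mid_normal p * N p = dressed_gauss p * mid_normal p.
Proof.
rewrite /dressed_gauss betaE.
exact: S_nc (gauss_sq W p) (alpha_neq0 p) ca_neq0 ca_comm cc_sq.
Qed.

Lemma darboux_gauss p : al p * (b p)^-1 * N p = dressed_gauss p * (al p * (b p)^-1).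
Proof.
rewrite /dressed_gauss betaE.
exact: T_nc (gauss_sq W p) (alpha_neq0 p) ca_neq0 ca_comm cc_sq.
Qed.

Lemma ratio_conj_sq p :
  ratio_conj p * ratio_conj p = - (1 + (al p * ca^-1 * (al p)^-1 + al p * ca^-1 * (al p)^-1)).
Proof. exact: ch_sq (alpha_neq0 p) cc_sq. Qed.

Lemma smooth_alpha : smooth al. Proof. by case: P. Qed.

Lemma smooth_beta : smooth b.
Proof.
have cst q := @smooth_cst R X q.
by apply: smoothM => //; apply: smoothD; apply: smoothM => //;
  [apply: smoothM; [exact: gauss_smooth W|]|]; exact: smooth_alpha.
Qed.

Lemma smooth_ratio_conj : smooth ratio_conj.
Proof.
apply: smoothM; last by apply: smoothV; [exact: alpha_neq0|exact: smooth_alpha].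
by apply: smoothM; [exact: smooth_alpha|exact: smooth_cst].
Qed.

Lemma smooth_darboux_shift : smooth (fun p => al p * (b p)^-1).
Proof.
apply: smoothM; first exact: smooth_alpha.
by apply: smoothV; [exact: beta_alpha_neq0|exact: smooth_beta].
Qed.

Lemma smooth_dressed_gauss : smooth dressed_gauss.
Proof. by apply: smoothD; [exact: smooth_darboux_shift|exact: smooth_ratio_conj]. Qed.

Lemma smooth_dressed : smooth dressed_surface.
Proof. by apply: smoothB; [exact: cmc_smooth W|exact: smooth_ratio_conj]. Qed.

Section Derivatives.
Variables (c : chart R X) (p : X) (v : R * R).
Hypotheses (ac : atlas c) (cp : dom c p).

Let sf := smooth_sdiff (cmc_smooth W) ac cp.
Let sN := smooth_sdiff (gauss_smooth W) ac cp.
Let sal := smooth_sdiff smooth_alpha ac cp.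
Let sb := smooth_sdiff smooth_beta ac cp.

Lemma d_alpha : d al c p v = - (d f c p v * b p).
Proof. exact: d_parallel W _ _ _ _ _ P ac cp. Qed.

Let smulr F (q : H) : sdiff F c p -> sdiff (fun r => F r * q) c p.
Proof. by move=> sF; apply: sdiffM => //; exact: sdiff_cst. Qed.

Lemma d_ratio_conj : d ratio_conj c p v =
  - (d f c p v * beta_quot p * ratio_conj p) + ratio_conj p * d f c p v * beta_quot p.
Proof.
have s1 := smulr cc sal; have s2 := sdiffV cp sal (alpha_neq0 p).
rewrite (d_mul v cp s1 s2) (d_mulr cc v cp sal) (d_inv v cp sal (alpha_neq0 p)) d_alpha.
rewrite /beta_quot /ratio_conj !mulrN !mulNr !mulrN opprK !mulrA.
by rewrite qdivK ?alpha_neq0.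
Qed.

Lemma d_dressed : d dressed_surface c p v =
  - (mid_normal p * d f c p v * beta_quot p + mid_normal p * d f c p v * beta_quot p).
Proof.
have sr := smooth_sdiff smooth_ratio_conj ac cp.
rewrite (d_sub v sf sr) d_ratio_conj opprD opprK addrA /beta_quot betaE.
have E := dressed_form (gauss_sq W p) (alpha_neq0 p) ca_neq0 ca_comm cc_sq (cmc_anti W v ac cp).
exact: E.
Qed.

Lemma d_beta : d b c p v = 2^-1 * ((d f c p v + d N c p v) * al p * ca).
Proof.
have s1 := smulr ca (sdiffM sN sal); have s2 := smulr (cplx (coef_b mu)) sal.
rewrite [LHS](d_mull 2^-1 v cp (sdiffD s1 s2)) (d_add v s1 s2).
rewrite (d_mulr _ v cp (sdiffM sN sal)) (d_mulr _ v cp sal) (d_mul v cp sN sal) d_alpha.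
rewrite coef_bE // cplxM; congr (_ * _).
(* [gauss_beta] splits N d alpha into df alpha and a term that cancels the contribution of d alpha
   in the summand with [coef_b]. *)
have E : N p * - (d f c p v * b p) = d f c p v * al p + d f c p v * (b p * cc).
  by rewrite mulrN (mulrA (N p)) (cmc_anti W) // mulNr opprK -(mulrA (d f c p v)) gauss_beta mulrDr.
have E2 : d f c p v * (b p * cc) * ca = d f c p v * b p * (ca * cc).
  by rewrite ca_comm !mulrA.
rewrite E !mulrDl E2 mulNr -!addrA.
by rewrite subrr addr0 addrC.
Qed.

(** df cancels against d alpha beta^-1 = - df, which leaves - alpha beta^-1 d beta beta^-1. *)
Lemma d_mu_transform : d (mu_transform f N mu al) c p v =
  - (2^-1 * (al p * (b p)^-1 * (d f c p v + d N c p v) * (al p * ca * (b p)^-1))).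
Proof.
have s1 := sdiffV cp sb (beta_alpha_neq0 p).
rewrite (d_add v sf (sdiffM sal s1)) (d_mul v cp sal s1) (d_inv v cp sb (beta_alpha_neq0 p)).
rewrite d_alpha d_beta mulNr qmulK ?beta_alpha_neq0 // addrA subrr add0r.
move: (d f c p v + d N c p v) => G.
by rewrite mulrN halfM -(mulrA 2^-1) halfM !mulrA.
Qed.

End Derivatives.

Lemma star_mu_transform c p v : atlas c -> dom c p ->
  d (mu_transform f N mu al) c p (rotJ v) =
  - (dressed_gauss p * d (mu_transform f N mu al) c p v).
Proof.
move=> ac cp; rewrite !d_mu_transform // (parallel_starl W) //.
move: (_ + _) (al p * ca * _) => G K.
rewrite !(mulrN, mulNr, opprK) halfM; congr (_ * _).
by rewrite !mulrA darboux_gauss !mulrA.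
Qed.

Lemma star_dressedl c p v : atlas c -> dom c p ->
  d dressed_surface c p (rotJ v) = dressed_gauss p * d dressed_surface c p v.
Proof.
move=> ac cp; rewrite !d_dressed // (cmc_starl W) // mulrN mulrDr.
by rewrite !(mulrA (mid_normal p)) mid_normal_gauss !mulrA.
Qed.

Lemma star_dressedr c p v : atlas c -> dom c p ->
  d dressed_surface c p (rotJ v) = - (d dressed_surface c p v * dressed_gauss p).
Proof.
move=> ac cp; rewrite !d_dressed // (cmc_starr W) // mulNr opprK.
rewrite mulrDl -!(mulrA _ (beta_quot p) (dressed_gauss p)) beta_quot_gauss.
by rewrite mulrN mulNr -opprD opprK !mulrA.
Qed.

Lemma mu_transform_dressed p : mu_transform f N mu al p = dressed_surface p + dressed_gauss p.
Proof.
by rewrite /dressed_surface /dressed_gauss [X in _ = _ + X]addrC addrA subrK.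
Qed.

(** Let G and F be the differentials of f_mu and f_check. The Gauss map differentiates to G - F, and
    Nc times this form after J is G + F, so the bracket is - 2 F. *)
Lemma dressed_mean c p v : atlas c -> dom c p -> d dressed_surface c p v =
  - 2^-1 * (d dressed_gauss c p v - dressed_gauss p * d dressed_gauss c p (rotJ v)).
Proof.
move=> ac cp.
have sg := smooth_sdiff smooth_dressed_gauss ac cp.
have sd := smooth_sdiff smooth_dressed ac cp.
have dE w : d dressed_gauss c p w =
    d (mu_transform f N mu al) c p w - d dressed_surface c p w.
  rewrite (eq_d c p w mu_transform_dressed) (d_add w sd sg) [_ + d dressed_gauss _ _ _]addrC.
  by rewrite addrK.
rewrite !dE star_mu_transform // star_dressedl //.
move: (d (mu_transform _ _ _ _) _ _ _) (d dressed_surface _ _ _) => G F.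
have -> : dressed_gauss p * (- (dressed_gauss p * G) - dressed_gauss p * F) = G + F.
  by rewrite mulrBr mulrN !mulrA dressed_gauss_sq !mulN1r !opprK.
have -> : G - F - (G + F) = - (F + F) by rewrite opprD addrACA subrr add0r opprD.
by rewrite mulrNN mulrDr double_half.
Qed.

(** Conjugation preserves real parts, so the real part of [ratio_conj] is the constant removed by
    the shift. *)
Lemma dressed_cmc : weak_cmc (fun p => dressed_surface p + rq (complex.Re (coef_ratio mu)))
  dressed_gauss.
Proof.
have dE c p v : atlas c -> dom c p ->
    d (fun p => dressed_surface p + rq (complex.Re (coef_ratio mu))) c p v =
    d dressed_surface c p v.
  move=> ac cp; have sd := smooth_sdiff smooth_dressed ac cp.
  by rewrite (d_add v sd (sdiff_cst _ _ _)) d_cst addr0.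
split.
- split; last exact: smooth_dressed_gauss.
  by apply: smoothD; [exact: smooth_dressed|exact: smooth_cst].
- move=> p; have f0 : q1 (f p) = 0 by case: W => _ /(_ p).
  have E : q1 (ratio_conj p) = complex.Re (coef_ratio mu) by apply: q1_conj; exact: alpha_neq0.
  rewrite /imaginary -[LHS]/(q1 (f p) - q1 (ratio_conj p) + complex.Re (coef_ratio mu)).
  by rewrite f0 E sub0r addNr.
- by move=> p; split; [apply: imaginary_sqrtN1|]; exact: dressed_gauss_sq.
- split=> c p v ac cp; rewrite /star /lmulf /Defs.oppf /rmulf !dE //.
    exact: star_dressedl.
  exact: star_dressedr.
by move=> c p v ac cp; rewrite dE // dressed_mean.
Qed.

Lemma dressed_immersion (q : H) : immersion f -> immersion (fun p => dressed_surface p + q).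
Proof.
move=> imm c p v ac cp; have sd := smooth_sdiff smooth_dressed ac cp.
rewrite (d_add v sd (sdiff_cst _ _ _)) d_cst addr0 d_dressed // => E.
apply: (imm c p v ac cp).
have {}E : mid_normal p * d f c p v * beta_quot p == 0.
  by apply/eqP; apply: qdouble_inj; rewrite addr0 -[LHS]opprK E oppr0.
move: E; rewrite qmul_eq0 (negPf (beta_quot_neq0 p)) orbF.
by rewrite qmul_eq0 (negPf (mid_normal_neq0 p)) => /eqP.
Qed.

End Dressing.

(** * Darboux transforms *)

Section Lines.
Variables (R : realType) (X : riemannSurface R).
Local Notation H := (quat R).
Implicit Types (c : chart R X) (p : X) (v : R * R) (h k : X -> H) (phi : X -> H * H).

Lemma span2_line phi h p : (phi p).2 != 0 -> (phi p).1 = h p * (phi p).2 ->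
  span2 phi p = line h p.
Proof.
move=> n0 E; apply/seteqP; split => _ [q ->] /=.
  by exists ((phi p).2 * q); rewrite /= mul1r E mulrA.
by exists ((phi p).2^-1 * q); rewrite /= mul1r E -mulrA qmulVK.
Qed.

Lemma direct_sum_lines h k p : k p != h p -> direct_sum (line k p) (line h p).
Proof.
rewrite -subr_eq0 => n0; split=> [[v1 v2]|w [x ->] [y E]].
  pose x := (k p - h p)^-1 * (v1 - h p * v2).
  exists (k p * x, 1 * x), (h p * (v2 - x), 1 * (v2 - x)); split.
  - by exists x.
  - by exists (v2 - x).
  have E : k p * x - h p * x = v1 - h p * v2 by rewrite -mulrBl /x qmulVK.
  congr pair => /=; last by rewrite !mul1r addrC subrK.
  by rewrite mulrBr addrCA E addrC subrK.
have E1 : k p * x = h p * y := congr1 fst E.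
have E2 : 1 * x = 1 * y := congr1 snd E.
have xy : x = y by rewrite -[x]mul1r E2 mul1r.
have /eqP : (k p - h p) * x = 0 by rewrite mulrBl E1 xy subrr.
by rewrite qmul_eq0 (negPf n0) /= => /eqP ->; rewrite /= !mulr0.
Qed.

(** One line, two sections: phi2 - phi1 chi has differential - phi1 d chi, with values in the line
    of [f1], and its multiple phi2 chi^-1 - phi1 has differential phi2 d (chi^-1), with values in
    the line of [f2]. *)
Lemma bianchi_common_darboux (f1 f2 k : X -> H) (phi1 phi2 : X -> H * H) (chi : X -> H) :
  smooth (fst_sec phi1) -> smooth (snd_sec phi1) ->
  smooth (fst_sec phi2) -> smooth (snd_sec phi2) -> smooth chi -> (forall p, chi p != 0) ->
  form_eq (d (fst_sec phi2)) (rmulf (d (fst_sec phi1)) chi) ->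
  form_eq (d (snd_sec phi2)) (rmulf (d (snd_sec phi1)) chi) ->
  section_of f1 phi1 -> section_of f2 phi2 ->
  (forall p, (phi2 p).2 - (phi1 p).2 * chi p != 0) ->
  (forall p, (phi2 p).1 - (phi1 p).1 * chi p = k p * ((phi2 p).2 - (phi1 p).2 * chi p)) ->
  (forall p, k p != f1 p) -> (forall p, k p != f2 p) ->
  [/\ section_of k (fun p => ((phi2 p).1 - (phi1 p).1 * chi p, (phi2 p).2 - (phi1 p).2 * chi p)),
    is_darboux f1 k & is_darboux f2 k].
Proof.
move=> s11 s12 s21 s22 sc c0 e1 e2 l1 l2 n0 kE k1 k2.
pose psi p := ((phi2 p).1 - (phi1 p).1 * chi p, (phi2 p).2 - (phi1 p).2 * chi p).
have lk : section_of k psi by move=> p; apply: span2_line => /=; [exact: n0|exact: kE].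
split => //.
- exists psi; split => //; split.
  + by split; apply: smoothB => //; exact: smoothM.
  + move=> c p v ac cp; rewrite -l1; exists (- d chi c p v).
    have D (a b : X -> H) : smooth a -> smooth b -> form_eq (d b) (rmulf (d a) chi) ->
        d (fun p => b p - a p * chi p) c p v = a p * - d chi c p v.
      move=> sa sb E; have da := smooth_sdiff sa ac cp; have dc := smooth_sdiff sc ac cp.
      rewrite (d_sub v (smooth_sdiff sb ac cp) (sdiffM da dc)) (d_mul v cp da dc) E //.
      by rewrite /rmulf opprD addrA subrr add0r mulrN.
    by rewrite -(D _ _ s11 s21 e1) -(D _ _ s12 s22 e2).
  + by move=> p; rewrite lk; exact: direct_sum_lines.
pose psi' p := ((phi2 p).1 * (chi p)^-1 - (phi1 p).1, (phi2 p).2 * (chi p)^-1 - (phi1 p).2).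
have E1 a b p : b * (chi p)^-1 - a = (b - a * chi p) * (chi p)^-1.
  by rewrite mulrBl qmulK.
have lk' : section_of k psi'.
  move=> p; apply: span2_line => /=; first by rewrite E1 qmul_neq0 // qinv_neq0.
  by rewrite !E1 kE mulrA.
have sV := smoothV c0 sc.
exists psi'; split => //; split.
- by split; apply: smoothB => //; apply: smoothM.
- move=> c p v ac cp; rewrite -l2; exists (d (fun q => (chi q)^-1) c p v).
  have D (a b : X -> H) : smooth a -> smooth b -> form_eq (d b) (rmulf (d a) chi) ->
      d (fun p => b p * (chi p)^-1 - a p) c p v = b p * d (fun q => (chi q)^-1) c p v.
    move=> sa sb E; have da := smooth_sdiff sa ac cp; have db := smooth_sdiff sb ac cp.
    have dc := smooth_sdiff sV ac cp.
    rewrite (d_sub v (sdiffM db dc) da) (d_mul v cp db dc) E // /rmulf qmulK //.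
    by rewrite addrC addrA addNr add0r.
  by rewrite -(D _ _ s11 s21 e1) -(D _ _ s12 s22 e2).
- by move=> p; rewrite lk'; exact: direct_sum_lines.
Qed.

End Lines.

Section ParallelDarboux.
Variables (R : realType) (X : riemannSurface R) (f N : X -> quat R) (l : R[i]) (s : X -> quat R).
Local Notation H := (quat R).
Hypotheses (W : weak_cmc f N) (P : parallel N l s) (nt : nontrivial s).

Definition parallel_section p : H * H := (s p + f p * beta N l s p, beta N l s p).

Lemma smooth_parallel_fst : smooth (fst_sec parallel_section).
Proof.
have [ss _] := P; apply: smoothD => //; apply: smoothM; first exact: cmc_smooth W.
exact: smooth_beta W P.
Qed.

Lemma d_parallel_fst c p v : atlas c -> dom c p ->
  d (fst_sec parallel_section) c p v = f p * d (beta N l s) c p v.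
Proof.
move=> ac cp; have [ss _] := P.
have ds := smooth_sdiff ss ac cp; have df := smooth_sdiff (cmc_smooth W) ac cp.
have db : sdiff (beta N l s) c p := smooth_sdiff (smooth_beta W P) ac cp.
rewrite [LHS](d_add v ds (sdiffM df db)) (d_mul v cp df db) (d_parallel W v P) //.
by rewrite addKr.
Qed.

(** From d s = - df beta the differential is (f, 1) d beta, with values in the line of f; the
    splitting holds because [s], the component transversal to this line, has no zeros. *)
Lemma parallel_darboux_section : darboux_section f parallel_section.
Proof.
have s0 := parallel_neq0 W P nt; split.
- by split; [exact: smooth_parallel_fst|exact: smooth_beta W P].
- move=> c p v ac cp; rewrite d_parallel_fst //; exists (d (beta N l s) c p v).
  by rewrite /= mul1r.
move=> p; split=> [[v1 v2]|w [x ->] [y E]].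
  pose x := (s p)^-1 * (v1 - f p * v2).
  exists ((parallel_section p).1 * x, (parallel_section p).2 * x),
    (f p * (v2 - beta N l s p * x), 1 * (v2 - beta N l s p * x)); split.
  - by exists x.
  - by exists (v2 - beta N l s p * x).
  have sx : s p * x = v1 - f p * v2 by rewrite /x qmulVK.
  have A1 B : v1 = (s p + f p * B) * x + f p * (v2 - B * x).
    by rewrite mulrDl sx mulrBr -mulrA addrACA subrr addr0 subrK.
  have A2 B : v2 = B * x + 1 * (v2 - B * x) by rewrite mul1r addrC subrK.
  by congr pair; [exact: A1|exact: A2].
have /eqP : s p * x = 0.
  have E1 : (s p + f p * beta N l s p) * x = f p * y := congr1 fst E.
  have E2 : beta N l s p * x = 1 * y := congr1 snd E.
  move: E1; rewrite mul1r in E2; rewrite -E2 mulrDl -mulrA => E1.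
  by apply: (addIr (f p * (beta N l s p * x))); rewrite E1 add0r.
rewrite qmul_eq0 (negPf (s0 p)) /= => /eqP ->.
by rewrite !mulr0.
Qed.

Lemma parallel_section_of : (forall p, beta N l s p != 0) ->
  section_of (mu_transform f N l s) parallel_section.
Proof.
move=> b0 p; apply: span2_line => /=; first exact: b0.
by rewrite /mu_transform mulrDl qdivK // addrC.
Qed.

End ParallelDarboux.

Section CommonDarboux.
Variables (R : realType) (X : riemannSurface R) (f N al s0 : X -> quat R) (mu : R[i]).
Local Notation H := (quat R).
Implicit Types (c : chart R X) (p : X) (v : R * R).
Hypotheses (W : weak_cmc f N) (mu0 : mu != 0) (mu1 : mu != 1) (muN1 : mu != -1).
Hypotheses (P : parallel N mu al) (nt : nontrivial al).
Hypotheses (P0 : parallel N (-1) s0) (nt0 : nontrivial s0).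
Local Notation ca := (cplx (coef_a mu - 1)).
Local Notation cc := (cplx (coef_ratio mu)).
Local Notation b := (beta N mu al).

(** This is chi, found by dividing d beta_0 = - dg alpha_0 by d beta = 1/2 dg alpha (a - 1) from the
    left. *)
Definition bianchi_factor p := - (ca^-1 * (al p)^-1 * s0 p + ca^-1 * (al p)^-1 * s0 p).

Lemma N_neq0 p : N p != 0.
Proof.
apply/eqP => N0; have := gauss_sq W p; rewrite N0 mulr0 => /eqP.
by rewrite eq_sym oppr_eq0 oner_eq0.
Qed.

Lemma beta0_neq0 p : beta N (-1) s0 p != 0.
Proof.
by rewrite beta_neg1 oppr_eq0 qmul_neq0 ?N_neq0 // (parallel_neq0 W P0 nt0).
Qed.

Lemma mu_transform_neg1 p : mu_transform f N (-1) s0 p = f p + N p.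
Proof.
have s00 := parallel_neq0 W P0 nt0 p.
rewrite /mu_transform; congr (_ + _).
apply: (mulIr (x := beta N (-1) s0 p)); first by rewrite qunit beta0_neq0.
by rewrite qdivK ?beta0_neq0 // beta_neg1 mulrN mulrA (gauss_sq W) mulN1r opprK.
Qed.

Lemma d_beta0 c p v : atlas c -> dom c p ->
  d (beta N (-1) s0) c p v = - ((d f c p v + d N c p v) * s0 p).
Proof.
move=> ac cp; have ds := smooth_sdiff P0.1 ac cp.
have dN := smooth_sdiff (gauss_smooth W) ac cp.
rewrite (eq_d c p v (beta_neg1 N s0)) (d_opp v (sdiffM dN ds)) (d_mul v cp dN ds).
have E : d s0 c p v = d f c p v * (N p * s0 p).
  by rewrite (d_parallel W v P0) // beta_neg1 mulrN opprK.
have E' : N p * (d f c p v * (N p * s0 p)) = d f c p v * s0 p.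
  by rewrite mulrA (cmc_anti W) // mulNr -mulrA (mulrA (N p)) (gauss_sq W) mulN1r mulrN opprK.
by rewrite E E' mulrDl addrC.
Qed.

Lemma mid_normalE p : b p * ca^-1 * (al p)^-1 = mid_normal N al mu p.
Proof.
rewrite (beta_mid W mu0 mu1 P nt) !mulrA qmulK ?(ca_neq0 mu0 mu1) //.
by rewrite qmulK // (alpha_neq0 W P nt).
Qed.

Lemma mid_normal2 p : mid_normal N al mu p + mid_normal N al mu p = N p + ratio_conj al mu p.
Proof. exact: double_half. Qed.

Lemma bianchi_snd p : beta N (-1) s0 p - b p * bianchi_factor p = ratio_conj al mu p * s0 p.
Proof.
have E : b p * (ca^-1 * (al p)^-1 * s0 p) = mid_normal N al mu p * s0 p.
  by rewrite -mid_normalE !(mulrA (b p)).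
rewrite beta_neg1 /bianchi_factor mulrN opprK mulrDr E -mulrDl mid_normal2 mulrDl.
by rewrite addKr.
Qed.

(** Subtracting f times the second component from the first leaves alpha_0 - alpha chi = (1 + 2
    alpha (a - 1)^-1 alpha^-1) alpha_0, which is - c^2 alpha_0 by [ratio_conj_sq]; the second
    component is c alpha_0. *)
Lemma bianchi_fst p : s0 p + f p * beta N (-1) s0 p - (al p + f p * b p) * bianchi_factor p =
  dressed_surface f al mu p * (beta N (-1) s0 p - b p * bianchi_factor p).
Proof.
have e : al p * bianchi_factor p =
    - ((al p * ca^-1 * (al p)^-1 + al p * ca^-1 * (al p)^-1) * s0 p).
  by rewrite /bianchi_factor mulrN mulrDr !mulrA -mulrDl.
have sq : ratio_conj al mu p * ratio_conj al mu p =
    - (1 + (al p * ca^-1 * (al p)^-1 + al p * ca^-1 * (al p)^-1)).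
  exact: ratio_conj_sq W mu0 mu1 P nt p.
have S := bianchi_snd p; rewrite S.
move: (beta N (-1) s0 p) (b p) (bianchi_factor p) e S => B0 B x e S.
have -> : s0 p + f p * B0 - (al p + f p * B) * x = s0 p - al p * x + f p * (B0 - B * x).
  by rewrite mulrDl mulrBr opprD addrACA mulrA.
rewrite S e opprK /dressed_surface mulrBl (mulrA (ratio_conj al mu p)) sq.
by rewrite mulNr opprK (mulrDl 1) mul1r addrC.
Qed.

Lemma bianchi_factor_neq0 p : bianchi_factor p != 0.
Proof.
have x0 : ca^-1 * (al p)^-1 * s0 p != 0.
  by rewrite !qmul_neq0 ?qinv_neq0 ?(ca_neq0 mu0 mu1) ?(alpha_neq0 W P nt)
    ?(parallel_neq0 W P0 nt0).
rewrite oppr_eq0; apply: contraNneq x0 => E; apply/eqP; apply: qdouble_inj.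
by rewrite E addr0.
Qed.

Lemma smooth_bianchi_factor : smooth bianchi_factor.
Proof.
have s1 : smooth (fun p => ca^-1 * (al p)^-1 * s0 p).
  apply: smoothM; last exact: P0.1.
  apply: smoothM; first exact: smooth_cst.
  exact: smoothV (alpha_neq0 W P nt) P.1.
by apply: smoothN; exact: smoothD.
Qed.

Lemma d_beta_bianchi c p v : atlas c -> dom c p ->
  d (beta N (-1) s0) c p v = d b c p v * bianchi_factor p.
Proof.
move=> ac cp; rewrite d_beta0 // (d_beta W mu0 mu1 P) //.
rewrite /bianchi_factor mulrN -mulrDr; congr (- _).
move: (d f c p v + d N c p v) => G.
rewrite -!mulrA qmulVK ?(ca_neq0 mu0 mu1) // qmulVK ?(alpha_neq0 W P nt) //.
by rewrite !mulrDr double_half.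
Qed.

(** Here mu <> -1 enters: at mu = -1 the coefficient b vanishes and f_check would be f itself. *)
Lemma ratio_conj_neq0 p : ratio_conj al mu p != 0.
Proof.
by rewrite !qmul_neq0 ?qinv_neq0 ?(alpha_neq0 W P nt) // cplx_eq0 coef_ratio_neq0.
Qed.

Theorem bianchi_dressed :
  [/\ bianchi f (mu_transform f N mu al) (fun p => f p + N p) (dressed_surface f al mu),
    is_darboux (mu_transform f N mu al) (dressed_surface f al mu) &
    is_darboux (fun p => f p + N p) (dressed_surface f al mu)].
Proof.
have d1 := parallel_darboux_section W P nt.
have d2 := parallel_darboux_section W P0 nt0.
have l1 := parallel_section_of f (beta_alpha_neq0 W mu0 mu1 P nt).
have l2' := parallel_section_of f beta0_neq0.
have l2 : section_of (fun p => f p + N p) (parallel_section f N (-1) s0).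
  by rewrite -(_ : mu_transform f N (-1) s0 = fun p => f p + N p) //; apply/funext => p;
    exact: mu_transform_neg1.
have e2 : form_eq (d (snd_sec (parallel_section f N (-1) s0)))
    (rmulf (d (snd_sec (parallel_section f N mu al))) bianchi_factor).
  by move=> c p v ac cp; exact: d_beta_bianchi.
have e1 : form_eq (d (fst_sec (parallel_section f N (-1) s0)))
    (rmulf (d (fst_sec (parallel_section f N mu al))) bianchi_factor).
  move=> c p v ac cp; rewrite /rmulf (d_parallel_fst W P) // (d_parallel_fst W P0) //.
  by rewrite d_beta_bianchi // mulrA.
have s00 := parallel_neq0 W P0 nt0.
have [[s11 s12] _ _] := d1; have [[s21 s22] _ _] := d2.
have n0 p : beta N (-1) s0 p - b p * bianchi_factor p != 0.
  by rewrite bianchi_snd qmul_neq0 ?ratio_conj_neq0.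
have k1 p : dressed_surface f al mu p != mu_transform f N mu al p.
  rewrite mu_transform_dressed -subr_eq0 opprD addrA subrr add0r oppr_eq0.
  apply/eqP => E; have := dressed_gauss_sq W mu0 mu1 P nt p; rewrite E mulr0 => /eqP.
  by rewrite eq_sym oppr_eq0 oner_eq0.
have k2 p : dressed_surface f al mu p != f p + N p.
  have := mid_normal_neq0 W mu0 mu1 P nt p; apply: contraNneq => E.
  apply/eqP; apply: qdouble_inj; rewrite mid_normal2 addr0.
  apply: (addrI (f p)); rewrite addrA -E /dressed_surface subrK addr0 //.
have [l3 D1 D2] := bianchi_common_darboux s11 s12 s21 s22 smooth_bianchi_factor
  bianchi_factor_neq0 e1 e2 l1 l2 n0 bianchi_fst k1 k2.
split => //.
exists (parallel_section f N mu al), (parallel_section f N (-1) s0), bianchi_factor; split => //;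
  exact: smooth_bianchi_factor.
Qed.

End CommonDarboux.

(** * Simple factor dressing *)

Section ComplexSplitting.
Variable R : realType.
Local Notation H := (quat R).
Local Notation I := (quat_i R).
Implicit Types (g x y : H) (z k m : R[i]).

(** The components in H = C + C j, written with multiplications by i rather than with coordinates so
    that the rules for [d] apply to them. *)
Definition complex_part x := 2^-1 * (x - I * x * I).
Definition anti_part x := 2^-1 * (x + I * x * I).
Definition split_scale g x := complex_part x * g + anti_part x.

Lemma complex_partE x : complex_part x = Quat (q1 x) (qi x) 0 0.
Proof. by rewrite /complex_part half_rq; apply: quat_ext => /=; field. Qed.

Lemma anti_partE x : anti_part x = Quat 0 0 (qj x) (qk x).
Proof. by rewrite /anti_part half_rq; apply: quat_ext => /=; field. Qed.

Lemma complex_anti x : complex_part x + anti_part x = x.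
Proof. by rewrite complex_partE anti_partE; apply: quat_ext; rewrite /= ?addr0 ?add0r. Qed.

Lemma split_scale1 x : split_scale 1 x = x.
Proof. by rewrite /split_scale mulr1 complex_anti. Qed.

Lemma split_scaleD g x y : split_scale g (x + y) = split_scale g x + split_scale g y.
Proof.
rewrite /split_scale !complex_partE !anti_partE addrACA -mulrDl.
by congr (_ * _ + _); apply: quat_ext; rewrite /= ?addr0.
Qed.

(** [m] commutes with the part of [x] in C and passes the part in C j as its conjugate, so x k - m x
    scales the two parts by k - m and k - conj m. *)
Lemma split_scale_ratio k m z x : z * (k - conjc m) = k - m ->
  split_scale (cplx z) x * cplx (k - conjc m) = x * cplx k - cplx m * x.
Proof.
move=> E; rewrite /split_scale mulrDl -mulrA -cplxM E complex_partE anti_partE.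
by clear; case: k m x => [? ?] [? ?] [? ? ? ?]; qring.
Qed.

Definition cspan_at (a : H) : set H := [set w | exists z : R[i], w = a * cplx z].

Lemma cplx_split z z' : complex_part (cplx z + cplx z' * quat_j R) = cplx z /\
  anti_part (cplx z + cplx z' * quat_j R) = cplx z' * quat_j R.
Proof.
by case: z z' => [? ?] [? ?]; rewrite complex_partE anti_partE; split; qring.
Qed.

Lemma complex_part_cplx x : complex_part x = cplx (Complex (q1 x) (qi x)).
Proof. exact: complex_partE. Qed.

Lemma anti_part_cplx x : anti_part x = cplx (Complex (qj x) (qk x)) * quat_j R.
Proof. by rewrite anti_partE; qring. Qed.

Lemma cspan_direct_sum a : a != 0 -> direct_sum (cspan_at a) (timesj (cspan_at a)).
Proof.
move=> a0; split=> [v|v [z E] [_ [z' ->] E']].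
  exists (a * complex_part (a^-1 * v)), (a * anti_part (a^-1 * v)); split.
  - by rewrite complex_part_cplx; eexists.
  - rewrite anti_part_cplx mulrA.
    by exists (a * cplx (Complex (qj (a^-1 * v)) (qk (a^-1 * v)))) => //; eexists.
  - by rewrite -mulrDr complex_anti qmulVK.
have E2 : cplx z = cplx z' * quat_j R.
  by rewrite -(qVmulK (cplx z) a0) -E -E' -mulrA qVmulK.
have [e1 _] := cplx_split 0 z'; have [e2 _] := cplx_split z 0.
rewrite cplx0 add0r -E2 in e1; rewrite cplx0 mul0r addr0 e1 in e2.
by rewrite E -e2 mulr0.
Qed.

Lemma proj_cspan a x : a != 0 ->
  Defs.proj (cspan_at a) (timesj (cspan_at a)) (a * x) = a * complex_part x /\
  Defs.proj (timesj (cspan_at a)) (cspan_at a) (a * x) = a * anti_part x.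
Proof.
move=> a0.
have U z z' : a * x = a * cplx z + a * cplx z' * quat_j R ->
    cplx z = complex_part x /\ cplx z' * quat_j R = anti_part x.
  rewrite -mulrA -mulrDr => E; have {E}-> : x = cplx z + cplx z' * quat_j R.
    by rewrite -(qVmulK x a0) E qVmulK.
  by have [-> ->] := cplx_split z z'.
have M1 : cspan_at a (a * complex_part x) by rewrite complex_part_cplx; eexists.
have M2 : timesj (cspan_at a) (a * anti_part x).
  rewrite anti_part_cplx mulrA; exists (a * cplx (Complex (qj x) (qk x))) => //; by eexists.
have D1 : a * x - a * complex_part x = a * anti_part x.
  by rewrite -{1}(complex_anti x) mulrDr addrC addKr.
have D2 : a * x - a * anti_part x = a * complex_part x.
  by rewrite -{1}(complex_anti x) mulrDr addrK.
split; apply: xget_unique.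
- by split; rewrite ?D1.
- move=> y [[z ->] [_ [z' ->] E]].
  by have /U[<- _] : a * x = a * cplx z + a * cplx z' * quat_j R by rewrite E addrC subrK.
- by split; rewrite ?D2.
- move=> y [[_ [z' ->] <-] [z E]].
  have /U[_ <-] : a * x = a * cplx z + a * cplx z' * quat_j R by rewrite -E subrK.
  by rewrite mulrA.
Qed.

End ComplexSplitting.

(** Here [n], [w], [b'] are N, df, beta carried to the frame alpha: alpha^-1 N alpha, alpha^-1 df
    alpha, alpha^-1 beta. In this frame E is C and the gauge equation becomes [gauge_identity]. *)
Lemma gauge_transport_l (R : realType) (a b F N S B nc n w b' ca r A Bc : quat R) :
  ca != 0 -> a * b' = b -> a * w = F * a -> a * n = N * a -> b = S * (a * ca) ->
  B * a = b -> B * nc = N * B ->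
  - (F * b * r) + - (S * F * B + S * F * B) * (2^-1 * (nc * (a * r) * A + a * r * Bc)) =
  a * (- (w * b' * r) - b' * ca^-1 * w * (n * b' * r * A + b' * r * Bc)).
Proof.
move=> ca0 e1 e2 e3 eb eB eN.
have e4 : B * (nc * (a * r) * A + a * r * Bc) = N * b * r * A + b * r * Bc.
  by rewrite mulrDr !mulrA eN -(mulrA N B a) eB.
have e5 : a * (n * b' * r * A + b' * r * Bc) = N * b * r * A + b * r * Bc.
  by rewrite mulrDr !mulrA e3 -(mulrA N a b') e1.
have e6 : a * (b' * ca^-1 * w) = S * F * a.
  by rewrite !mulrA e1 eb !mulrA qmulK // -!mulrA e2.
have e7 : a * (w * b' * r) = F * b * r by rewrite !mulrA e2 -(mulrA F a b') e1.
rewrite mulrBr mulrN e7 (mulrA a) e6 -(mulrA _ a) e5 -e4 mulNr; congr (_ - _).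
by move: (_ + a * r * Bc) => Y; rewrite halfM mulrDl mulrDr double_half mulrA.
Qed.

Lemma gauge_transport_r (R : realType) (a b F N n w b' x A Bc : quat R) :
  a != 0 -> a * b' = b -> a * w = F * a -> a * n = N * a ->
  a^-1 * (- (F * b * x) + F * (2^-1 * (N * (a * x) * A + a * x * Bc))) =
  - (w * b' * x) + 2^-1 * (w * (n * x * A + x * Bc)).
Proof.
move=> a0 e1 e2 e3.
rewrite -[RHS](qVmulK _ a0); congr (_ * _); rewrite [RHS]mulrDr [a * - _]mulrN !halfM.
congr (- _ + 2^-1 * _); first by rewrite !mulrA e2 -(mulrA F a b') e1.
by rewrite (mulrA a w) e2 -(mulrA F a) [a * (_ + _)]mulrDr !mulrA e3.
Qed.

Section SimpleFactor.
Variables (R : realType) (X : riemannSurface R) (f N al : X -> quat R) (mu : R[i]).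
Local Notation H := (quat R).
Implicit Types (c : chart R X) (p : X) (v : R * R) (s : X -> H) (l : R[i]).
Hypotheses (W : weak_cmc f N) (mu0 : mu != 0) (mu1 : mu != 1).
Hypotheses (P : parallel N mu al) (nt : nontrivial al).
Local Notation ca := (cplx (coef_a mu - 1)).
Local Notation cc := (cplx (coef_ratio mu)).
Local Notation b := (beta N mu al).
Local Notation hc := (fun p => dressed_surface f al mu p + rq (complex.Re (coef_ratio mu))).
Local Notation Nc := (dressed_gauss N al mu).

Let a0 := alpha_neq0 W P nt.

Lemma dress_alpha l p x : dress (cspan al) mu l p (al p * x) =
  al p * split_scale (cplx (dress_factor mu l)) x.
Proof.
have [E1 E2] := proj_cspan x (a0 p).
by rewrite /split_scale mulrDr mulrA -E1 -E2.
Qed.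

Lemma smooth_split_scale g s : smooth s -> smooth (fun p => split_scale g (s p)).
Proof.
move=> ss; have cst q := @smooth_cst R X q.
have s1 : smooth (fun p => quat_i R * s p * quat_i R).
  by apply: smoothM => //; exact: smoothM.
apply: smoothD; last by apply: smoothM => //; exact: smoothD.
by apply: smoothM => //; apply: smoothM => //; exact: smoothB.
Qed.

Lemma d_split_scale g s c p v : dom c p -> sdiff s c p ->
  d (fun q => split_scale g (s q)) c p v = split_scale g (d s c p v).
Proof.
move=> cp ss; have cst q := @sdiff_cst R X q c p.
have s1 : sdiff (fun p => quat_i R * s p) c p := sdiffM (cst _) ss.
have s2 : sdiff (fun p => quat_i R * s p * quat_i R) c p := sdiffM s1 (cst _).
have sN := sdiffN s2.
have s3 : sdiff (fun p => s p - quat_i R * s p * quat_i R) c p := sdiffD ss sN.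
have s4 : sdiff (fun p => s p + quat_i R * s p * quat_i R) c p := sdiffD ss s2.
have s5 : sdiff (fun p => complex_part (s p)) c p := sdiffM (cst _) s3.
have s6 : sdiff (fun p => anti_part (s p)) c p := sdiffM (cst _) s4.
have s7 : sdiff (fun p => complex_part (s p) * g) c p := sdiffM s5 (cst _).
have dI : d (fun p => quat_i R * s p * quat_i R) c p v = quat_i R * d s c p v * quat_i R.
  by rewrite (d_mulr _ v cp s1) (d_mull _ v cp ss).
rewrite [LHS](d_add v s7 s6) (d_mulr _ v cp s5).
rewrite [d (fun p => complex_part _) _ _ _](d_mull _ v cp s3) (d_sub v ss s2) dI.
by rewrite [d (fun p => anti_part _) _ _ _](d_mull _ v cp s4) (d_add v ss s2) dI.
Qed.

Lemma dressing_identity l F x p : l != 0 -> l != (conjc mu)^-1 -> N p * F = - (F * N p) ->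
  let g := cplx (dress_factor mu l) in
  let A := cplx (coef_a l - 1) in let Bc := cplx (coef_b l) in
  - (F * b p * split_scale g x) +
  - (mid_normal N al mu p * F * beta_quot N al mu p + mid_normal N al mu p * F * beta_quot N al mu p)
    * (2^-1 * (Nc p * (al p * split_scale g x) * A + al p * split_scale g x * Bc)) =
  al p * split_scale g ((al p)^-1 * (- (F * b p * x)
    + F * (2^-1 * (N p * (al p * x) * A + al p * x * Bc)))).
Proof.
move=> l0 lm NF g A Bc.
set r := split_scale g x.
pose n := (al p)^-1 * N p * al p; pose w := (al p)^-1 * F * al p; pose b' := (al p)^-1 * b p.
have n2 : n * n = -1.
  rewrite /n -!mulrA (mulrA (al p)) qdivv // mul1r (mulrA (N p)) (gauss_sq W) mulN1r mulrN.
  by rewrite qmulV.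
have nw : n * w = - (w * n).
  rewrite /n /w -!mulrA !(mulrA (al p) (al p)^-1) !qdivv // !mul1r.
  by rewrite (mulrA (N p)) NF mulNr mulrN -!mulrA.
have b'E : b' = 2^-1 * ((n + cc) * ca).
  rewrite /b' (betaE N al mu0 mu1) halfM mulrDr mulrDl !mulrA qmulV // mul1r.
  by rewrite ca_comm.
have e1 : al p * b' = b p by rewrite /b' qmulVK.
have e2 : al p * w = F * al p by rewrite /w -mulrA qmulVK.
have e3 : al p * n = N p * al p by rewrite /n -mulrA qmulVK.
rewrite (gauge_transport_l r A Bc (ca_neq0 mu0 mu1) e1 e2 e3 (beta_mid W mu0 mu1 P nt p)
  (qdivK (b p) (a0 p)) (beta_quot_gauss W mu0 mu1 P nt p)).
rewrite (gauge_transport_r x A Bc (a0 p) e1 e2 e3); congr (_ * _).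
(* The Cayley coordinate has its pole at l = 1; there both families are d and the dressing is the
   identity. *)
have [l1|l1] := eqVneq l 1.
  have A0 : A = 0.
    by rewrite /A l1 /coef_a invr1 -mulr2n divff ?pnatr_eq0 // subrr.
  have B0 : Bc = 0.
    by rewrite /Bc l1 /coef_b invr1 subrr mulr0 mul0r.
  have g1 : g = 1 by rewrite /g l1 dress_factor1.
  by rewrite /r A0 B0 !mulr0 addr0 mulr0 subr0 mulr0 mulr0 addr0 g1 !split_scale1.
have BE : Bc = A * cplx (coef_ratio l) by rewrite /Bc /A coef_bE // cplxM.
rewrite BE b'E.
apply: (@gauge_identity _ n w ca cc (cplx (coef_ratio l)) A
  (cplx (coef_ratio l - conjc (coef_ratio mu))) x (split_scale g)) => //.
- exact: ca_neq0.
- exact: ca_comm.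
- exact: cc_sq.
- rewrite -cplxM -cplx1 -cplxD -expr2 coef_ratio_sq // -cplxM mulrC divfK ?coef_a_neq1 //.
  exact: cplxN2.
- exact: cplx_comm.
- exact: cplx_comm.
- exact: cplx_comm.
- by rewrite cplx_eq0 conj_coef_neq.
- by move=> u; apply: split_scale_ratio; rewrite dress_factorE // divfK // conj_coef_neq.
Qed.

Lemma d_dressed_shift (q : H) c p v : atlas c -> dom c p ->
  d (fun p => dressed_surface f al mu p + q) c p v = d (dressed_surface f al mu) c p v.
Proof.
move=> ac cp; have sd := smooth_sdiff (smooth_dressed W P nt) ac cp.
by rewrite (d_add v sd (sdiff_cst _ _ _)) d_cst addr0.
Qed.

Lemma dressing_gauge l s : l != 0 -> l != (conjc mu)^-1 -> smooth s ->
  form_eq (assoc Nc l (fun p => dress (cspan al) mu l p (s p)))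
          (fun c p v => dress (cspan al) mu l p (assoc N l s c p v)).
Proof.
move=> l0 lm ss c p v ac cp.
pose x q := (al q)^-1 * s q; pose g := cplx (dress_factor mu l).
have sx : smooth x by apply: smoothM => //; exact: smoothV a0 P.1.
have sE q : s q = al q * x q by rewrite /x qmulVK.
have -> : (fun p => dress (cspan al) mu l p (s p)) = (fun p => al p * split_scale g (x p)).
  by apply/funext => q; rewrite sE dress_alpha.
have dal := smooth_sdiff P.1 ac cp; have dx := smooth_sdiff sx ac cp.
have dr := smooth_sdiff (smooth_split_scale g sx) ac cp.
rewrite (assoc_cmc (dressed_cmc W mu0 mu1 P nt)) // d_dressed_shift //.
rewrite (d_mul v cp dal dr) (d_split_scale g v cp dx) (d_alpha W P) // mulNr.
rewrite (d_dressed W mu0 mu1 P nt) // [beta Nc _ _ _]/beta.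
rewrite (assoc_cmc W) // (eq_d c p v sE) (d_mul v cp dal dx) (d_alpha W P) //.
rewrite [beta N l _ _]/beta sE [- (_ * b p) * x p]mulNr.
have I := dressing_identity (x p) l0 lm (cmc_anti W v ac cp).
move: I; rewrite /= -/g => I.
rewrite addrAC I [in RHS]addrAC -[X in dress _ _ _ _ X](qmulVK _ (a0 p)) dress_alpha -/g.
rewrite -mulrDr -split_scaleD; congr (_ * split_scale g _).
by rewrite [RHS]mulrDr qVmulK.
Qed.

(** Sections of E are alpha z with z complex, and d^N_mu (alpha z) = alpha dz as alpha is
    parallel. *)
Lemma stable_alpha : stable N mu (cspan al).
Proof.
move=> U s oU sU Es c p v ac cp Up.
have qs : qsmooth (img c `&` cinv c @^-1` U) (s \o cinv c) := sU c ac.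
have [ip Ep] := coord_img cp.
have ds : sdiff s c p by apply: (qsmooth_qdiff qs); split => //=; rewrite Ep.
pose z q := (al q)^-1 * s q.
have dal := smooth_sdiff P.1 ac cp.
have dz : sdiff z c p by apply: sdiffM => //; exact: sdiffV.
have sE q : s q = al q * z q by rewrite /z qmulVK.
have Ez q : U q -> exists t, z q = cplx t.
  by move=> /Es[t E]; exists t; rewrite /z E qVmulK.
(* That z is complex is expressed by the vanishing of its part in C j, a condition that can be
   differentiated. *)
have nz : \forall q \near p, split_scale 0 (z q) = 0.
  have nU : \near p, U p by apply: open_nbhs_nbhs.
  apply: filterS nU => q /Ez[t ->].
  rewrite /split_scale mulr0 add0r anti_partE.
  by apply: quat_ext.
have z0 : anti_part (d z c p v) = 0.
  have := near_eq_d v cp nz; rewrite (d_split_scale 0 v cp dz) d_cst.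
  by rewrite /split_scale mulr0 add0r.
have [t Et] := Ez p Up.
exists (Complex (q1 (d z c p v)) (qi (d z c p v))).
rewrite -complex_part_cplx -[complex_part _]addr0 -z0 complex_anti.
rewrite (assoc_cmc W) // (eq_d c p v sE) (d_mul v cp dal dz) (d_alpha W P) //.
have -> : beta N mu s p = b p * z p.
  rewrite /beta sE Et -(mulrA 2^-1) mulrDl -!mulrA.
  by rewrite (cplx_comm t) (cplx_comm t).
by rewrite mulNr mulrA addrAC addNr add0r.
Qed.

Theorem dressed_is_dressing : immersion f ->
  is_simple_factor_dressing N mu (cspan al) hc.
Proof.
move=> imm; split.
- move=> p; exists setT, al; split => //; first exact: openT.
    exact: P.1.
  by move=> q _; split => //; apply/eqP.
- by move=> p; exact: cspan_direct_sum (a0 p).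
- exact: stable_alpha.
exists Nc; split.
  by split; [exact: dressed_cmc W mu0 mu1 P nt|exact: (@dressed_immersion R X f N al mu W mu0 mu1 P nt _ imm)].
by move=> l l0 _ lm s; exact: dressing_gauge.
Qed.

(** As mu <> -1, the value l = -1 differs from mu and 1 / conj mu, so r_l is invertible there. Since
    d^N at l = -1 is d + df after J, two dressings of the nowhere zero section [t] have the same df
    after J, hence the same df. *)
Theorem dressing_unique h : mu != -1 -> is_simple_factor_dressing N mu (cspan al) h ->
  exists q, forall p, h p = dressed_surface f al mu p + q.
Proof.
move=> muN1 [_ _ _ [N' [[W' _] G']]].
have mN : -1 != mu by rewrite eq_sym.
have mN' : -1 != (conjc mu)^-1.
  apply: contraNneq muN1 => E; apply/eqP; apply: (fmorph_inj (@conjc R)).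
  by transitivity ((conjc mu)^-1)^-1; [rewrite invrK|rewrite -E invrN1 rmorphN1].
have n0 : -1 != 0 :> R[i] by rewrite oppr_eq0 oner_eq0.
have sal : smooth al := P.1.
have WN := dressed_cmc W mu0 mu1 P nt.
pose t p := dress (cspan al) mu (-1) p (al p).
have t0 p : t p != 0.
  rewrite /t -[X in dress _ _ _ _ X]mulr1 dress_alpha qmul_neq0 //.
  have -> : split_scale (cplx (dress_factor mu (-1))) 1 = cplx (dress_factor mu (-1)).
    by rewrite /split_scale complex_partE anti_partE; qring.
  by rewrite cplx_eq0 dress_factor_neq0.
have dE c p v : atlas c -> dom c p -> d h c p v = d hc c p v.
  move=> ac cp; have [w ->] := rotJ_surj v.
  have E1 := G' (-1) n0 mN mN' al sal c p w ac cp.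
  have E2 := dressing_gauge n0 mN' sal w ac cp.
  have : assoc N' (-1) t c p w = assoc Nc (-1) t c p w := etrans E1 (esym E2).
  rewrite (assoc_cmc W' _ _ _ ac cp) (assoc_cmc WN _ _ _ ac cp) !beta_neg1.
  rewrite !mulrN => /addrI/oppr_inj.
  rewrite (cmc_starr W' w ac cp) (cmc_starr WN w ac cp).
  move: (d h c p w) (d hc c p w) (N' p) (Nc p) (t p) (t0 p) => F G n m u u0.
  by rewrite !mulrA => E; congr (- _); apply: (mulIr (x := u)); rewrite ?qunit.
have [p0 _] := nt.
have sh := cmc_smooth W'; have shc := cmc_smooth WN.
exists (h p0 - dressed_surface f al mu p0) => p.
have E : h p - hc p = h p0 - hc p0.
  apply: (@d_eq0_cst _ _ (fun p => h p - hc p)); first exact: smoothB.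
  move=> c q v ac cq.
  by rewrite (d_sub v (smooth_sdiff sh ac cq) (smooth_sdiff shc ac cq)) dE // subrr.
move: E; move: (rq _) (h p) (h p0) (dressed_surface _ _ _ p) (dressed_surface _ _ _ p0).
move=> r x x0 y y0 /eqP; rewrite subr_eq => /eqP ->.
by clear; qring.
Qed.

End SimpleFactor.

(** f - m = - N has length 1; in this way the exclusion of round spheres makes g nonconstant. *)
Lemma parallel_surface_constant_round (R : realType) (X : riemannSurface R) (f N : X -> quat R)
    (m : quat R) (p0 : X) :
  weak_cmc f N -> (forall p, f p + N p = m) -> round_sphere f.
Proof.
move=> W E; have [_ If IN _ _] := W.
exists m, 1; split; [|exact: ltr01|move=> p].
  by move: (If p0) (IN p0).1; rewrite /imaginary -(E p0) /= => -> ->; rewrite addr0.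
have -> : f p - m = - N p by rewrite -(E p) opprD addrA subrr add0r.
have [N0 NN] := IN p; rewrite /imaginary in N0.
have := congr1 (@q1 R) NN; rewrite /= N0 /qnorm2 /= N0 => h.
by rewrite expr1n; lra.
Qed.

Theorem theorem4p17 (R : realType) (M Mt : riemannSurface R) (pr : Mt -> M)
    (f N : M -> quat R) (mu : R[i]) (alpha : Mt -> quat R)
    (Mt_universal : universal_cover pr)
    (f_cmc : cmc_surface f N)
    (f_not_sphere : ~ round_sphere f)
    (mu0 : mu != 0) (mu1 : mu != 1) (muN1 : mu != -1)
    (alpha_parallel : parallel (N \o pr) mu alpha)
    (alpha_nontrivial : nontrivial alpha) :
  let ft := f \o pr in
  let Nt := N \o pr in
  let f_mu := mu_transform ft Nt mu alpha in
  let g := fun p => ft p + Nt p in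
  let f_check := fun p =>
    ft p - alpha p * cplx (coef_b mu / (coef_a mu - 1)) * (alpha p)^-1 in
  let dressing := is_simple_factor_dressing Nt mu (cspan alpha) in
  (* up to translation, the simple factor dressing is f_check *)
  [/\ exists c, dressing (fun p => f_check p + c),
      forall h, dressing h -> exists c, forall p, h p = f_check p + c,
      two_step_darboux ft f_check
  (* the mu-Darboux transform f_mu and the parallel CMC surface g *)
    & [/\ forall p, alpha p <> 0 /\ beta Nt mu alpha p <> 0,
          weak_cmc g (fun p => - Nt p) /\ (exists p q, g p <> g q),
          is_mu_darboux ft Nt (-1) g,
          bianchi ft f_mu g f_check
        & is_darboux f_mu f_check /\ is_darboux g f_check]].
Proof.
move=> ft Nt f_mu g f_check dressing.
have [W0 imm0] := f_cmc; have [hpr cpr sc] := Mt_universal.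
have W : weak_cmc ft Nt := weak_cmc_pullback hpr W0.
have imm : immersion ft by apply: immersion_pullback => //; exact: cmc_smooth W0.
have P := alpha_parallel; have nt := alpha_nontrivial; have [p0 _] := nt.
have [s [Ps s1]] := neg_one_parallel W p0 sc.
have nts : nontrivial s by exists p0; rewrite s1; apply/eqP; exact: oner_neq0.
have [B D1 D2] := bianchi_dressed W mu0 mu1 muN1 P nt Ps nts.
split.
- by exists (rq (complex.Re (coef_ratio mu))); exact: dressed_is_dressing W mu0 mu1 P nt imm.
- by move=> h; exact: dressing_unique W mu0 mu1 P nt _ muN1.
- by exists f_mu, g.
split.
- by move=> p; split; apply/eqP; [exact: alpha_neq0 W P nt p|exact: beta_alpha_neq0 W mu0 mu1 P nt p].
- split; first exact: parallel_surface_cmc W.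
  (* A constant g on the cover makes f + N constant on M, because the projection is onto. *)
  apply: contrapT => nE; apply: f_not_sphere.
  apply: (parallel_surface_constant_round (m := g p0) (pr p0) W0) => q.
  have [_ /(_ q)[q' <-] _] := cpr.
  by apply: contrapT => ne; apply: nE; exists q', p0.
- exists s; split => //.
    by move=> p; apply/eqP; exact: beta0_neq0 W Ps nts p.
  by move=> p; rewrite (mu_transform_neg1 W Ps nts).
- exact: B.
- by split; [exact: D1|exact: D2].
Qed.
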